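(* For any $\beta\in(0,1/2)$ there are constants $C_2,C_3,C_4,C_5,C_6>0$ such that the following holds for all $\delta<1/2$ and $n\ge 4$ for any dataset satisfying the cluster assumptions below with parameters $\epsilon,r,\Delta$. If $\Delta<C_2$, $r<C_2$, $\epsilon<C_2$, $\alpha_0=p^{-(1/2+\beta)}$, $\sigma=p^{-(1/2+\beta/2)}$, $h=1/p$, and $p\ge \ln^{C_3}(nd/\delta)$, then: (a) with probability at least $1-\delta$, $L(\theta^{(1)})\le \exp(-C_4\,p^{1/2-\beta})$; (b) if for all $t\ge1$ the step-sizes are $\alpha_t=\frac{C_5\log^2(1/L(\theta^{(t)}))}{p}$, then with probability at least $1-\delta$, for all $t>1$, \[ L(\theta^{(t)})\le \frac{C_6\,d}{p^{1-3\beta}\,t}. \]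
   Context: $\log$ and $\ln$ denote the natural logarithm. The Huberized ReLU with bandwidth $h>0$ is $\phi(z)=0$ for $z<0$, $\phi(z)=z^2/(2h)$ for $z\in[0,h]$, $\phi(z)=z-h/2$ for $z>h$. The network has $2p$ hidden units with input weights $v_i\in\mathbb{R}^d$ and biases $b_i\in\mathbb{R}$; output weights are fixed: $u_1=\cdots=u_p=1$, $u_{p+1}=\cdots=u_{2p}=-1$. Trainable parameters $\theta=(v_1,b_1,\ldots,v_{2p},b_{2p})$; $f_\theta(x)=\sum_{i=1}^{2p}u_i\phi(v_i\cdot x+b_i)$; training loss $L(\theta)=\frac1n\sum_{s=1}^n\ln(1+\exp(-y_sf_\theta(x_s)))$ on data $(x_1,y_1),\ldots,(x_n,y_n)\in\mathbb{R}^d\times\{-1,1\}$. Initialization: all entries of $\theta^{(0)}$ are drawn independently from $\mathcal N(0,\sigma^2)$; then $\theta^{(t+1)}=\theta^{(t)}-\alpha_t\nabla_\theta L(\theta^{(t)})$ for $t\ge0$, with initial step-size $\alpha_0$. Cluster assumptions: the index set $[n]$ is partitioned into four clusters $\mathcal K_1,\ldots,\mathcal K_4$; all examples in $\mathcal K_1,\mathcal K_2$ have label $1$ and all in $\mathcal K_3,\mathcal K_4$ have label $-1$ (write $y_k$ for the common label of $\mathcal K_k$); for some $\epsilon>0$ each $n_k=|\mathcal K_k|$ satisfies $(1/4-\epsilon)n\le n_k\le(1/4+\epsilon)n$; $\lVert x_s\rVert=1$ for all $s$; for some $r>0$ each cluster $\mathcal K_k$ has a center $\mu_k$ with $\lVert\mu_k\rVert=1$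 and $\lVert x_s-\mu_k\rVert\le r$ for all $s\in\mathcal K_k$; for some $\Delta>0$, $\mu_k\cdot\mu_\ell\le\Delta$ whenever $y_k\ne y_\ell$. The probability is over the random initialization. *)

(* Defs.v *)
From HB Require Import structures.
From mathcomp Require Import all_boot all_order all_algebra.
From mathcomp Require Import all_classical all_reals all_analysis.
Set Implicit Arguments. Unset Strict Implicit. Unset Printing Implicit Defensive.
Import Order.TTheory GRing.Theory Num.Theory.
Local Open Scope classical_set_scope.
Local Open Scope ring_scope.

Section Defs.
Variable R : realType.

Definition dotv (d : nat) (a b : 'rV[R]_d) : R := \sum_(j < d) a 0 j * b 0 j.
Definition enorm (d : nat) (a : 'rV[R]_d) : R := Num.sqrt (dotv a a).

Definition huber_relu (h z : R) : R :=
  if z < 0 then 0 else if z <= h then z ^+ 2 / (h *+ 2) else z - h / 2.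

(* Parameters theta : 'M_(2p, d+1); row i is (v_i, b_i): columns j < d hold
   v_i, the last column (ord_max) holds the bias b_i. *)
Definition vw (p d : nat) (th : 'M[R]_(p.*2, d.+1)) (i : 'I_(p.*2)) : 'rV[R]_d :=
  \row_(j < d) th i (widen_ord (leqnSn d) j).
Definition bias (p d : nat) (th : 'M[R]_(p.*2, d.+1)) (i : 'I_(p.*2)) : R :=
  th i ord_max.

Definition outw (p : nat) (i : 'I_(p.*2)) : R := if (i < p)%N then 1 else -1.

Definition net (p d : nat) (h : R) (th : 'M[R]_(p.*2, d.+1)) (x : 'rV[R]_d) : R :=
  \sum_(i < p.*2) outw i * huber_relu h (dotv (vw th i) x + bias th i).

Definition loss (p d n : nat) (h : R) (X : 'I_n -> 'rV[R]_d) (Y : 'I_n -> R)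
    (th : 'M[R]_(p.*2, d.+1)) : R :=
  n%:R^-1 * \sum_(s < n) ln (1 + expR (- (Y s * net h th (X s)))).

Definition grad (m k : nat) (F : 'M[R]_(m, k) -> R) (th : 'M[R]_(m, k)) : 'M[R]_(m, k) :=
  \matrix_(i, j) (derive1 (fun t : R => F (th + t *: delta_mx i j)) 0).

Fixpoint gd (m k : nat) (F : 'M[R]_(m, k) -> R) (step : nat -> 'M[R]_(m, k) -> R)
    (th0 : 'M[R]_(m, k)) (t : nat) : 'M[R]_(m, k) :=
  match t with
  | 0 => th0
  | t'.+1 => let th := gd F step th0 t' in th - step t' th *: grad F th
  end.

(* Product Gaussian measure: all coordinates i.i.d. N(0, sigma^2), computed by
   iterated (Tonelli) integration over the coordinates listed in s. *)
Fixpoint gauss_iter (sigma : R) (I : eqType) (s : seq I) (S : set (I -> R))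
    (f : I -> R) : \bar R :=
  match s with
  | [::] => (\1_S f)%:E
  | i :: s' => (\int[lebesgue_measure]_x
       ((normal_pdf 0 sigma x)%:E *
        gauss_iter sigma s' S (fun j => if j == i then x else f j)))%E
  end.

Definition gauss_prob (sigma : R) (I : finType) (S : set (I -> R)) : \bar R :=
  gauss_iter sigma (enum I) S (fun _ => 0).

Definition gauss_mx_prob (sigma : R) (m k : nat) (S : set 'M[R]_(m, k)) : \bar R :=
  gauss_prob sigma [set g : 'I_m * 'I_k -> R | S (\matrix_(i, j) g (i, j))].

Definition cluster_data (n d : nat) (X : 'I_n -> 'rV[R]_d) (Y : 'I_n -> R)
    (eps r Delta : R) : Prop :=
  exists (c : 'I_n -> 'I_4) (mu : 'I_4 -> 'rV[R]_d),
    let lab (k : 'I_4) : R := if (k < 2)%N then 1 else -1 in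
    [/\ (forall s, Y s = lab (c s)),
        (forall s, enorm (X s) = 1) /\ (forall k, enorm (mu k) = 1),
        (forall k : 'I_4, (4^-1 - eps) * n%:R <= #|[pred s | c s == k]|%:R
                        /\ #|[pred s | c s == k]|%:R <= (4^-1 + eps) * n%:R),
        (forall s, enorm (X s - mu (c s)) <= r)
      & (forall k l, lab k != lab l -> dotv (mu k) (mu l) <= Delta)].

End Defs.

(* Main.v *)
(** At initialization a hidden unit has preactivation [v.x + b], a Gaussian of
    scale [sigma] that is much larger than both the bandwidth [1/p] and the
    step [alpha0].  Hence, away from the few units whose preactivation is near
    zero, the first step moves the output on [x_s] by [alpha0] times a sum over
    the units active on [x_s] of correlations with the examples on which they
    are active.  Own-cluster examples contribute [1/4 * 1/2 * 2] per active
    unit and the two opposite clusters at most the same amount, minus a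
    constant for the units that are active on [x_s] but not on the opposite
    example; a constant fraction of the units is of this kind.  So every
    margin is of order [alpha0 p = p^(1/2 - beta)].  All probabilistic input
    goes through exponential moments of sums over independent rows.

    Afterwards the loss [L] satisfies [|L(th + D) - L(th) - <G, D>| <= 9 p L |D|^2],
    which both identifies the gradient [G] and gives descent, while almost
    homogeneity gives [- <th, G> >= (2/3) L ln(1/L)].  Thus [|th|] grows at most
    like [ln(1/L)^2], so that [1/L] increases by at least a constant of order
    [ln(1/L(th1))^4 / (p |th1|^2)] at each step. *)

Require Import Defs.
From HB Require Import structures.
From mathcomp Require Import all_boot all_order all_algebra.
From mathcomp Require Import all_classical all_reals all_analysis.
From mathcomp Require Import measurable_realfun.
From mathcomp Require Import ring lra.
Set Implicit Arguments. Unset Strict Implicit. Unset Printing Implicit Defensive.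
Import Order.TTheory GRing.Theory Num.Theory.
Local Open Scope classical_set_scope.
Local Open Scope ring_scope.

(** * Iterated Gaussian integrals *)

Section IteratedIntegral.
Variables (R : realType) (sigma : R).
Implicit Types (I J : eqType).
Local Open Scope ereal_scope.

(** The events in the conclusion are integrated as they stand, with no proof that they are
    measurable. Each bound therefore passes through a measurable nonnegative [W] such that [W < 1]
    forces the event, and through monotonicity of the integral of nonnegative functions. A single
    event, [good_init], serves both claims; everything after it is deterministic.

    The gain of the first step has to beat errors that are fixed fractions of the number of units.
    So the probability that a unit separates two opposite examples needs a lower bound independent
    of [p], [n] and [d]. That bound, [gap_const], is tiny because it comes from a second-moment
    argument on exponentials, and the other thresholds are calibrated against it.

    Exponents in (b): [|th1|^2] is at most of order [d p^(-beta)] and [ln(1/L(th1))] at least of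
    order [p^(1/2 - beta)], so [p |th1|^2 / ln(1/L(th1))^4] is of order [d p^(1 - beta - (2 - 4
    beta)) = d / p^(1 - 3 beta)]. *)

Definition upd I (f : I -> R) (i : I) (x : R) : I -> R :=
  fun j => if j == i then x else f j.

(** General integrands replace the indicators of [gauss_iter], so that Markov's inequality and
    factorization over rows can be expressed. *)
Fixpoint gauss_int I (s : seq I) (F : (I -> R) -> \bar R) (f : I -> R) : \bar R :=
  match s with
  | [::] => F f
  | i :: s' => \int[lebesgue_measure]_x
       ((normal_pdf 0 sigma x)%:E * gauss_int s' F (upd f i x))
  end.

Lemma gauss_iterE I (s : seq I) (S : set (I -> R)) f :
  gauss_iter sigma s S f = gauss_int s (fun g => (\1_S g)%:E) f.
Proof.
elim: s f => [//|i s ih] f /=; apply: eq_integral => x _.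
by rewrite ih.
Qed.

(* Quantifying over all parametrizations by a measurable space avoids putting
   a product sigma-algebra on [I -> R]. *)
Definition coord_measurable (I : Type) (F : (I -> R) -> \bar R) : Prop :=
  forall (d : measure_display) (T : measurableType d) (Phi : T -> I -> R),
    (forall i, measurable_fun [set: T] (fun t => Phi t i)) ->
    measurable_fun [set: T] (fun t => F (Phi t)).

Lemma measurable_upd I (f : I -> R) i j :
  measurable_fun [set: R] (fun x => upd f i x j).
Proof.
rewrite /upd; case: (j == i); first exact: measurable_id.
exact: measurable_cst.
Qed.

Lemma coord_measurable_upd I (F : (I -> R) -> \bar R) f i :
  coord_measurable F -> measurable_fun [set: R] (fun x => F (upd f i x)).
Proof. by move=> mF; apply: mF => j; exact: measurable_upd. Qed.

Lemma measurable_pdfM (G : R -> \bar R) : measurable_fun [set: R] G ->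
  measurable_fun [set: R] (fun x => (normal_pdf 0 sigma x)%:E * G x).
Proof.
move=> mG; apply: emeasurable_funM => //.
by apply/measurable_EFinP; exact: measurable_normal_pdf.
Qed.

Lemma pdf_ge0E x : 0 <= (normal_pdf 0 sigma x)%:E.
Proof. by rewrite lee_fin normal_pdf_ge0. Qed.

Lemma gauss_int_ge0 I (s : seq I) F f : (forall g, 0 <= F g) ->
  0 <= gauss_int s F f.
Proof.
move=> F0; elim: s f => [//|i s ih] f /=.
by apply: integral_ge0 => x _; rewrite mule_ge0// pdf_ge0E.
Qed.

(** Tonelli on [T * R]. The induction hypothesis is used with this product as the new parameter
    space, which is where quantifying over all parametrizations pays off. *)
Lemma coord_measurable_gauss_int I (s : seq I) F : (forall g, 0 <= F g) ->
  coord_measurable F -> coord_measurable (gauss_int s F).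
Proof.
move=> F0 mF; elim: s => [//|i s ih] d T Phi mPhi /=.
pose H (z : T * R) := (normal_pdf 0 sigma z.2)%:E * gauss_int s F (upd (Phi z.1) i z.2).
have := (@measurable_fun_fubini_tonelli_F _ _ T (measurableTypeR R) R
  (@lebesgue_measure R) H); rewrite /fubini_F; apply.
  apply: emeasurable_funM.
    apply/measurable_EFinP; apply: measurableT_comp.
      exact: measurable_normal_pdf.
    exact: measurable_snd.
  apply: ih => j; rewrite /upd; case: (j == i); first exact: measurable_snd.
  by apply: (measurableT_comp (mPhi j)); exact: measurable_fst.
by move=> z; rewrite mule_ge0 ?pdf_ge0E// gauss_int_ge0.
Qed.

(** The integral of a nonnegative function is a supremum over the simple functions below it, so it
    is monotone even off the measurable functions. *)
Lemma le_integral_ge0 (f g : R -> \bar R) : (forall x, 0 <= f x) ->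
  (forall x, f x <= g x) ->
  \int[lebesgue_measure]_x f x <= \int[lebesgue_measure]_x g x.
Proof.
move=> f0 fg; have g0 x : 0 <= g x by exact: le_trans (fg x).
rewrite !ge0_integralTE//; apply: le_ereal_sup => _ [h /= hf <-].
by exists h => // x; exact: le_trans (hf x) (fg x).
Qed.

Lemma le_gauss_int I (s : seq I) F G f : (forall g, 0 <= F g) ->
  (forall g, F g <= G g) -> gauss_int s F f <= gauss_int s G f.
Proof.
move=> F0 FG; elim: s f => [//|i s ih] f /=; apply: le_integral_ge0 => x.
  by rewrite mule_ge0 ?pdf_ge0E// gauss_int_ge0.
by apply: lee_pmul => //; [exact: pdf_ge0E|exact: gauss_int_ge0].
Qed.

Lemma gauss_int_cst I (s : seq I) (c : \bar R) f : 0 <= c ->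
  gauss_int s (fun=> c) f = c.
Proof.
move=> c0; elim: s f => [//|i s ih] f /=.
under eq_integral do rewrite ih muleC.
rewrite ge0_integralZl//; first by rewrite integral_normal_pdf mule1.
- by apply/measurable_EFinP; exact: measurable_normal_pdf.
- by move=> x _; exact: pdf_ge0E.
Qed.

Lemma gauss_intD I (s : seq I) F G f : (forall g, 0 <= F g) ->
  coord_measurable F -> (forall g, 0 <= G g) -> coord_measurable G ->
  gauss_int s (fun g => F g + G g) f = gauss_int s F f + gauss_int s G f.
Proof.
move=> F0 mF G0 mG; elim: s f => [//|i s ih] f /=.
under eq_integral do rewrite ih ge0_muleDr ?gauss_int_ge0//.
rewrite ge0_integralD//.
- by move=> x _; rewrite mule_ge0 ?pdf_ge0E// gauss_int_ge0.
- by apply: measurable_pdfM; apply: coord_measurable_upd; exact: coord_measurable_gauss_int.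
- by move=> x _; rewrite mule_ge0 ?pdf_ge0E// gauss_int_ge0.
- by apply: measurable_pdfM; apply: coord_measurable_upd; exact: coord_measurable_gauss_int.
Qed.

Lemma gauss_int_cat I (s1 s2 : seq I) F f :
  gauss_int (s1 ++ s2) F f = gauss_int s1 (gauss_int s2 F) f.
Proof.
by elim: s1 f => [//|i s ih] f /=; apply: eq_integral => x _; rewrite ih.
Qed.

Lemma eq_gauss_int I (s : seq I) F G f : F =1 G -> gauss_int s F f = gauss_int s G f.
Proof. by move=> /funext ->. Qed.

(** Independence enters here: a factor insensitive to the integrated coordinates leaves the
    integral. *)
Lemma gauss_intM I (s : seq I) (A B : (I -> R) -> \bar R) f :
  (forall g, 0 <= A g) -> (forall g, 0 <= B g) -> coord_measurable B ->
  (forall g i x, i \in s -> A (upd g i x) = A g) ->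
  gauss_int s (fun g => A g * B g) f = A f * gauss_int s B f.
Proof.
move=> A0 B0 mB; elim: s f => [//|i s ih] f Ai /=.
under eq_integral.
  move=> x _; rewrite ih; last by move=> g j y js; rewrite Ai// in_cons js orbT.
  rewrite Ai ?mem_head// muleCA; over.
rewrite ge0_integralZl//.
- by apply: measurable_pdfM; apply: coord_measurable_upd; exact: coord_measurable_gauss_int.
- by move=> x _; rewrite mule_ge0 ?pdf_ge0E// gauss_int_ge0.
Qed.

Lemma gauss_int_agree I (s : seq I) F (f g : I -> R) :
  (forall i, i \notin s -> f i = g i) -> gauss_int s F f = gauss_int s F g.
Proof.
elim: s f g => [|i s ih] f g fg /=; first by congr F; apply/funext => i; exact: fg.
apply: eq_integral => x _; congr (_ * _); apply: ih => j js; rewrite /upd.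
by case: eqVneq => // ji; apply: fg; rewrite in_cons negb_or ji.
Qed.

Lemma gauss_int_reindex I J (h : J -> I) (s : seq J) (G : (J -> R) -> \bar R) f :
  injective h ->
  gauss_int (map h s) (fun g => G (g \o h)) f = gauss_int s G (f \o h).
Proof.
move=> hI; elim: s f => [//|j s ih] f /=; apply: eq_integral => x _.
congr (_ * _); rewrite ih; congr gauss_int; apply/funext => k.
by rewrite /= /upd (inj_eq hI).
Qed.

End IteratedIntegral.

Section RealMeasurable.
Variable R : realType.
Implicit Types (I : Type).

Definition rcoord_measurable I (W : (I -> R) -> R) : Prop :=
  forall (d : measure_display) (T : measurableType d) (Phi : T -> I -> R),
    (forall i, measurable_fun [set: T] (fun t => Phi t i)) ->
    measurable_fun [set: T] (fun t => W (Phi t)).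

Lemma coord_measurable_EFin I (W : (I -> R) -> R) :
  rcoord_measurable W -> coord_measurable (fun g => (W g)%:E).
Proof. by move=> mW d T Phi mPhi; apply/measurable_EFinP; exact: mW. Qed.

Lemma rcoord_measurable_coord I (i : I) : rcoord_measurable (fun g : I -> R => g i).
Proof. by move=> d T Phi mPhi; exact: mPhi. Qed.

Lemma rcoord_measurable_cst I (c : R) : rcoord_measurable (fun g : I -> R => c).
Proof. by move=> d T Phi mPhi; exact: measurable_cst. Qed.

Lemma rcoord_measurableD I (V W : (I -> R) -> R) : rcoord_measurable V ->
  rcoord_measurable W -> rcoord_measurable (fun g => V g + W g).
Proof.
by move=> mV mW d T Phi mPhi; apply: measurable_funD; [exact: mV|exact: mW].
Qed.

Lemma rcoord_measurableM I (V W : (I -> R) -> R) : rcoord_measurable V ->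
  rcoord_measurable W -> rcoord_measurable (fun g => V g * W g).
Proof.
by move=> mV mW d T Phi mPhi; apply: measurable_funM; [exact: mV|exact: mW].
Qed.

Lemma rcoord_measurable_comp I (h : R -> R) (W : (I -> R) -> R) :
  measurable_fun [set: R] h -> rcoord_measurable W ->
  rcoord_measurable (fun g => h (W g)).
Proof.
by move=> mh mW d T Phi mPhi; apply: (measurableT_comp mh); exact: mW.
Qed.

Lemma rcoord_measurable_expR I (W : (I -> R) -> R) :
  rcoord_measurable W -> rcoord_measurable (fun g => expR (W g)).
Proof. by apply: rcoord_measurable_comp; exact: measurable_expR. Qed.

Lemma rcoord_measurable_sum I (K : Type) (r : seq K) (P : pred K)
    (W : K -> (I -> R) -> R) : (forall k, rcoord_measurable (W k)) ->
  rcoord_measurable (fun g => \sum_(k <- r | P k) W k g).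
Proof.
move=> mW; elim: r => [|k r ih].
  rewrite (_ : (fun g => _) = cst 0); first exact: rcoord_measurable_cst.
  by apply/funext => g; rewrite big_nil.
rewrite (_ : (fun g => _) = fun g => if P k then W k g + \sum_(k <- r | P k) W k g
    else \sum_(k <- r | P k) W k g); last by apply/funext => g; rewrite big_cons.
by case: (P k) => //; exact: rcoord_measurableD.
Qed.

Lemma rcoord_measurable_prod I (K : Type) (r : seq K) (P : pred K)
    (W : K -> (I -> R) -> R) : (forall k, rcoord_measurable (W k)) ->
  rcoord_measurable (fun g => \prod_(k <- r | P k) W k g).
Proof.
move=> mW; elim: r => [|k r ih].
  rewrite (_ : (fun g => _) = cst 1); first exact: rcoord_measurable_cst.
  by apply/funext => g; rewrite big_nil.
rewrite (_ : (fun g => _) = fun g => if P k then W k g * \prod_(k <- r | P k) W k g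
    else \prod_(k <- r | P k) W k g); last by apply/funext => g; rewrite big_cons.
by case: (P k) => //; exact: rcoord_measurableM.
Qed.

Lemma rcoord_measurable_ite I (h : R -> bool) (V1 V2 W : (I -> R) -> R) :
  measurable_fun [set: R] h ->
  rcoord_measurable W -> rcoord_measurable V1 -> rcoord_measurable V2 ->
  rcoord_measurable (fun g => if h (W g) then V1 g else V2 g).
Proof.
move=> mh mW m1 m2 d T Phi mPhi; apply: measurable_fun_ifT.
- by apply: (measurableT_comp mh); exact: mW.
- exact: m1.
- exact: m2.
Qed.

Lemma measurable_ltr_cst (c : R) : measurable_fun [set: R] (fun x => x < c).
Proof. by apply: measurable_fun_ltr; [exact: measurable_id|exact: measurable_cst]. Qed.

Lemma measurable_ler_cst (c : R) : measurable_fun [set: R] (fun x => x <= c).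
Proof. by apply: measurable_fun_ler; [exact: measurable_id|exact: measurable_cst]. Qed.

Lemma rcoord_measurable_row (J : Type) I (i : I) (w : (J -> R) -> R) :
  rcoord_measurable w ->
  rcoord_measurable (fun g : I * J -> R => w (fun j => g (i, j))).
Proof. by move=> mw d T Phi mPhi; apply: mw => j; exact: mPhi. Qed.

End RealMeasurable.

(** * Markov's inequality and products over independent coordinates *)

Section Product.
Variables (R : realType) (sigma : R).
Local Open Scope ereal_scope.

(** The indicator of [S] is replaced by the measurable minorant [V], the indicator of [W < 1];
    pointwise [1 <= V + W]. *)
Lemma gauss_int_markov (I : eqType) (s : seq I) (S : set (I -> R))
    (W : (I -> R) -> R) (dlt : R) f :
  (forall g, 0 <= W g)%R -> rcoord_measurable W ->
  (forall g, (W g < 1)%R -> S g) ->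
  gauss_int sigma s (fun g => (W g)%:E) f <= dlt%:E ->
  (1 - dlt)%:E <= gauss_iter sigma s S f.
Proof.
move=> W0 mW WS Wd; rewrite gauss_iterE.
pose V g : R := if (W g < 1)%R then 1%R else 0%R.
have mV : rcoord_measurable V.
  apply: (rcoord_measurable_ite (measurable_ltr_cst 1) mW); exact: rcoord_measurable_cst.
have V0 g : (0 <= V g)%R by rewrite /V; case: ifP.
apply: (@le_trans _ _ (gauss_int sigma s (fun g => (V g)%:E) f)); last first.
  apply: le_gauss_int => g; rewrite lee_fin// /V indicE; case: ifP => // Wg.
  by rewrite mem_set//; exact: WS.
have : 1 <= gauss_int sigma s (fun g => (V g)%:E) f + gauss_int sigma s (fun g => (W g)%:E) f.
  rewrite -gauss_intD; [|by move=> g; rewrite lee_fin|exact: coord_measurable_EFin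
    |by move=> g; rewrite lee_fin|exact: coord_measurable_EFin].
  rewrite -[leLHS](gauss_int_cst sigma s f lee01).
  apply: le_gauss_int => [g|g]; first exact: lee01.
  by rewrite -EFinD lee_fin /V; case: ltP => h; [rewrite lerDl|rewrite add0r].
move=> h1; rewrite EFinB leeBlDr//.
by apply: (le_trans h1); rewrite leeD2l.
Qed.

(** The bound must be uniform in the current assignment [f]: the remaining rows are integrated
    first, with row [i] frozen, and [uniq] ensures that they do not touch it. *)
Lemma gauss_int_prod_rows (I : eqType) (J : finType) (rs : seq I)
    (w : I -> (J -> R) -> R) (c : I -> R) f :
  uniq rs -> (forall i g, 0 <= w i g)%R -> (forall i, rcoord_measurable (w i)) ->
  (forall i, gauss_int sigma (enum J) (fun g => (w i g)%:E) (fun=> 0%R) <= (c i)%:E) ->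
  gauss_int sigma [seq (i, j) | i <- rs, j <- enum J]
    (fun g => (\prod_(i <- rs) w i (fun j => g (i, j)))%:E) f
  <= (\prod_(i <- rs) c i)%:E.
Proof.
move=> urs w0 mw wc.
have c0 i : (0 <= c i)%R.
  rewrite -lee_fin; apply: le_trans (wc i); apply: gauss_int_ge0 => g.
  by rewrite lee_fin.
have P0 (r : seq I) (g : I * J -> R) : 0 <= (\prod_(i <- r) w i (fun j => g (i, j)))%:E.
  by rewrite lee_fin prodr_ge0.
elim: rs urs f => [|i rs ih] /=; first by move=> _ f; rewrite !big_nil.
move=> /andP[irs urs] f; rewrite gauss_int_cat.
apply: (@le_trans _ _ (gauss_int sigma [seq (i, j) | j <- enum J]
   (fun g => (\prod_(i <- rs) c i)%:E * (w i (fun j => g (i, j)))%:E) f)).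
  apply: le_gauss_int => g; first exact: gauss_int_ge0.
  under eq_gauss_int do rewrite big_cons EFinM.
  rewrite gauss_intM//; first last.
  - move=> h k x /allpairsP[[a b] /= [ars _ ->]]; congr (w i _)%:E.
    apply/funext => j; rewrite /upd; case: eqP => // -[ia _].
    by rewrite ia ars in irs.
  - apply: coord_measurable_EFin; apply: rcoord_measurable_prod => k.
    exact: rcoord_measurable_row.
  - by move=> h; rewrite lee_fin.
  by rewrite muleC; apply: lee_pmul => //; [exact: gauss_int_ge0|rewrite lee_fin|exact: ih].
rewrite gauss_intM//; first last.
- by apply: coord_measurable_EFin; exact: rcoord_measurable_row.
- by move=> g; rewrite lee_fin.
- by move=> g; rewrite lee_fin prodr_ge0.
rewrite big_cons muleC EFinM; apply: lee_pmul => //.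
- by apply: gauss_int_ge0 => g; rewrite lee_fin.
- by rewrite lee_fin prodr_ge0.
- rewrite (@gauss_int_reindex _ _ _ _ (pair i) (enum J) (fun g => (w i g)%:E)); last first.
    by move=> a b [].
  by rewrite (@gauss_int_agree _ _ _ _ _ _ (fun=> 0%R))// => j; rewrite mem_enum.
Qed.

Lemma gauss_int_prod_coord (I : eqType) (s : seq I) (w : I -> R -> R) (c : I -> R) f :
  uniq s -> (forall i x, 0 <= w i x)%R -> (forall i, measurable_fun [set: R] (w i)) ->
  (forall i, \int[lebesgue_measure]_x ((normal_pdf 0 sigma x)%:E * (w i x)%:E) = (c i)%:E) ->
  gauss_int sigma s (fun g => (\prod_(i <- s) w i (g i))%:E) f = (\prod_(i <- s) c i)%:E.
Proof.
move=> us w0 mw wc; elim: s us f => [|i s ih] /=; first by move=> _ f; rewrite !big_nil.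
move=> /andP[ins us] f; rewrite big_cons.
transitivity (\int[lebesgue_measure]_x ((\prod_(i <- s) c i)%:E *
    ((normal_pdf 0 sigma x)%:E * (w i x)%:E))).
  apply: eq_integral => x _.
  under eq_gauss_int do rewrite big_cons EFinM.
  rewrite gauss_intM//; first last.
  - move=> h k y ks; rewrite /upd; case: eqP => // ik.
    by rewrite ik ks in ins.
  - apply: coord_measurable_EFin; apply: rcoord_measurable_prod => k.
    by apply: rcoord_measurable_comp => //; exact: rcoord_measurable_coord.
  - by move=> g; rewrite lee_fin; apply: prodr_ge0.
  - by move=> g; rewrite lee_fin.
  by rewrite ih// /upd eqxx muleA muleC.
rewrite ge0_integralZl//.
- by rewrite wc -EFinM mulrC.
- by apply: measurable_pdfM; exact/measurable_EFinP.
- by move=> x _; rewrite mule_ge0 ?pdf_ge0E// lee_fin.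
- rewrite lee_fin prodr_ge0// => k _; rewrite -lee_fin -wc.
  by apply: integral_ge0 => x _; rewrite mule_ge0 ?pdf_ge0E ?lee_fin.
Qed.

End Product.

(** * One-dimensional Gaussian integrals *)

Section Gaussian1D.
Variables (R : realType) (sigma : R).
Hypothesis sigma0 : 0 < sigma.
Local Open Scope ereal_scope.

Let sigmaN0 : sigma != 0%R. Proof. by rewrite gt_eqF. Qed.

(** Completing the square: the exponential tilt moves the mean to [l * sigma ^+ 2]. *)
Lemma integral_normal_expR (l : R) :
  \int[lebesgue_measure]_x ((normal_pdf 0 sigma x)%:E * (expR (l * x))%:E)
  = (expR (l ^+ 2 * sigma ^+ 2 / 2))%:E.
Proof.
transitivity (\int[lebesgue_measure]_x ((expR (l ^+ 2 * sigma ^+ 2 / 2))%:E *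
   (normal_pdf (l * sigma ^+ 2) sigma x)%:E)).
  apply: eq_integral => x _; rewrite -!EFinM !normal_pdfE// /normal_fun.
  congr (_%:E); rewrite -(mulrA (normal_peak _)) -expRD [RHS]mulrCA -expRD; congr (_ * expR _)%R.
  by field.
rewrite ge0_integralZl//; first by rewrite integral_normal_pdf mule1.
- by apply/measurable_EFinP; exact: measurable_normal_pdf.
- by move=> x _; rewrite lee_fin normal_pdf_ge0.
Qed.

(** The factor halves the exponent of the density, leaving a centred Gaussian of variance
    [2 * sigma ^+ 2], whose peak is smaller by [Num.sqrt 2]. *)
Lemma integral_normal_sqr :
  \int[lebesgue_measure]_x ((normal_pdf 0 sigma x)%:E * (expR (x ^+ 2 / (4 * sigma ^+ 2)))%:E)
  = (Num.sqrt 2)%:E.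
Proof.
set s2 := (Num.sqrt 2 * sigma)%R.
have s20 : s2 != 0%R by rewrite mulf_neq0// sqrtr_eq0 -ltNge.
have s2E : (s2 ^+ 2 = 2 * sigma ^+ 2)%R by rewrite exprMn sqr_sqrtr.
transitivity (\int[lebesgue_measure]_x ((Num.sqrt 2)%:E *
   (normal_pdf 0 s2 x)%:E)).
  apply: eq_integral => x _; rewrite -!EFinM !normal_pdfE// /normal_fun /normal_peak s2E.
  congr (_%:E); rewrite -(mulrA (_^-1)%R) -expRD [RHS]mulrA; congr (_ * expR _)%R; last first.
    by field.
  rewrite -[(2 * _ * _ *+ 2)%R]mulrnAr -mulrA sqrtrM// invfM mulrA divff ?mul1r; last first.
    by rewrite sqrtr_eq0 -ltNge.
  by rewrite mulrnAr.
rewrite ge0_integralZl//; first by rewrite integral_normal_pdf mule1.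
- by apply/measurable_EFinP; exact: measurable_normal_pdf.
- by move=> x _; rewrite lee_fin normal_pdf_ge0.
Qed.

(** The density is at most its peak and the interval has length [2 * t]; [pi >= 2] gives [2 * sigma
    <= Num.sqrt (sigma ^+ 2 * pi *+ 2)]. *)
Lemma integral_normal_ball (c t : R) : (0 <= t)%R ->
  \int[lebesgue_measure]_x ((normal_pdf 0 sigma x)%:E * (if `|c + x| <= t then 1 else 0)%R%:E)
  <= (t / sigma)%:E.
Proof.
move=> t0.
apply: (@le_trans _ _ (\int[lebesgue_measure]_x ((normal_peak sigma)%:E *
    (\1_`[(- c - t)%R, (- c + t)%R] x)%:E))).
  apply: le_integral_ge0 => x.
    by rewrite mule_ge0 ?pdf_ge0E// lee_fin; case: ifP.
  rewrite indicE -!EFinM lee_fin.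
  case: ifPn => [|_]; last by rewrite mulr0 mulr_ge0 ?normal_peak_ge0.
  move=> cxt; rewrite mem_set; first by rewrite !mulr1 normal_pdf_ub.
  by rewrite /= in_itv /=; move: cxt; rewrite ler_norml => /andP[h1 h2]; apply/andP; split; lra.
rewrite ge0_integralZl; [|exact: measurableT
  |by apply/measurable_EFinP; apply: measurable_indic; exact: measurable_itv
  |by move=> x _; rewrite lee_fin|by rewrite lee_fin normal_peak_ge0].
rewrite integral_indic// setIT.
change ((normal_peak sigma)%:E *
  lebesgue_measure ([set` `[(- c - t)%R, (- c + t)%R]] : set R) <= (t / sigma)%:E).
rewrite lebesgue_measure_itv/= lte_fin.
case: ifPn => _; last by rewrite mule0 lee_fin divr_ge0// ltW.
rewrite -EFinB -EFinM lee_fin (_ : (- c + t - (- c - t) = 2 * t)%R); last by ring.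
rewrite mulrA mulrC ler_wpM2l// -[leRHS]mul1r ler_pdivlMr// /normal_peak.
have h : (2 * sigma <= Num.sqrt (sigma ^+ 2 * pi *+ 2))%R.
  rewrite -[leLHS]ger0_norm; last by rewrite mulr_ge0// ltW.
  rewrite -sqrtr_sqr ler_sqrt; last by rewrite mulrn_wge0// mulr_ge0 ?sqr_ge0 ?pi_ge0.
  rewrite exprMn (_ : sigma ^+ 2 * pi *+ 2 = sigma ^+ 2 * (2 * pi))%R; last by ring.
  rewrite mulrC ler_wpM2l ?sqr_ge0//.
  by have := pi_ge2 R; rewrite expr2; lra.
rewrite -mulrA mulrC ler_pdivrMr ?mul1r//.
by apply: lt_le_trans h; rewrite mulr_gt0.
Qed.

End Gaussian1D.

(** * Estimates for a single hidden unit *)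

Section ExpBounds.
Variable R : realType.
Implicit Types x y : R.

Lemma expR_le_quad y : expR y <= 1 + y + y ^+ 2 * expR `|y|.
Proof.
have h1 : expR y - 1 <= y * expR y.
  have /(ler_wpM2r (expR_ge0 y)) := expR_ge1Dx (- y).
  by rewrite -expRD addNr expR0; lra.
have [y0|y0] := leP 0 y.
  rewrite ger0_norm//.
  have : y * (expR y - 1) <= y * (y * expR y) by rewrite ler_wpM2l.
  by rewrite expr2; lra.
rewrite ltr0_norm//.
have h2 : y * (expR y - 1) <= y ^+ 2.
  rewrite expr2 ler_wnM2l ?(ltW y0)//.
  by have := expR_ge1Dx y; lra.
have h3 : y ^+ 2 * 1 <= y ^+ 2 * expR (- y).
  by rewrite ler_wpM2l ?sqr_ge0//; have := expR_ge1Dx (- y); lra.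
by lra.
Qed.

Lemma expR_half_le2 : expR 2^-1 <= 2 :> R.
Proof.
have /(ler_wpM2r (expR_ge0 (2^-1 : R))) := expR_ge1Dx (- 2^-1 : R).
by rewrite -expRD addNr expR0; lra.
Qed.

Lemma expR_le_quad2 y : y <= 2^-1 -> expR y <= 1 + y + 2 * y ^+ 2.
Proof.
move=> y1; have [y0|y0] := leP 0 y.
  apply: (le_trans (expR_le_quad y)); rewrite ger0_norm// lerD2l mulrC ler_wpM2r ?sqr_ge0//.
  by apply: le_trans expR_half_le2; rewrite ler_expR.
have h1 : expR y - 1 <= y * expR y.
  have /(ler_wpM2r (expR_ge0 y)) := expR_ge1Dx (- y).
  by rewrite -expRD addNr expR0; lra.
have h2 : y * (expR y - 1) <= y ^+ 2.
  rewrite expr2 ler_wnM2l ?(ltW y0)//.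
  by have := expR_ge1Dx y; lra.
by have := sqr_ge0 y; lra.
Qed.

Lemma sqr_le_expR x : 0 <= x -> x ^+ 2 <= 2 * expR x.
Proof. by move=> x0; have := expR_ge1Dxn 1 x0; rewrite !factS fact0 /=; lra. Qed.

Lemma expR_norm_le x : expR `|x| <= expR x + expR (- x).
Proof.
have [x0|x0] := leP 0 x; [rewrite ger0_norm// lerDl|rewrite ltr0_norm// lerDr];
  exact: expR_ge0.
Qed.

End ExpBounds.

Section GaussianVector.
Variables (R : realType) (sigma : R) (d : nat).
Hypothesis sigma0 : 0 < sigma.
Local Notation J := 'I_d.+1.
Implicit Types (g u v w : J -> R) (V W : (J -> R) -> R).

Definition expect W : \bar R := gauss_int sigma (enum J) (fun g => (W g)%:E) (fun=> 0).

Definition lin w g : R := \sum_j w j * g j.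
Definition inner u v : R := \sum_(j < d.+1) u j * v j.

Lemma expect_ge0 W : (forall g, 0 <= W g) -> (0 <= expect W)%E.
Proof. by move=> W0; apply: gauss_int_ge0 => g; rewrite lee_fin. Qed.

Lemma le_expect V W : (forall g, 0 <= V g) -> (forall g, V g <= W g) ->
  (expect V <= expect W)%E.
Proof. by move=> V0 VW; apply: le_gauss_int => g; rewrite lee_fin. Qed.

Lemma expectD V W : (forall g, 0 <= V g) -> rcoord_measurable V ->
  (forall g, 0 <= W g) -> rcoord_measurable W ->
  expect (fun g => V g + W g) = (expect V + expect W)%E.
Proof.
move=> V0 mV W0 mW; rewrite /expect -gauss_intD; [by []|by move=> g; rewrite lee_fin
  |exact: coord_measurable_EFin|by move=> g; rewrite lee_fin|exact: coord_measurable_EFin].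
Qed.

Lemma expectZ k W : 0 <= k -> (forall g, 0 <= W g) -> rcoord_measurable W ->
  expect (fun g => k * W g) = (k%:E * expect W)%E.
Proof.
move=> k0 W0 mW; rewrite /expect.
under eq_gauss_int do rewrite EFinM.
rewrite (@gauss_intM _ _ _ _ (fun=> k%:E)); [by []|by move=> g; rewrite lee_fin
  |by move=> g; rewrite lee_fin|exact: coord_measurable_EFin|by []].
Qed.

Lemma expect_cst k : 0 <= k -> expect (fun=> k) = k%:E.
Proof. by move=> k0; rewrite /expect gauss_int_cst. Qed.

Lemma rcoord_measurable_lin w : rcoord_measurable (lin w).
Proof.
apply: rcoord_measurable_sum => j; apply: rcoord_measurableM.
  exact: rcoord_measurable_cst.
exact: rcoord_measurable_coord.
Qed.

Lemma rcoord_measurable_explin w : rcoord_measurable (fun g => expR (lin w g)).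
Proof. by apply: rcoord_measurable_expR; exact: rcoord_measurable_lin. Qed.

Lemma expect_explin w :
  expect (fun g => expR (lin w g)) = (expR (sigma ^+ 2 * inner w w / 2))%:E.
Proof.
transitivity (gauss_int sigma (enum J)
    (fun g => (\prod_(j <- enum J) expR (w j * g j))%:E) (fun=> 0)).
  by apply: eq_gauss_int => g; rewrite -expR_sum /lin big_enum.
rewrite (@gauss_int_prod_coord _ _ _ _ (fun j x => expR (w j * x))
   (fun j => expR (w j ^+ 2 * sigma ^+ 2 / 2))).
- rewrite -expR_sum big_enum /=; congr (expR _)%:E.
  rewrite /inner mulr_sumr mulr_suml; apply: eq_bigr => j _.
  by rewrite expr2; ring.
- exact: enum_uniq.
- by move=> j x; exact: expR_ge0.
- move=> j; apply: measurableT_comp; first exact: measurable_expR.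
  by apply: measurable_funM; [exact: measurable_cst|exact: measurable_id].
- by move=> j; exact: integral_normal_expR.
Qed.

Lemma expect_expsqr :
  expect (fun g => expR (\sum_j g j ^+ 2 / (4 * sigma ^+ 2))) = (Num.sqrt 2 ^+ d.+1)%:E.
Proof.
transitivity (gauss_int sigma (enum J)
    (fun g => (\prod_(j <- enum J) expR (g j ^+ 2 / (4 * sigma ^+ 2)))%:E) (fun=> 0)).
  by apply: eq_gauss_int => g; rewrite -expR_sum big_enum.
rewrite (@gauss_int_prod_coord _ _ _ _ (fun j x => expR (x ^+ 2 / (4 * sigma ^+ 2)))
   (fun j => Num.sqrt 2)).
- by rewrite big_const_seq count_predT size_enum_ord iter_mulr_1.
- exact: enum_uniq.
- by move=> j x; exact: expR_ge0.
- move=> j; apply: measurableT_comp; first exact: measurable_expR.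
  apply: measurable_funM; last exact: measurable_cst.
  by apply: measurable_funX; exact: measurable_id.
- by move=> j; exact: integral_normal_sqr.
Qed.

(* The last coordinate (the bias) enters with weight 1 and is independent of
   the others, so the density of [lin w] is at most that of the bias. *)
Lemma expect_ball w t : 0 <= t -> w ord_max = 1 ->
  (expect (fun g => (`|lin w g| <= t)%R%:R) <= (t / sigma)%:E)%E.
Proof.
(* [enum_ordSr] lists the bias last, hence as the innermost integral; the other coordinates only
   shift the centre of the interval. *)
move=> t0 w1; rewrite /expect enum_ordSr -cats1 gauss_int_cat.
apply: (@le_trans _ _ (gauss_int sigma [seq widen_ord (leqnSn d) i | i <- enum 'I_d]
   (fun=> (t / sigma)%:E) (fun=> 0))); last first.
  by rewrite gauss_int_cst// lee_fin divr_ge0// ltW.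
apply: le_gauss_int => g; first by apply: gauss_int_ge0 => h; rewrite lee_fin.
rewrite /=; apply: le_trans (integral_normal_ball sigma0 (lin w (upd g ord_max 0)) t0).
apply: le_integral_ge0 => x; first by rewrite mule_ge0 ?pdf_ge0E.
rewrite (_ : lin w (upd g ord_max x) = lin w (upd g ord_max 0) + x); first by case: ifP.
rewrite /lin (bigD1 ord_max)//= [in RHS](bigD1 ord_max)//= /upd eqxx w1.
rewrite mulr0 add0r mul1r addrC; congr (_ + _).
by apply: eq_bigr => j /negbTE ->.
Qed.

(** Chernoff's bound with parameter [(r * sigma)^-1], at which the moment generating function is at
    most [expR 2]. It is meant for [w] the difference of two augmented inputs of one cluster. *)
Lemma expect_tail w r rho : 0 < r -> inner w w <= 4 * r ^+ 2 ->
  (expect (fun g => (rho * sigma < lin w g)%R%:R) <= (expR (2 - rho / r))%:E)%E.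
Proof.
move=> r0 wr.
have k0 : 0 < (r * sigma)^-1 by rewrite invr_gt0 mulr_gt0.
apply: (@le_trans _ _ (expect (fun g => expR (- (rho / r)) *
    expR (lin (fun j => (r * sigma)^-1 * w j) g)))).
  apply: le_expect => g //; rewrite -expRD.
  case: ltP => [h|_]; last exact: expR_ge0.
  rewrite -[leLHS](expR0) ler_expR.
  rewrite (_ : lin _ g = (r * sigma)^-1 * lin w g); last first.
    by rewrite /lin mulr_sumr; apply: eq_bigr => j _; rewrite mulrA.
  rewrite addrC subr_ge0 (_ : rho / r = (r * sigma)^-1 * (rho * sigma)).
    by rewrite ler_wpM2l// ltW.
  by field; rewrite !gt_eqF.
rewrite expectZ ?expR_ge0//; last exact: rcoord_measurable_explin.
rewrite expect_explin -EFinM -expRD lee_fin ler_expR addrC lerD2r.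
rewrite (_ : inner _ _ = (r * sigma)^-1 ^+ 2 * inner w w); last first.
  by rewrite /inner mulr_sumr; apply: eq_bigr => j _; rewrite expr2; ring.
rewrite (_ : _ / 2 = inner w w * (2 * r ^+ 2)^-1); last by field; rewrite !gt_eqF.
by rewrite ler_pdivrMr ?mulr_gt0 ?exprn_gt0//; lra.
Qed.

End GaussianVector.

Section Indicators.
Variables (R : realType).

Definition bcoord_measurable (I : Type) (A : (I -> R) -> bool) : Prop :=
  forall (d : measure_display) (T : measurableType d) (Phi : T -> I -> R),
    (forall i, measurable_fun [set: T] (fun t => Phi t i)) ->
    measurable_fun [set: T] (fun t => A (Phi t)).

Lemma rcoord_measurable_indic (I : Type) (A : (I -> R) -> bool) :
  bcoord_measurable A -> rcoord_measurable (fun g => (A g)%:R).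
Proof.
move=> mA d T Phi mPhi.
rewrite (_ : (fun t => _) = fun t => if A (Phi t) then 1 else 0); last first.
  by apply/funext => t; case: (A _).
by apply: measurable_fun_ifT; [exact: mA|exact: measurable_cst|exact: measurable_cst].
Qed.

Lemma bcoord_measurable_lt (I : Type) (V W : (I -> R) -> R) :
  rcoord_measurable V -> rcoord_measurable W -> bcoord_measurable (fun g => V g < W g).
Proof.
by move=> mV mW d T Phi mPhi; apply: measurable_fun_ltr; [exact: mV|exact: mW].
Qed.

Lemma bcoord_measurable_le (I : Type) (V W : (I -> R) -> R) :
  rcoord_measurable V -> rcoord_measurable W -> bcoord_measurable (fun g => V g <= W g).
Proof.
by move=> mV mW d T Phi mPhi; apply: measurable_fun_ler; [exact: mV|exact: mW].
Qed.

Lemma bcoord_measurable_and (I : Type) (A B : (I -> R) -> bool) :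
  bcoord_measurable A -> bcoord_measurable B -> bcoord_measurable (fun g => A g && B g).
Proof.
by move=> mA mB d T Phi mPhi; apply: measurable_and; [exact: mA|exact: mB].
Qed.

End Indicators.

Section NeuronEstimates.
Variables (R : realType) (sigma : R) (d : nat).
Hypothesis sigma0 : 0 < sigma.
Local Notation J := 'I_d.+1.
Implicit Types (g u v w : J -> R) (V W : (J -> R) -> R).
Local Notation E := (expect sigma (d := d)).

Lemma linD u v g : lin (fun j => u j + v j) g = lin u g + lin v g.
Proof. by rewrite /lin -big_split; apply: eq_bigr => j _; rewrite mulrDl. Qed.

Lemma linZ k u g : lin (fun j => k * u j) g = k * lin u g.
Proof. by rewrite /lin mulr_sumr; apply: eq_bigr => j _; rewrite mulrA. Qed.

Lemma inner_comb a b u v :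
  inner (fun j => a * u j + b * v j) (fun j => a * u j + b * v j) =
  a ^+ 2 * inner u u + 2 * a * b * inner u v + b ^+ 2 * inner v v.
Proof.
rewrite /inner !mulr_sumr -!big_split; apply: eq_bigr => j _ /=.
by rewrite !expr2; ring.
Qed.

Lemma expect_explin2 a b u v :
  E (fun g => expR (a / sigma * lin u g + b / sigma * lin v g)) =
  (expR ((a ^+ 2 * inner u u + 2 * a * b * inner u v + b ^+ 2 * inner v v) / 2))%:E.
Proof.
transitivity (E (fun g => expR (lin (fun j => a / sigma * u j + b / sigma * v j) g))).
  by apply: eq_gauss_int => g; rewrite linD !linZ.
rewrite expect_explin// inner_comb; congr (expR _)%:E.
by field; rewrite gt_eqF.
Qed.

Lemma rcoord_measurable_explin2 a b u v :
  rcoord_measurable (fun g => expR (a * lin u g + b * lin v g)).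
Proof.
by apply: rcoord_measurable_expR; apply: rcoord_measurableD;
  apply: rcoord_measurableM; try exact: rcoord_measurable_cst;
  exact: rcoord_measurable_lin.
Qed.

(** Inverse of the bound on the second moment [E Q] in [expect_gap]: [2 + 4 * 2] exponentials, the
    largest exponent being [8 ^+ 2 * s / 2] with [s <= 8]. *)
Definition gap_const : R := (10 * expR 256)^-1.

Lemma gap_const_gt0 : 0 < gap_const.
Proof. by rewrite invr_gt0 mulr_gt0// expR_gt0. Qed.

(* With U = z - z', V = z + z' the event is U > |V|, and
   e^{4U} - (e^V + e^{-V}) e^{3U} is positive only there.  The expectation of
   this test function and of its square only involve Gaussian moment
   generating functions. *)
Lemma expect_gap w w' : inner w w = 2 -> inner w' w' = 2 ->
  inner w w' <= 1 + 10^-1 -> -2 <= inner w w' ->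
  (gap_const%:E <= E (fun g => ((0 < lin w g) && (lin w' g < 0))%R%:R))%E.
Proof.
move=> w2 w'2 ww' ww'2.
pose A g := (0 < lin w g) && (lin w' g < 0).
change (gap_const%:E <= E (fun g => (A g)%:R))%E.
(* [u] and [v] are orthogonal because [w] and [w'] have equal norms, so [lin u] and [lin v] are
   independent, with variances [s] and [8 - s] in units of [sigma ^+ 2]. *)
pose u j := w j + -1 * w' j; pose v j := w j + 1 * w' j.
pose s := inner u u.
have uE : u = (fun j => 1 * w j + -1 * w' j) by apply/funext => j; rewrite mul1r.
have vE : v = (fun j => 1 * w j + 1 * w' j) by apply/funext => j; rewrite /v !mul1r.
have sE : s = 4 - 2 * inner w w'.
  by rewrite /s uE inner_comb w2 w'2; ring.
have tE : inner v v = 8 - s.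
  by rewrite sE vE inner_comb w2 w'2; ring.
have uvE : inner u v = 0.
  transitivity (inner w w - inner w' w'); last by rewrite w2 w'2 subrr.
  by rewrite /inner -sumrB; apply: eq_bigr => j _; rewrite /u /v; ring.
have s_lb : 18 / 10 <= s by rewrite sE; lra.
have s_ub : s <= 8 by rewrite sE; lra.
pose ee a b g := expR (a / sigma * lin u g + b / sigma * lin v g).
have Eee a b : E (ee a b) = (expR ((a ^+ 2 * s + b ^+ 2 * (8 - s)) / 2))%:E.
  by rewrite expect_explin2 uvE -/s tE mulr0 addr0.
have ee0 a b g : 0 <= ee a b g by exact: expR_ge0.
have mee a b : rcoord_measurable (ee a b) by exact: rcoord_measurable_explin2.
pose K : R := 10 * expR 256.
have K0 : 0 < K by rewrite mulr_gt0// expR_gt0.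
(* A linear form of the Paley-Zygmund argument. For [T = ee 4 0 - Y],
   [4 * tau * T <= 1 + 4 * tau ^+ 2 * T ^+ 2] always, and [T <= 0] off [A]. This [tau] makes the
   quadratic cost [4 * tau ^+ 2 * K] equal to [2 * tau], half of what a mean of [T] of at least 1
   provides. *)
pose tau := (2 * K)^-1.
have tau0 : 0 < tau by rewrite invr_gt0 mulr_gt0.
have mA : rcoord_measurable (fun g => (A g)%:R : R).
  apply: rcoord_measurable_indic; apply: bcoord_measurable_and;
  apply: bcoord_measurable_lt; try exact: rcoord_measurable_cst;
  exact: rcoord_measurable_lin.
pose Y g := ee 3 1 g + ee 3 (-1) g.
pose Q g := 2 * ee 8 0 g + 4 * (ee 6 2 g + ee 6 (-2) g).
have Y0 g : 0 <= Y g by rewrite addr_ge0.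
have Q0 g : 0 <= Q g by rewrite addr_ge0// mulr_ge0// addr_ge0.
have mY : rcoord_measurable Y by exact: rcoord_measurableD.
have mQ : rcoord_measurable Q.
  by apply: rcoord_measurableD; apply: rcoord_measurableM;
    try exact: rcoord_measurable_cst; [exact: mee|exact: rcoord_measurableD].
have pw g : 4 * tau * ee 4 0 g <=
    (A g)%:R + (4 * tau * Y g + 4 * tau ^+ 2 * Q g).
  have XYQ : (ee 4 0 g - Y g) ^+ 2 <= Q g.
    have e1 : ee 4 0 g ^+ 2 = ee 8 0 g.
      by rewrite /ee expr2 -expRD; congr expR; ring.
    have e2 : ee 3 1 g ^+ 2 = ee 6 2 g.
      by rewrite /ee expr2 -expRD; congr expR; ring.
    have e3 : ee 3 (-1) g ^+ 2 = ee 6 (-2) g.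
      by rewrite /ee expr2 -expRD; congr expR; ring.
    rewrite /Q -e1 -e2 -e3 /Y.
    move: (ee 4 0 g) (ee 3 1 g) (ee 3 (-1) g) => a b c.
    have := sqr_ge0 (a + (b + c)); have := sqr_ge0 (b - c).
    by rewrite !expr2; lra.
  case AE : (A g).
    have := sqr_ge0 (2 * tau * (ee 4 0 g - Y g) - 1).
    have : 4 * tau ^+ 2 * (ee 4 0 g - Y g) ^+ 2 <= 4 * tau ^+ 2 * Q g.
      by rewrite ler_wpM2l// mulr_ge0// sqr_ge0.
    rewrite !expr2 /=.
    move: (ee 4 0 g) (Y g) (Q g) => a b c; lra.
  have XY : ee 4 0 g <= Y g.
    move: AE => /negbT; rewrite negb_and -!leNgt => AE.
    have UV : lin u g / sigma <= `|lin v g / sigma|.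
      rewrite [leRHS]normrM (gtr0_norm (x := sigma^-1)) ?invr_gt0// ler_wpM2r ?invr_ge0 ?(ltW sigma0)//.
      rewrite /u /v !linD !linZ; case/orP: AE => h.
        by rewrite -normrN; apply: le_trans (ler_norm _); lra.
      by apply: le_trans (ler_norm _); lra.
    rewrite (_ : Y g = expR (3 * (lin u g / sigma)) *
        (expR (lin v g / sigma) + expR (- (lin v g / sigma)))); last first.
      by rewrite /Y /ee mulrDr -!expRD; congr (expR _ + expR _); ring.
    rewrite (_ : ee 4 0 g = expR (3 * (lin u g / sigma)) * expR (lin u g / sigma)); last first.
      by rewrite /ee -expRD; congr (expR _); ring.
    rewrite ler_wpM2l ?expR_ge0//.
    by apply: le_trans (expR_norm_le _); rewrite ler_expR.
  have : 4 * tau * ee 4 0 g <= 4 * tau * Y g by rewrite ler_wpM2l// mulr_ge0// ltW.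
  have : 0 <= 4 * tau ^+ 2 * Q g by rewrite mulr_ge0// mulr_ge0// sqr_ge0.
  by rewrite /=; lra.
have t4 : 0 <= 4 * tau by rewrite mulr_ge0// ltW.
have t42 : 0 <= 4 * tau ^+ 2 by rewrite mulr_ge0// sqr_ge0.
have EY : E Y = (2 * expR (4 * s + 4))%:E.
  rewrite /Y expectD// !Eee -EFinD; congr (_%:E).
  rewrite (_ : 2 * expR (4 * s + 4) = expR (4 * s + 4) + expR (4 * s + 4)); last by ring.
  by congr (expR _ + expR _); field.
have EQ : (E Q <= K%:E)%E.
  rewrite /Q expectD//; last 4 first.
  - by move=> g; rewrite mulr_ge0.
  - by apply: rcoord_measurableM => //; exact: rcoord_measurable_cst.
  - by move=> g; rewrite mulr_ge0// addr_ge0.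
  - apply: rcoord_measurableM; first exact: rcoord_measurable_cst.
    exact: rcoord_measurableD.
  rewrite !expectZ//; last 2 first.
  - by move=> g; rewrite addr_ge0.
  - exact: rcoord_measurableD.
  rewrite expectD// !Eee.
  rewrite [leLHS](_ : _ = (2 * expR ((8 ^+ 2 * s + 0 ^+ 2 * (8 - s)) / 2) +
    4 * (expR ((6 ^+ 2 * s + 2 ^+ 2 * (8 - s)) / 2) +
    expR ((6 ^+ 2 * s + (- 2) ^+ 2 * (8 - s)) / 2)))%:E)// lee_fin /K.
  have h1 : expR ((8 ^+ 2 * s + 0 ^+ 2 * (8 - s)) / 2) <= expR 256 by rewrite ler_expR; lra.
  have h2 : expR ((6 ^+ 2 * s + 2 ^+ 2 * (8 - s)) / 2) <= expR 256 by rewrite ler_expR; lra.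
  have h3 : expR ((6 ^+ 2 * s + (- 2) ^+ 2 * (8 - s)) / 2) <= expR 256 by rewrite ler_expR; lra.
  by lra.
have main : ((4 * tau * expR (8 * s))%:E <=
    E (fun g => (A g)%:R) + (4 * tau * (2 * expR (4 * s + 4)) + 4 * tau ^+ 2 * K)%:E)%E.
  have -> : (4 * tau * expR (8 * s))%:E = E (fun g => 4 * tau * ee 4 0 g).
    by rewrite expectZ// Eee -EFinM; congr (_ * expR _)%:E; field.
  apply: (@le_trans _ _ (E (fun g => (A g)%:R + (4 * tau * Y g + 4 * tau ^+ 2 * Q g)))).
    by apply: le_expect => // g; rewrite mulr_ge0.
  have m1 : rcoord_measurable (fun g => 4 * tau * Y g).
    by apply: rcoord_measurableM => //; exact: rcoord_measurable_cst.
  have m2 : rcoord_measurable (fun g => 4 * tau ^+ 2 * Q g).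
    by apply: rcoord_measurableM => //; exact: rcoord_measurable_cst.
  rewrite expectD//; last 2 first.
  - by move=> g; rewrite addr_ge0// mulr_ge0.
  - exact: rcoord_measurableD.
  rewrite leeD2l// expectD//; last 2 first.
  - by move=> g; rewrite mulr_ge0.
  - by move=> g; rewrite mulr_ge0.
  rewrite !expectZ// EY EFinD leeD//.
  by rewrite [leRHS]EFinM lee_pmul// expect_ge0.
rewrite -(@leeD2rE _ (4 * tau * (2 * expR (4 * s + 4)) + 4 * tau ^+ 2 * K)%:E)//.
apply: le_trans main; rewrite -EFinD lee_fin.
have -> : 8 * s = (4 * s + 4) + (4 * s - 4) by ring.
rewrite (expRD (4 * s + 4)).
have h1 : 1 <= expR (4 * s + 4) by rewrite -[leLHS]expR0 ler_expR; lra.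
(* The correlation bound is spent here: [s >= 18 / 10] makes the mean of [ee 4 0] at least three
   times [expR (4 * s + 4)], while that of [Y] is twice it. *)
have h2 : 3 <= expR (4 * s - 4) by apply: le_trans (expR_ge1Dx _); lra.
have h3 : 3 * expR (4 * s + 4) <= expR (4 * s + 4) * expR (4 * s - 4).
  by rewrite mulrC ler_wpM2l ?expR_ge0.
have h4 : 4 * tau ^+ 2 * K = 2 * tau.
  by rewrite /tau; field; rewrite gt_eqF.
have h5 : gap_const = 2 * tau.
  by rewrite /gap_const -/K /tau; field; rewrite gt_eqF.
rewrite h4 h5.
have : 4 * tau * (2 * expR (4 * s + 4) + 1) <= 4 * tau * (expR (4 * s + 4) * expR (4 * s - 4)).
  by rewrite ler_wpM2l//; lra.
by lra.
Qed.

End NeuronEstimates.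

(** * Exponential moments of one unit *)

Section Chernoff.
Variables (R : realType) (sigma : R) (d : nat).
Hypothesis sigma0 : 0 < sigma.
Local Notation J := 'I_d.+1.
Implicit Types (g u v w : J -> R) (V W : (J -> R) -> R) (A : (J -> R) -> bool).
Local Notation E := (expect sigma (d := d)).

(** The exponent [2^-1] is chosen because [expR 2^-1 <= 2], which makes [1] plus the indicator a
    pointwise majorant. *)
Lemma expect_exp_indic A (q : R) : bcoord_measurable A ->
  (E (fun g => (A g)%:R) <= q%:E)%E ->
  (E (fun g => expR (2^-1 * (A g)%:R)) <= (expR q)%:E)%E.
Proof.
move=> mA Aq; apply: (@le_trans _ _ (E (fun g => 1 + (A g)%:R))).
  apply: le_expect => g; first exact: expR_ge0.
  case: (A g); first by rewrite mulr1 /=; have := expR_half_le2 R; lra.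
  by rewrite mulr0 expR0 addr0.
rewrite expectD; [|by []|exact: rcoord_measurable_cst|by []
  |exact: rcoord_measurable_indic].
rewrite expect_cst//; apply: (@le_trans _ _ (1%:E + q%:E)%E); first by rewrite leeD2l.
by rewrite -EFinD lee_fin expR_ge1Dx.
Qed.

(** Pointwise, [expR (- x) <= 1 - x / 2] for [x] in [{0, 1}]; the proof keeps all terms on one side
    because [expect] is additive on nonnegative functions. *)
Lemma expect_exp_indicN A (c : R) : bcoord_measurable A ->
  (c%:E <= E (fun g => (A g)%:R))%E ->
  (E (fun g => expR (- (A g)%:R)) <= (expR (- (c / 2)))%:E)%E.
Proof.
move=> mA Ac.
have mI : rcoord_measurable (fun g => (A g)%:R : R) by exact: rcoord_measurable_indic.
have mI2 : rcoord_measurable (fun g => 2^-1 * (A g)%:R : R).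
  by apply: rcoord_measurableM => //; exact: rcoord_measurable_cst.
have mX : rcoord_measurable (fun g => expR (- (A g)%:R) : R).
  rewrite (_ : (fun g => _) = (fun g => expR (-1 * (A g)%:R))); last first.
    by apply/funext => g; rewrite mulN1r.
  apply: rcoord_measurable_expR.
  by apply: rcoord_measurableM; [exact: rcoord_measurable_cst|exact: mI].
have h : (E (fun g => expR (- (A g)%:R)) + (2^-1)%:E * E (fun g => (A g)%:R) <= 1%:E)%E.
  have X0 g : 0 <= expR (- (A g)%:R) :> R by exact: expR_ge0.
  have I0 g : 0 <= 2^-1 * (A g)%:R :> R by rewrite mulr_ge0.
  rewrite -expectZ// -expectD//.
  rewrite -[leRHS](@expect_cst R sigma d 1)//; apply: le_expect => g.
    by rewrite addr_ge0 ?expR_ge0// mulr_ge0.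
  case: (A g) => /=; last by rewrite oppr0 expR0 mulr0 addr0.
  have : expR (- (1 : R)) * expR 1 = 1 by rewrite -expRD addNr expR0.
  have h1 : 2 <= expR (1 : R) by apply: le_trans (expR_ge1Dx _); lra.
  have : expR (- (1 : R)) * 2 <= expR (- (1 : R)) * expR 1 by rewrite ler_wpM2l ?expR_ge0.
  by rewrite mulr1; lra.
rewrite -(@leeD2rE _ (2^-1 * c)%:E)//.
apply: (@le_trans _ _ 1%:E).
  by apply: le_trans h; rewrite leeD2l// EFinM lee_wpmul2l.
by rewrite -EFinD lee_fin; have := expR_ge1Dx (- (c / 2)); lra.
Qed.

(* The same [m], the mean of [psi], occurs with opposite signs, so it cancels
   between units with output weights 1 and -1. *)
Lemma expect_exp_Lipschitz (psi : R -> R) (l : R) w :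
  measurable_fun [set: R] psi -> (forall z, 0 <= psi z <= `|z|) ->
  0 <= l -> l * sigma <= 1 -> inner w w = 2 ->
  exists m : R,
    (E (fun g => expR (l * psi (lin w g))) <=
      (expR (l * m + 4 * expR 4 * (l * sigma) ^+ 2))%:E)%E /\
    (E (fun g => expR (- (l * psi (lin w g)))) <=
      (expR (- (l * m) + 4 * expR 4 * (l * sigma) ^+ 2))%:E)%E.
Proof.
move=> mpsi psi_le l0 ls w2.
have psi0 g : 0 <= psi (lin w g) by case/andP: (psi_le (lin w g)).
pose P g := psi (lin w g).
have mP : rcoord_measurable P.
  by apply: rcoord_measurable_comp => //; exact: rcoord_measurable_lin.
pose ee a g := expR (a / sigma * lin w g + 0 / sigma * lin w g).
have Eee a : E (ee a) = (expR (a ^+ 2))%:E.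
  by rewrite expect_explin2// w2; congr (expR _)%:E; field.
have mee a : rcoord_measurable (ee a) by exact: rcoord_measurable_explin2.
have ee0 a g : 0 <= ee a g by exact: expR_ge0.
have eeE a g : ee a g = expR (a * (lin w g / sigma)).
  by rewrite /ee mul0r mul0r addr0; congr expR; ring.
have P_fin : E P \is a fin_num.
  rewrite ge0_fin_numE ?expect_ge0//.
  apply: (@le_lt_trans _ _ (E (fun g => sigma * (ee 1 g + ee (-1) g)))).
    apply: le_expect => // g; case/andP: (psi_le (lin w g)) => _ h.
    apply: (le_trans h); rewrite -ler_pdivrMl// !eeE mul1r mulN1r mulrC.
    apply: le_trans (expR_norm_le _).
    have := expR_ge1Dx `|lin w g / sigma|; rewrite normrM (gtr0_norm (x := sigma^-1)) ?invr_gt0//.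
    by lra.
  have e0 g : 0 <= ee 1 g + ee (-1) g by rewrite addr_ge0.
  have me : rcoord_measurable (fun g => ee 1 g + ee (-1) g) by exact: rcoord_measurableD.
  rewrite expectZ ?(ltW sigma0)//.
  by rewrite expectD// !Eee -EFinD -EFinM ltry.
pose m := fine (E P); exists m.
have EP : E P = m%:E by rewrite /m fineK.
(* Since [l * sigma <= 1], the remainder [y ^+ 2 * expR |y|] is at most
   [(l * sigma) ^+ 2 * a ^+ 2 * expR a], and [a ^+ 2 <= 2 * expR a] turns it into exponentials with
   explicit moments. *)
have key (y z : R) : `|y| <= l * `|z| -> expR y <= 1 + y + 2 * (l * sigma) ^+ 2 *
    (expR (2 * (z / sigma)) + expR (-2 * (z / sigma))).
  move=> yz; apply: (le_trans (expR_le_quad y)); rewrite lerD2l.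
  set a := `|z / sigma|.
  have a0 : 0 <= a by exact: normr_ge0.
  have ya : `|y| <= l * sigma * a.
    rewrite /a normrM (gtr0_norm (x := sigma^-1)) ?invr_gt0//.
    by rewrite (_ : _ * _ = l * `|z|)//; field; rewrite gt_eqF.
  have la0 : 0 <= l * sigma by rewrite mulr_ge0// ltW.
  have h1 : y ^+ 2 <= (l * sigma) ^+ 2 * a ^+ 2.
    rewrite -exprMn -[leLHS]real_normK ?num_real//.
    by rewrite lerXn2r// nnegrE mulr_ge0.
  have h2 : expR `|y| <= expR a.
    by rewrite ler_expR; apply: (le_trans ya); rewrite ler_piMl.
  have h3 : expR a * expR a <= expR (2 * (z / sigma)) + expR (-2 * (z / sigma)).
    rewrite -expRD (_ : a + a = `|2 * (z / sigma)|); last first.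
      by rewrite normrM ger0_norm// -/a; ring.
    by rewrite mulNr; exact: expR_norm_le.
  apply: (@le_trans _ _ ((l * sigma) ^+ 2 * (2 * expR a) * expR a)).
    apply: ler_pM; rewrite ?sqr_ge0 ?expR_ge0//.
    apply: (le_trans h1); rewrite ler_wpM2l ?sqr_ge0//.
    exact: sqr_le_expR.
  rewrite (_ : _ * _ * _ = 2 * (l * sigma) ^+ 2 * (expR a * expR a)); last by ring.
  by rewrite ler_wpM2l// mulr_ge0// sqr_ge0.
have c0 : 0 <= 2 * (l * sigma) ^+ 2 by rewrite mulr_ge0// sqr_ge0.
pose B g := 2 * (l * sigma) ^+ 2 * (ee 2 g + ee (-2) g).
have B0 g : 0 <= B g by rewrite mulr_ge0// addr_ge0.
have mB : rcoord_measurable B.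
  by apply: rcoord_measurableM; [exact: rcoord_measurable_cst|exact: rcoord_measurableD].
have EB : E B = (4 * expR 4 * (l * sigma) ^+ 2)%:E.
  have e0 g : 0 <= ee 2 g + ee (-2) g by rewrite addr_ge0.
  have me : rcoord_measurable (fun g => ee 2 g + ee (-2) g) by exact: rcoord_measurableD.
  rewrite /B expectZ//.
  rewrite expectD// !Eee sqrrN -EFinD -EFinM (_ : 2 ^+ 2 = 4); last by ring.
  by congr (_%:E); ring.
have mlP : rcoord_measurable (fun g => l * P g).
  by apply: rcoord_measurableM => //; exact: rcoord_measurable_cst.
have lP0 g : 0 <= l * P g by apply: mulr_ge0; [|exact: psi0].
have mB1 : rcoord_measurable (fun g => 1 + B g).
  by apply: rcoord_measurableD => //; exact: rcoord_measurable_cst.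
have B10 g : 0 <= 1 + B g by rewrite addr_ge0.
have EB1 : E (fun g => 1 + B g) = (1 + 4 * expR 4 * (l * sigma) ^+ 2)%:E.
  rewrite expectD; [|by []|exact: rcoord_measurable_cst|by []|by []].
  by rewrite expect_cst// EB -EFinD.
have lPz g : l * P g <= l * `|lin w g|.
  by rewrite ler_wpM2l//; case/andP: (psi_le (lin w g)).
split.
  apply: (@le_trans _ _ (E (fun g => l * P g + (1 + B g)))).
    apply: le_expect => g; first exact: expR_ge0.
    have := @key (l * P g) (lin w g); rewrite ger0_norm// => /(_ (lPz g)).
    by rewrite /B !eeE; lra.
  rewrite expectD// EB1 expectZ// EP -EFinM -EFinD lee_fin.
  by apply: le_trans (expR_ge1Dx _); lra.
(* The linear term is negative here, so it is added to both sides to stay with nonnegative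
   integrands. *)
rewrite -(@leeD2rE _ (l * m)%:E)//.
have -> : (l * m)%:E = E (fun g => l * P g) by rewrite expectZ// EP -EFinM.
have mX : rcoord_measurable (fun g => expR (- (l * P g))).
  rewrite (_ : (fun g => _) = (fun g => expR (-1 * (l * P g)))); last first.
    by apply/funext => g; rewrite mulN1r.
  apply: rcoord_measurable_expR.
  by apply: rcoord_measurableM; [exact: rcoord_measurable_cst|exact: mlP].
have X0 g : 0 <= expR (- (l * P g)) by exact: expR_ge0.
rewrite -expectD//.
apply: (@le_trans _ _ (E (fun g => 1 + B g))).
  apply: le_expect => g; first by rewrite addr_ge0// expR_ge0.
  have := @key (- (l * P g)) (lin w g); rewrite normrN ger0_norm// => /(_ (lPz g)).
  by rewrite /B !eeE; lra.
rewrite EB1 expectZ// EP -EFinM -EFinD lee_fin.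
by have := expR_ge1Dx (- (l * m) + 4 * expR 4 * (l * sigma) ^+ 2); lra.
Qed.

End Chernoff.

(** * The activation, the logistic loss and the network *)

Section HuberRelu.
Variables (R : realType) (h : R).
Hypothesis h0 : 0 < h.

Definition huber_deriv (z : R) : R := if z < 0 then 0 else if z <= h then z / h else 1.

Lemma huber_deriv_bounds z : 0 <= huber_deriv z <= 1.
Proof.
rewrite /huber_deriv; have [z0|z0] := ltP z 0; first by rewrite lexx ler01.
have [zh|zh] := leP z h; last by rewrite lexx ler01.
by rewrite divr_ge0 ?(ltW h0)//= ler_pdivrMr// mul1r.
Qed.

(* [huber_relu h] is the supremum of [s * z - h * s ^+ 2 / 2] over [0 <= s <= 1],
   attained at [s = huber_deriv z]. *)
Lemma huber_dual z :
  huber_relu h z = huber_deriv z * z - h * huber_deriv z ^+ 2 / 2.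
Proof.
rewrite /huber_relu /huber_deriv; have [z0|z0] := ltP z 0; first by ring.
by have [zh|zh] := leP z h; [field; rewrite gt_eqF|ring].
Qed.

(** Optimality condition for the supremum above: [huber_deriv z] is the projection of [z / h] onto
    [[0, 1]]. *)
Lemma huber_deriv_clamp z s : 0 <= s <= 1 ->
  (h * huber_deriv z - z) * (s - huber_deriv z) >= 0.
Proof.
move=> /andP[s0 s1]; rewrite /huber_deriv; case: ltP => z0.
  by rewrite mulr0 sub0r subr0 mulr_ge0// oppr_ge0 ltW.
have [zh|zh] := leP z h.
  rewrite (_ : h * (z / h) - z = 0) ?mul0r//.
  by field; rewrite gt_eqF.
by rewrite mulr1 mulr_le0// subr_le0// ltW.
Qed.

(** Convexity and [1 / h]-smoothness. With slopes [t] at [a] and [s] at [b], the middle term is the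
    optimality condition at [b] tested with [t], plus [h * (s - t) ^+ 2 / 2]. Up to the factor
    [2 * h], the slack above is a square plus a multiple of the condition at [a] tested with [s]. *)
Lemma huber_taylor a b :
  0 <= huber_relu h b - huber_relu h a - huber_deriv a * (b - a) <= (b - a) ^+ 2 / (h *+ 2).
Proof.
have := huber_deriv_clamp b (huber_deriv_bounds a).
have := huber_deriv_clamp a (huber_deriv_bounds b).
rewrite !huber_dual; set s := huber_deriv b; set t := huber_deriv a => h1 h2.
have e0 : s * b - h * s ^+ 2 / 2 - (t * a - h * t ^+ 2 / 2) - t * (b - a) =
  (h * s - b) * (t - s) + h * (s - t) ^+ 2 / 2 by field.
rewrite e0; apply/andP; split.
  rewrite addr_ge0// divr_ge0//; apply: mulr_ge0; [exact: ltW|exact: sqr_ge0].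
rewrite ler_pdivlMr ?mulrn_wgt0//.
have e2 : (b - a) ^+ 2 - ((h * s - b) * (t - s) + h * (s - t) ^+ 2 / 2) * (h *+ 2) =
  (b - a - h * (s - t)) ^+ 2 + 2 * h * ((h * t - a) * (s - t)).
  by rewrite -mulr_natr; field.
rewrite -subr_ge0 e2 addr_ge0 ?sqr_ge0//.
by apply: mulr_ge0 => //; rewrite mulr_ge0// ltW.
Qed.

Lemma huber_Lipschitz a b : `|huber_relu h b - huber_relu h a| <= `|b - a|.
Proof.
wlog ab : a b / a <= b.
  move=> H; have [/H//|/ltW/H] := leP a b.
  by rewrite distrC (distrC a).
have /andP[h1 _] := huber_taylor a b; have /andP[h2 _] := huber_taylor b a.
have /andP[a0 a1] := huber_deriv_bounds a; have /andP[b0 b1] := huber_deriv_bounds b.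
have ba : 0 <= b - a by rewrite subr_ge0.
have h3 : 0 <= huber_deriv a * (b - a) by rewrite mulr_ge0.
have h4 : huber_deriv b * (b - a) <= b - a by rewrite ler_piMl.
rewrite !ger0_norm//; lra.
Qed.

Lemma huber_ge0 z : 0 <= huber_relu h z.
Proof.
rewrite /huber_relu; have [//|z0] := ltP z 0; have [zh|zh] := leP z h; last by lra.
by rewrite divr_ge0 ?sqr_ge0// mulrn_wge0// ltW.
Qed.

Lemma huber_neg z : z < 0 -> huber_relu h z = 0.
Proof. by rewrite /huber_relu => ->. Qed.

Lemma huber0 : huber_relu h 0 = 0.
Proof. by rewrite /huber_relu ltxx ltW// expr2 !mul0r. Qed.

Lemma huber_le_norm z : 0 <= huber_relu h z <= `|z|.
Proof.
rewrite huber_ge0 /=; have := huber_Lipschitz 0 z.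
by rewrite huber0 !subr0 ger0_norm// huber_ge0.
Qed.

Lemma huber_linear z : h < z -> huber_relu h z = z - h / 2.
Proof.
move=> hz; rewrite /huber_relu ltNge (ltW (lt_trans h0 hz)) /= leNgt hz //.
Qed.

(** By [huber_dual] the difference is exactly [h * huber_deriv z ^+ 2 / 2]. *)
Lemma huber_almost_homogeneous z :
  `|huber_deriv z * z - huber_relu h z| <= h / 2.
Proof.
rewrite huber_dual opprB addrCA subrr addr0.
have /andP[z0 z1] := huber_deriv_bounds z.
rewrite ger0_norm; last by rewrite !mulr_ge0 ?sqr_ge0// ltW.
rewrite ler_pM2r// ler_piMr ?(ltW h0)// expr_le1//.
Qed.

Lemma measurable_huber : measurable_fun [set: R] (huber_relu h).
Proof.
apply: measurable_fun_ifT; first exact: measurable_ltr_cst.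
  exact: measurable_cst.
apply: measurable_fun_ifT; first exact: measurable_ler_cst.
  by apply: measurable_funM; [apply: measurable_funX; exact: measurable_id|exact: measurable_cst].
by apply: measurable_funB; [exact: measurable_id|exact: measurable_cst].
Qed.

End HuberRelu.

(** * The logistic loss of one margin *)

Section Logistic.
Variable R : realType.
Implicit Types m u : R.

Definition logi m : R := ln (1 + expR (- m)).
(** Minus the derivative of [logi]: the weight of an example in the gradient. *)
Definition sig m : R := (1 + expR m)^-1.

Lemma one_expR_gt0 m : 0 < 1 + expR m.
Proof. by rewrite addr_gt0// expR_gt0. Qed.

Lemma sig_gt0 m : 0 < sig m. Proof. by rewrite invr_gt0 one_expR_gt0. Qed.

Lemma sig_le1 m : sig m <= 1.
Proof.
by rewrite invf_le1 ?one_expR_gt0// lerDl expR_ge0.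
Qed.

Lemma expR_logi m : expR (logi m) = 1 + expR (- m).
Proof. by rewrite /logi lnK// posrE one_expR_gt0. Qed.

Lemma sigE m : sig m = expR (- m) / (1 + expR (- m)).
Proof.
rewrite /sig (expRN m); have := expR_gt0 m; move: (expR m) => q q0.
by field; rewrite !gt_eqF//; lra.
Qed.

Lemma sig_logi m : sig m = 1 - expR (- logi m).
Proof.
rewrite sigE [in RHS]expRN expR_logi; have := one_expR_gt0 (- m).
by move: (expR (- m)) => q q0; field; rewrite gt_eqF.
Qed.

Lemma logi_gt0 m : 0 < logi m.
Proof. by rewrite /logi ln_gt0// ltrDl expR_gt0. Qed.

Lemma sig_le_logi m : sig m <= logi m.
Proof. by rewrite sig_logi; have := expR_ge1Dx (- logi m); lra. Qed.

Lemma logi_le_exp m : logi m <= expR (- m).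
Proof. by have := expR_ge1Dx (logi m); rewrite expR_logi; lra. Qed.

Lemma sig_ge_logi m : logi m - 2 * logi m ^+ 2 <= sig m.
Proof.
rewrite sig_logi.
have := @expR_le_quad2 _ (- logi m); rewrite sqrrN => h.
by have := h (le_trans _ (_ : 0 <= 2^-1)); have := logi_gt0 m; lra.
Qed.

Lemma logi_lower m u : logi m - sig m * u <= logi (m + u).
Proof.
rewrite -ler_expR expRD !expR_logi.
have q1 := one_expR_gt0 (- m).
set q := expR (- m) in q1 *.
have e1 : 1 + expR (- (m + u)) = 1 + q * expR (- u) by rewrite opprD expRD.
rewrite e1.
have q0 : 0 < q by exact: expR_gt0.
set w := sig m.
have wE : w * (1 + q) = q by rewrite /w sigE -/q mulfVK// gt_eqF.
have w0 : 0 <= w by rewrite ltW ?sig_gt0.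
have w1 : 0 <= 1 - w by rewrite subr_ge0 sig_le1.
(* Jensen for exp with weights [1 - w, w], through tangents at the barycenter. *)
have h1 : (1 - w) * (expR (- (w * u)) * (1 + w * u)) <= (1 - w) * 1.
  rewrite ler_wpM2l// -[leRHS]expR0 -(addNr (w * u)) expRD ler_wpM2l ?expR_ge0//.
  exact: expR_ge1Dx.
have h2 : w * (expR (- (w * u)) * (1 + (w * u - u))) <= w * expR (- u).
  have -> : expR (- u) = expR (- (w * u)) * expR (w * u - u).
    by rewrite -expRD; congr expR; ring.
  by rewrite ler_wpM2l// ler_wpM2l ?expR_ge0// expR_ge1Dx.
have h3 : expR (- (w * u)) <= (1 - w) + w * expR (- u) by lra.
have -> : 1 + q * expR (- u) = (1 + q) * ((1 - w) + w * expR (- u)).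
  transitivity ((1 + q) - w * (1 + q) + w * (1 + q) * expR (- u)); last by ring.
  by rewrite wE; ring.
by rewrite ler_wpM2l// ltW.
Qed.

(** The quadratic term keeps the factor [sig m]; this makes the remainder in [loss_taylor]
    proportional to the loss and allows large steps once the loss is small. *)
Lemma logi_upper m u : - u <= 2^-1 ->
  logi (m + u) <= logi m - sig m * u + 2 * sig m * u ^+ 2.
Proof.
move=> u1; have q1 := one_expR_gt0 (- m).
have h0 : logi (m + u) - logi m <= sig m * (expR (- u) - 1).
  rewrite /logi -ln_div ?posrE ?one_expR_gt0//.
  have e0 : (1 + expR (- (m + u))) / (1 + expR (- m)) = 1 + sig m * (expR (- u) - 1).
    by rewrite sigE opprD expRD; field; rewrite gt_eqF.
  rewrite e0; apply: le_trans (le_ln1Dx _) _; last by [].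
  rewrite -subr_gt0 opprK addrC -e0.
  by rewrite divr_gt0// one_expR_gt0.
have h1 := @expR_le_quad2 _ (- u) u1; rewrite sqrrN in h1.
have := ler_wpM2l (ltW (sig_gt0 m)) h1.
by lra.
Qed.

Lemma sig_near_half m e : 0 <= e -> e <= 2^-1 -> `|m| <= e ->
  2^-1 - e <= sig m <= 2^-1 + e.
Proof.
move=> e0 e1; rewrite ler_norml => /andP[m1 m2].
have h1 := expR_ge1Dx m.
have h2 : expR m <= 1 + 2 * e.
  apply: (@le_trans _ _ (expR e)); first by rewrite ler_expR.
  have := expR_le_quad2 e1; have : e * e <= e * 2^-1 by rewrite ler_wpM2l.
  by rewrite expr2; lra.
have q0 := one_expR_gt0 m.
rewrite /sig; apply/andP; split.
  rewrite -[leRHS]mul1r ler_pdivlMr//.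
  have [le|gt] := leP 0 (2^-1 - e).
    have := ler_wpM2l le h2; have := sqr_ge0 e; rewrite expr2; lra.
  by have : (2^-1 - e) * (1 + expR m) <= 0; [rewrite mulr_le0_ge0// ltW|lra].
rewrite -[leLHS]mul1r ler_pdivrMr//.
have p0 : 0 <= 2^-1 + e by lra.
have := ler_wpM2l p0 h1; have : e * e <= e * 2^-1 by rewrite ler_wpM2l.
have : e * (- e) <= e * m by rewrite ler_wpM2l.
lra.
Qed.

Lemma margin_lower m (l : R) : logi m <= l -> l <= 2^-1 -> - ln (2 * l) <= m.
Proof.
move=> ml l1; have l0 := lt_le_trans (logi_gt0 m) ml.
rewrite lerNl -ler_expR lnK ?posrE ?mulr_gt0//.
have : expR (logi m) <= expR l by rewrite ler_expR.
have h1 := expR_le_quad2 l1.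
have : l * l <= l * 2^-1 by rewrite ler_wpM2l// ltW.
by rewrite expR_logi; move: h1; rewrite expr2; lra.
Qed.

End Logistic.

Section FiniteSums.
Variable R : realType.

(** Lagrange's identity. *)
Lemma sum_CauchySchwarz (I : finType) (a b : I -> R) :
  (\sum_i a i * b i) ^+ 2 <= (\sum_i a i ^+ 2) * (\sum_i b i ^+ 2).
Proof.
have : 0 <= \sum_i \sum_k (a i * b k - a k * b i) ^+ 2.
  by rewrite sumr_ge0// => i _; rewrite sumr_ge0// => k _; rewrite sqr_ge0.
have -> : \sum_i \sum_k (a i * b k - a k * b i) ^+ 2 =
    2 * ((\sum_i a i ^+ 2) * (\sum_i b i ^+ 2)) - 2 * (\sum_i a i * b i) ^+ 2.
  transitivity (\sum_i \sum_k (a i ^+ 2 * b k ^+ 2 + b i ^+ 2 * a k ^+ 2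
      - 2 * (a i * b i) * (a k * b k))).
    by apply: eq_bigr => i _; apply: eq_bigr => k _; ring.
  transitivity (\sum_i (a i ^+ 2 * (\sum_k b k ^+ 2) + b i ^+ 2 * (\sum_k a k ^+ 2)
      - 2 * (a i * b i) * (\sum_k a k * b k))).
    by apply: eq_bigr => i _; rewrite !mulr_sumr -big_split -sumrB.
  rewrite sumrB big_split /= -!mulr_suml -mulr_sumr; ring.
by lra.
Qed.

Lemma sum_sqr_le (I : finType) (a : I -> R) :
  (\sum_i a i) ^+ 2 <= #|I|%:R * \sum_i a i ^+ 2.
Proof.
have := sum_CauchySchwarz (fun=> 1) a.
under eq_bigr do rewrite mul1r.
by rewrite expr1n sumr_const.
Qed.

Lemma mean_le n (a b : 'I_n -> R) : (forall s, a s <= b s) ->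
  n%:R^-1 * \sum_s a s <= n%:R^-1 * \sum_s b s.
Proof. by move=> ab; rewrite ler_wpM2l ?invr_ge0// ler_sum. Qed.

Lemma mean_cst n (c : R) : (0 < n)%N -> n%:R^-1 * \sum_(s < n) c = c.
Proof.
move=> n0; rewrite sumr_const card_ord -(mulr_natl c) mulKf//.
by rewrite pnatr_eq0 -lt0n.
Qed.

End FiniteSums.

Section Derivative.
Import numFieldNormedType.Exports.
Variable R : realType.

(** A quadratic remainder identifies the derivative, so the gradient needs no chain rule through the
    piecewise activation. *)
Lemma derive1_quadratic (F : R -> R) (a C e : R) : 0 < e ->
  (forall t, `|t| <= e -> `|F t - F 0 - a * t| <= C * t ^+ 2) -> derive1 F 0 = a.
Proof.
move=> e0 FC; rewrite /derive1; apply: cvg_lim => //.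
apply/cvgrPdist_le => eps eps0.
have C0 : 0 <= C.
  have := FC e; rewrite gtr0_norm// lexx => /(_ isT) h.
  by rewrite -(@pmulr_lge0 _ (e ^+ 2)) ?exprn_gt0//; apply: le_trans h.
have C1 : 0 < C + 1 by lra.
near=> t.
have t0 : t != 0 by near: t; exact: nbhs_dnbhs_neq.
have te : `|t| <= e.
  by near: t; apply: dnbhs0_le.
have te2 : `|t| <= eps / (C + 1).
  by near: t; apply: dnbhs0_le; rewrite divr_gt0.
rewrite addr0 (_ : a - _ = - (t^-1 * (F t - F 0 - a * t))); last first.
  by rewrite /GRing.scale /=; field.
rewrite normrN normrM normfV ler_pdivrMl ?normr_gt0//.
apply: le_trans (FC _ te) _.
rewrite -[t ^+ 2]real_normK ?num_real// expr2 mulrCA ler_wpM2l//.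
apply: (@le_trans _ _ ((C + 1) * `|t|)); first by rewrite ler_wpM2r//; lra.
by rewrite mulrC -ler_pdivlMr.
Unshelve. all: by end_near. Qed.

End Derivative.

(** * The network, its linearization and the gradient of the loss *)

Section Network.
Variables (R : realType) (p d n : nat) (X : 'I_n -> 'rV[R]_d) (Y : 'I_n -> R).
Local Notation J := 'I_d.+1.
Local Notation param := 'M[R]_(p.*2, d.+1).
Implicit Types (th dl : param) (x : 'rV[R]_d) (i : 'I_(p.*2)) (s : 'I_n).

(** Appends the coordinate that multiplies the bias: [unlift] is [None] at [ord_max], hence the
    default value 1. *)
Definition augment x : J -> R := fun j => oapp (x 0) 1 (unlift ord_max j).

Definition preact th x i : R := lin (augment x) (fun j => th i j).

Lemma preactE th x i : dotv (vw th i) x + bias th i = preact th x i.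
Proof.
rewrite /preact /lin big_ord_recr /=; congr (_ + _).
  apply: eq_bigr => j _; rewrite /augment /vw mxE mulrC; congr (_ * _).
  have -> : widen_ord (leqnSn d) j = lift ord_max j.
    by apply: val_inj; rewrite /= /bump leqNgt ltn_ord.
  by rewrite liftK.
by rewrite /augment unlift_none mul1r.
Qed.

Lemma augment_bias x : augment x ord_max = 1.
Proof. by rewrite /augment unlift_none. Qed.

Lemma inner_augment x y : inner (augment x) (augment y) = dotv x y + 1.
Proof.
rewrite /inner big_ord_recr /= !augment_bias mulr1; congr (_ + _).
apply: eq_bigr => j _; rewrite /augment.
have -> : widen_ord (leqnSn d) j = lift ord_max j.
  by apply: val_inj; rewrite /= /bump leqNgt ltn_ord.
by rewrite liftK.
Qed.

Lemma preactD th dl x i : preact (th + dl) x i = preact th x i + preact dl x i.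
Proof.
by rewrite /preact /lin -big_split; apply: eq_bigr => j _; rewrite mxE mulrDr.
Qed.

Lemma preactZ k th x i : preact (k *: th) x i = k * preact th x i.
Proof.
by rewrite /preact /lin mulr_sumr; apply: eq_bigr => j _; rewrite mxE mulrCA.
Qed.

Definition mxdot (A B : param) : R := \sum_i \sum_j A i j * B i j.
Definition fro2 A : R := mxdot A A.

Lemma mxdot_CS A B : mxdot A B ^+ 2 <= fro2 A * fro2 B.
Proof.
rewrite /fro2 /mxdot !pair_bigA /=.
exact: (sum_CauchySchwarz (fun q => A q.1 q.2) (fun q => B q.1 q.2)).
Qed.

Lemma fro2_ge0 A : 0 <= fro2 A.
Proof. by rewrite sumr_ge0// => i _; rewrite sumr_ge0// => j _; rewrite -expr2 sqr_ge0. Qed.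

Lemma fro2Z k A : fro2 (k *: A) = k ^+ 2 * fro2 A.
Proof.
rewrite /fro2 /mxdot mulr_sumr; apply: eq_bigr => i _; rewrite mulr_sumr.
by apply: eq_bigr => j _; rewrite !mxE expr2; ring.
Qed.

Lemma fro2D A B : fro2 (A + B) = fro2 A + 2 * mxdot A B + fro2 B.
Proof.
rewrite /fro2 /mxdot mulr_sumr -!big_split; apply: eq_bigr => i _ /=.
by rewrite mulr_sumr -!big_split; apply: eq_bigr => j _; rewrite !mxE /=; ring.
Qed.

Lemma outw_sqr i : outw R i * outw R i = 1.
Proof. by rewrite /outw; case: ifP => _; ring. Qed.

Lemma norm_outw i : `|outw R i| = 1.
Proof. by rewrite /outw; case: ifP => _; rewrite ?normrN normr1. Qed.

Hypothesis p0 : (0 < p)%N.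
Hypothesis n0 : (0 < n)%N.
Hypothesis HX : forall s, inner (augment (X s)) (augment (X s)) = 2.
Hypothesis HY : forall s, Y s = 1 \/ Y s = -1.
Local Notation h := (p%:R^-1 : R).

Let pR0 : 0 < p%:R :> R. Proof. by rewrite ltr0n. Qed.
Let h0 : 0 < h. Proof. by rewrite invr_gt0. Qed.

Lemma labelK s : Y s * Y s = 1.
Proof. by case: (HY s) => ->; ring. Qed.

Lemma norm_label s : `|Y s| = 1.
Proof. by case: (HY s) => ->; rewrite ?normrN normr1. Qed.

Lemma sum_preact_sqr dl s : \sum_i preact dl (X s) i ^+ 2 <= 2 * fro2 dl.
Proof.
rewrite /fro2 /mxdot mulr_sumr ler_sum// => i _.
rewrite /preact /lin; apply: le_trans (sum_CauchySchwarz _ _) _.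
have -> : \sum_j augment (X s) j ^+ 2 = 2 by rewrite -(HX s); apply: eq_bigr.
by [].
Qed.

(** The factor [4 * p] is the number [2p] of units, from Cauchy-Schwarz, times the squared norm 2 of
    an augmented input. *)
Lemma sum_norm_preact dl s : (\sum_i `|preact dl (X s) i|) ^+ 2 <= 4 * p%:R * fro2 dl.
Proof.
apply: le_trans (sum_sqr_le _) _; rewrite card_ord.
under eq_bigr do rewrite real_normK ?num_real//.
rewrite (_ : 4 * p%:R * _ = (p.*2)%:R * (2 * fro2 dl)).
  by rewrite ler_wpM2l// sum_preact_sqr.
by rewrite -muln2 natrM; ring.
Qed.

Local Notation phi := (huber_relu h).
Local Notation dphi := (huber_deriv h).
Local Notation f := (net h).

Lemma netE th x : f th x = \sum_i outw R i * phi (preact th x i).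
Proof. by apply: eq_bigr => i _; rewrite preactE. Qed.

Definition dnet th x dl : R :=
  \sum_i outw R i * (dphi (preact th x i) * preact dl x i).

Lemma net_Lipschitz th dl s : (f (th + dl) (X s) - f th (X s)) ^+ 2 <= 4 * p%:R * fro2 dl.
Proof.
apply: le_trans (sum_norm_preact dl s).
rewrite -[leLHS]real_normK ?num_real// lerXn2r ?nnegrE ?normr_ge0 ?sumr_ge0//.
rewrite !netE -sumrB; apply: le_trans (ler_norm_sum _ _ _) _; apply: ler_sum => i _.
rewrite -mulrBr normrM norm_outw mul1r; apply: le_trans (huber_Lipschitz h0 _ _) _.
by rewrite preactD addrAC subrr add0r.
Qed.

Lemma dnet_bound th dl s : dnet th (X s) dl ^+ 2 <= 4 * p%:R * fro2 dl.
Proof.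
apply: le_trans (sum_norm_preact dl s).
rewrite -[leLHS]real_normK ?num_real// lerXn2r ?nnegrE ?normr_ge0 ?sumr_ge0//.
apply: le_trans (ler_norm_sum _ _ _) _; apply: ler_sum => i _.
have /andP[a0 a1] := huber_deriv_bounds h0 (preact th (X s) i).
by rewrite !normrM norm_outw mul1r ler_piMl// ger0_norm.
Qed.

Lemma net_taylor th dl s :
  `|f (th + dl) (X s) - f th (X s) - dnet th (X s) dl| <= p%:R * fro2 dl.
Proof.
rewrite !netE /dnet -!sumrB; apply: le_trans (ler_norm_sum _ _ _) _.
apply: (@le_trans _ _ (\sum_i preact dl (X s) i ^+ 2 / (h *+ 2))).
  apply: ler_sum => i _; rewrite -!mulrBr normrM norm_outw mul1r.
  have := huber_taylor h0 (preact th (X s) i) (preact (th + dl) (X s) i).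
  rewrite preactD (addrAC _ _ (- preact th _ _)) subrr add0r => /andP[g0 g1].
  by rewrite ger0_norm.
rewrite -mulr_suml (_ : (h *+ 2)^-1 = p%:R / 2); last first.
  by rewrite -mulr_natr; field; rewrite gt_eqF.
rewrite mulrC -mulrA ler_wpM2l ?(ltW pR0)// ler_pdivrMl//.
exact: sum_preact_sqr.
Qed.

(** Approximate Euler identity: [2p] units, each off by at most [h / 2], and [h = 1 / p]. *)
Lemma dnet_self th s : `|dnet th (X s) th - f th (X s)| <= 1.
Proof.
rewrite netE /dnet -sumrB; apply: le_trans (ler_norm_sum _ _ _) _.
apply: (@le_trans _ _ (\sum_(i < p.*2) h / 2)).
  apply: ler_sum => i _; rewrite -mulrBr normrM norm_outw mul1r.
  exact: huber_almost_homogeneous.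
rewrite sumr_const card_ord -(mulr_natl (h / 2)) -muln2 natrM.
by rewrite le_eqVlt; apply/orP; left; apply/eqP; field; rewrite gt_eqF.
Qed.

Local Notation L := (loss h X Y).
Local Notation margin th s := (Y s * f th (X s)).

Lemma lossE th : L th = n%:R^-1 * \sum_s logi (margin th s).
Proof. by []. Qed.

Lemma loss_gt0 th : 0 < L th.
Proof.
rewrite lossE mulr_gt0 ?invr_gt0 ?ltr0n//.
rewrite (bigD1 (Ordinal n0))//= ltr_pwDl ?logi_gt0// sumr_ge0// => s _.
by rewrite ltW ?logi_gt0.
Qed.

Lemma logi_le_loss th s : logi (margin th s) <= n%:R * L th.
Proof.
rewrite lossE mulrA divff ?mul1r ?pnatr_eq0 -?lt0n//.
by rewrite (bigD1 s)//= lerDl sumr_ge0// => k _; rewrite ltW ?logi_gt0.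
Qed.

Definition mean_sig th : R := n%:R^-1 * \sum_s sig (margin th s).

Lemma mean_sig_ge0 th : 0 <= mean_sig th.
Proof. by rewrite mulr_ge0 ?invr_ge0// sumr_ge0// => s _; rewrite ltW ?sig_gt0. Qed.

Lemma mean_sig_le_loss th : mean_sig th <= L th.
Proof. by apply: mean_le => s; exact: sig_le_logi. Qed.

Lemma mean_sig_le1 th : mean_sig th <= 1.
Proof.
by rewrite -[leRHS](mean_cst 1 n0); apply: mean_le => s; exact: sig_le1.
Qed.

Definition dloss th dl : R :=
  n%:R^-1 * \sum_s - (sig (margin th s) * (Y s * dnet th (X s) dl)).

(** Here [9 = 1 + 2 * 4]: the curvature of the network plus that of [logi], whose increment
    satisfies [u ^+ 2 <= 4 * p * fro2 dl]. The smallness hypothesis gives [|u| <= 2^-1], as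
    [logi_upper] requires. *)
Lemma loss_taylor th dl : 4 * p%:R * fro2 dl <= 4^-1 ->
  `|L (th + dl) - L th - dloss th dl| <= 9 * p%:R * L th * fro2 dl.
Proof.
move=> small.
have F0 := fro2_ge0 dl.
pose B := 9 * p%:R * fro2 dl.
have B0 : 0 <= B by rewrite !mulr_ge0.
have key s : `|logi (margin (th + dl) s) - logi (margin th s)
    + sig (margin th s) * (Y s * dnet th (X s) dl)| <= B * sig (margin th s).
  set m := margin th s; pose u := Y s * (f (th + dl) (X s) - f th (X s)).
  have -> : margin (th + dl) s = m + u by rewrite /u /m; ring.
  have u2 : u ^+ 2 <= 4 * p%:R * fro2 dl.
    by rewrite /u exprMn expr2 labelK mul1r net_Lipschitz.
  have u_half : `|u| <= 2^-1.
    rewrite -(@ler_pXn2r _ 2) ?nnegrE// real_normK ?num_real//.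
    by apply: le_trans u2 _; apply: le_trans small _; rewrite expr2; lra.
  have h1 := logi_lower m u; have h2 : logi (m + u) <= _ := @logi_upper _ m u _.
  have g0 := sig_gt0 m.
  have d1 : `|u - Y s * dnet th (X s) dl| <= p%:R * fro2 dl.
    by rewrite /u -mulrBr normrM norm_label mul1r net_taylor.
  have {}h2 : logi (m + u) <= logi m - sig m * u + 2 * sig m * u ^+ 2.
    by apply: logi_upper; apply: le_trans u_half; rewrite -normrN ler_norm.
  have h3 : sig m * `|u - Y s * dnet th (X s) dl| <= sig m * (p%:R * fro2 dl).
    by rewrite ler_wpM2l// ltW.
  have h4 : sig m * u ^+ 2 <= sig m * (4 * p%:R * fro2 dl).
    by rewrite ler_wpM2l// ltW.
  have h5 := ler_wpM2l (ltW g0) (ler_norm (u - Y s * dnet th (X s) dl)).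
  have h6 := ler_wpM2l (ltW g0) (ler_norm (- (u - Y s * dnet th (X s) dl))).
  rewrite normrN in h6.
  have h7 : 0 <= sig m * (p%:R * fro2 dl) by rewrite !mulr_ge0// ltW.
  by rewrite /B ler_norml; apply/andP; split; lra.
have -> : L (th + dl) - L th - dloss th dl = n%:R^-1 * \sum_s
   (logi (margin (th + dl) s) - logi (margin th s)
    + sig (margin th s) * (Y s * dnet th (X s) dl)).
  by rewrite big_split /= sumrB !lossE /dloss sumrN; ring.
rewrite normrM ger0_norm ?invr_ge0//.
apply: (@le_trans _ _ (B * mean_sig th)); last first.
  rewrite (_ : 9 * _ * _ * _ = B * L th); last by rewrite /B; ring.
  by rewrite ler_wpM2l// mean_sig_le_loss.
rewrite /mean_sig mulrCA ler_wpM2l ?invr_ge0//.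
by apply: le_trans (ler_norm_sum _ _ _) _; rewrite mulr_sumr ler_sum.
Qed.

Definition gradL th : param := \matrix_(i, j) dloss th (delta_mx i j).

Lemma dnetD th x A B : dnet th x (A + B) = dnet th x A + dnet th x B.
Proof.
by rewrite /dnet -big_split; apply: eq_bigr => i _ /=; rewrite preactD; ring.
Qed.

Lemma dnetZ th x k A : dnet th x (k *: A) = k * dnet th x A.
Proof.
by rewrite /dnet mulr_sumr; apply: eq_bigr => i _ /=; rewrite preactZ; ring.
Qed.

Lemma dlossD th A B : dloss th (A + B) = dloss th A + dloss th B.
Proof.
rewrite /dloss -mulrDr -big_split /=.
by congr (_ * _); apply: eq_bigr => s _; rewrite dnetD; ring.
Qed.

Lemma dlossZ th k A : dloss th (k *: A) = k * dloss th A.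
Proof.
rewrite /dloss [RHS]mulrCA [X in _ = _ * X]mulr_sumr; congr (_ * _); apply: eq_bigr => s _ /=.
by rewrite dnetZ; ring.
Qed.

Lemma dloss_sum th (I : finType) (A : I -> param) :
  dloss th (\sum_k A k) = \sum_k dloss th (A k).
Proof.
apply: (big_morph (dloss th) (dlossD th)).
by rewrite -(scale0r (0 : param)) dlossZ mul0r.
Qed.

Lemma mxdot_gradL th dl : mxdot (gradL th) dl = dloss th dl.
Proof.
rewrite [in RHS](matrix_sum_delta dl) dloss_sum; apply: eq_bigr => i _.
rewrite dloss_sum; apply: eq_bigr => j _.
by rewrite dlossZ mxE mulrC.
Qed.

Lemma fro2_delta i j : fro2 (delta_mx i j) = 1.
Proof.
rewrite /fro2 /mxdot (bigD1 i)//= [X in _ + X]big1 ?addr0; last first.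
  by move=> k /negbTE ki; rewrite big1// => l _; rewrite mxE ki mul0r.
rewrite (bigD1 j)//= [X in _ + X]big1 ?addr0; last first.
  by move=> k /negbTE kj; rewrite mxE kj andbF mul0r.
by rewrite mxE !eqxx mul1r.
Qed.

Lemma gradE th : grad L th = gradL th.
Proof.
apply/matrixP => i j; rewrite !mxE.
(* The largest [e] for which [t *: delta_mx i j] with [|t| <= e] meets the smallness condition of
   [loss_taylor]. *)
pose e : R := Num.sqrt (16 * p%:R)^-1.
have e0 : 0 < e by rewrite sqrtr_gt0 invr_gt0 mulr_gt0.
apply: (@derive1_quadratic _ _ _ (9 * p%:R * L th) e) => // t te.
rewrite scale0r addr0.
have := @loss_taylor th (t *: delta_mx i j).
rewrite fro2Z fro2_delta mulr1 dlossZ (mulrC t); apply.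
have : t ^+ 2 <= e ^+ 2.
  by rewrite -[leLHS]real_normK ?num_real// lerXn2r ?nnegrE// ltW.
rewrite sqr_sqrtr ?invr_ge0 ?mulr_ge0// => t2.
apply: (@le_trans _ _ (4 * p%:R * (16 * p%:R)^-1)).
  by rewrite ler_wpM2l// mulr_ge0.
by rewrite le_eqVlt; apply/orP; left; apply/eqP; field; rewrite gt_eqF.
Qed.

(** The squared norm of [G] is the derivative of the loss along [G], hence at most [mean_sig th]
    times [Num.sqrt (4 * p * fro2 G)]. It serves with [B] the loss during descent and with [B = 1]
    in the first step. *)
Lemma fro2_gradL_le th B : mean_sig th <= B -> fro2 (gradL th) <= 4 * p%:R * B ^+ 2.
Proof.
move=> sB; set G := gradL th.
have B0 := le_trans (mean_sig_ge0 th) sB.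
set q := Num.sqrt (4 * p%:R * fro2 G).
have q2 : q ^+ 2 = 4 * p%:R * fro2 G by rewrite sqr_sqrtr// !mulr_ge0// fro2_ge0.
have q0 : 0 <= q by rewrite sqrtr_ge0.
have h1 : fro2 G <= q * B.
  apply: (@le_trans _ _ (q * mean_sig th)); last by rewrite ler_wpM2l.
  rewrite [leLHS]/fro2 mxdot_gradL /dloss /mean_sig [leRHS]mulrCA ler_wpM2l ?invr_ge0//.
  rewrite mulr_sumr ler_sum// => s _.
  rewrite (mulrC q) -mulrN ler_wpM2l ?(ltW (sig_gt0 _))//.
  apply: le_trans (ler_norm _) _; rewrite normrN normrM norm_label mul1r.
  rewrite -(@ler_pXn2r _ 2) ?nnegrE// real_normK ?num_real// q2.
  exact: dnet_bound.
have h2 : fro2 G ^+ 2 <= fro2 G * (4 * p%:R * B ^+ 2).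
  rewrite (_ : fro2 G * _ = (q * B) ^+ 2); last by rewrite exprMn q2; ring.
  by rewrite lerXn2r ?nnegrE ?fro2_ge0// mulr_ge0.
have [G0|G0] := leP (fro2 G) 0; first by apply: le_trans G0 _; rewrite !mulr_ge0 ?sqr_ge0.
by rewrite expr2 ler_pM2l in h2.
Qed.

Lemma dloss_self th :
  n%:R^-1 * \sum_s sig (margin th s) * (margin th s - 1) <= - dloss th th.
Proof.
rewrite /dloss -mulrN -sumrN; apply: mean_le => s.
rewrite opprK ler_wpM2l ?(ltW (sig_gt0 _))//.
have := dnet_self th s.
have : `|Y s * (dnet th (X s) th - f th (X s))| = `|dnet th (X s) th - f th (X s)|.
  by rewrite normrM norm_label mul1r.
move=> <-; rewrite mulrBr ler_norml => /andP[]; lra.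
Qed.

End Network.

(** * Convergence of gradient descent from a small loss *)

(** Solves [3 / 4 * (2 / 3) ^+ 2 / 80 * rate_const = 1], where the constants of descent, alignment
    and step size meet in [inv_loss_growth]. *)
Definition rate_const (R : realType) : R := 240.

Lemma rate_const_gt0 (R : realType) : 0 < rate_const R.
Proof. by rewrite /rate_const ltr0n. Qed.

(** * One step in real numbers: losses [L], [L'], parameter norm [N], gradient norm [g], step size
    [a] *)

Section StepArithmetic.
Variable R : realType.
Variables (L L' l l' N g a : R).
Hypotheses (L0 : 0 < L) (L'0 : 0 < L') (N0 : 0 < N) (a0 : 0 < a) (l0 : 0 < l).
Hypothesis descent_ineq : L' <= L - 3 / 4 * (a * g ^+ 2).
Hypothesis alignment : 2 / 3 * (L * l) <= g * N.

Let Ll0 : 0 < L * l. Proof. by rewrite mulr_gt0. Qed.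
Let gN0 : 0 < g * N. Proof. by apply: lt_le_trans alignment; rewrite mulr_gt0. Qed.
Let g0 : 0 < g. Proof. by rewrite -(pmulr_lgt0 _ N0). Qed.

(** By [ln x <= x - 1] the logarithm gains at least [3 / 4 * a * g ^+ 2 / L], and alignment replaces
    one factor [g / L] by [2 / 3 * l / N]. *)
Lemma log_growth : l = ln L^-1 -> l' = ln L'^-1 -> l * (1 + 2^-1 * (a * g / N)) <= l'.
Proof.
move=> lE l'E.
have r0 : 0 < L' / L by rewrite divr_gt0.
have h1 : ln (L' / L) <= L' / L - 1.
  have := @le_ln1Dx R (L' / L - 1); rewrite (addrC 1) subrK; apply.
  by rewrite ltrBrDl subrr.
have h2 : l' = l - ln (L' / L).
  by rewrite ln_div ?posrE// lE l'E !lnV ?posrE//; ring.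
have h3 : 3 / 4 * (a * g ^+ 2) / L <= 1 - L' / L.
  rewrite ler_pdivrMr// mulrBl divfK ?gt_eqF// mul1r.
  by move: descent_ineq; lra.
have h4 : l * (2^-1 * (a * g / N)) <= 3 / 4 * (a * g ^+ 2) / L.
  rewrite ler_pdivlMr//.
  rewrite (_ : l * _ * _ = 3 / 4 * (a * g) / N * (2 / 3 * (L * l))); last first.
    by field; rewrite gt_eqF.
  rewrite (_ : 3 / 4 * (a * g ^+ 2) = 3 / 4 * (a * g) / N * (g * N)); last first.
    by field; rewrite gt_eqF.
  by rewrite ler_wpM2l// divr_ge0 ?(ltW N0)// !mulr_ge0// ltW.
by rewrite mulrDr mulr1 h2; move: h1 h3 h4; lra.
Qed.

(** With [x = a * g / N], the norm grows by a factor at most [1 + x] and [l] by at least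
    [1 + x / 2]. As [1 + x <= (1 + x / 2) ^+ 2], the norm cannot outgrow [l ^+ 2]. *)
Lemma norm_growth (N' l1 M : R) : 0 < l1 -> 0 < M -> 0 < l' ->
  l * (1 + 2^-1 * (a * g / N)) <= l' ->
  N' <= (N * (1 + a * g / N)) ^+ 2 ->
  N ^+ 2 * l1 ^+ 4 <= M * l ^+ 4 -> N' * l1 ^+ 4 <= M * l' ^+ 4.
Proof.
move=> l10 M0 l'0 grow; set x := a * g / N in grow *; move=> N'_le inv.
have x0 : 0 < x by rewrite divr_gt0// mulr_gt0.
have sqx : 1 + x <= (1 + 2^-1 * x) ^+ 2.
  rewrite (_ : (1 + 2^-1 * x) ^+ 2 = 1 + x + (2^-1 * x) ^+ 2); last by field.
  by rewrite lerDl sqr_ge0.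
have x1 : 0 <= 1 + x by rewrite addr_ge0// ltW.
have x2 : 0 <= 1 + 2^-1 * x by rewrite addr_ge0// mulr_ge0// ltW.
apply: (@le_trans _ _ ((N * (1 + x)) ^+ 2 * l1 ^+ 4)).
  by rewrite ler_wpM2r// exprn_ge0// ltW.
apply: (@le_trans _ _ (M * (l ^+ 2 * (1 + x)) ^+ 2)).
  rewrite (_ : M * _ = M * l ^+ 4 * (1 + x) ^+ 2); last by ring.
  rewrite (_ : _ * l1 ^+ 4 = N ^+ 2 * l1 ^+ 4 * (1 + x) ^+ 2); last by ring.
  by rewrite ler_wpM2r ?sqr_ge0.
rewrite ler_wpM2l ?(ltW M0)// (_ : l' ^+ 4 = (l' ^+ 2) ^+ 2); last by ring.
rewrite ler_pXn2r ?nnegrE ?sqr_ge0//; last by rewrite mulr_ge0 ?sqr_ge0.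
apply: (@le_trans _ _ ((l * (1 + 2^-1 * x)) ^+ 2)).
  by rewrite exprMn ler_wpM2l ?sqr_ge0.
by rewrite ler_pXn2r ?nnegrE// ?(ltW l'0)// mulr_ge0// ltW.
Qed.

(** [L'^-1 - L^-1 >= (L - L') / L ^+ 2]. Two powers of [l] from the step size and two from alignment
    cancel [l ^+ 4] in the norm bound, so the increment is the same at every step. *)
Lemma inv_loss_growth (P l1 M : R) : 0 < P -> 0 < l1 -> 0 < M ->
  a * P = 80^-1 * l ^+ 2 -> N ^+ 2 * l1 ^+ 4 <= M * l ^+ 4 ->
  L^-1 + l1 ^+ 4 / (rate_const R * P * M) <= L'^-1.
Proof.
move=> P0 l10 M0 aP inv.
have ag0 : 0 <= 3 / 4 * (a * g ^+ 2) by rewrite mulr_ge0// mulr_ge0 ?sqr_ge0// ltW.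
have LL : L' <= L by apply: (le_trans descent_ineq); rewrite gerBl.
have rate : l1 ^+ 4 / (rate_const R * P * M) * L ^+ 2 <= 3 / 4 * (a * g ^+ 2).
  have den0 : 0 < rate_const R * P * M by rewrite !mulr_gt0 ?rate_const_gt0.
  rewrite mulrAC ler_pdivrMr//.
  have h1 : (2 / 3 * (L * l)) ^+ 2 <= (g * N) ^+ 2.
    by rewrite ler_pXn2r ?nnegrE ?(ltW gN0)// mulr_ge0// ltW.
  have h2 : l1 ^+ 4 * L ^+ 2 * N ^+ 2 <= M * l ^+ 4 * L ^+ 2.
    by rewrite mulrAC ler_wpM2r ?sqr_ge0// mulrC.
  rewrite -(@ler_pM2r _ (N ^+ 2)) ?exprn_gt0//.
  apply: (le_trans h2).
  rewrite (_ : 3 / 4 * _ * _ * _ = 3 / 4 * rate_const R * (a * P) * M * (g * N) ^+ 2);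
    last by field.
  rewrite aP; apply: (@le_trans _ _ (3 / 4 * rate_const R * (80^-1 * l ^+ 2) * M *
    (2 / 3 * (L * l)) ^+ 2)).
    by rewrite le_eqVlt; apply/orP; left; apply/eqP; rewrite /rate_const; field.
  have c0 : 0 <= 3 / 4 * rate_const R * (80^-1 * l ^+ 2) * M.
    by rewrite mulr_ge0 ?(ltW M0)// mulr_ge0 ?mulr_ge0 ?sqr_ge0// ltW ?rate_const_gt0.
  by rewrite ler_wpM2l.
have den0 : 0 < rate_const R * P * M by rewrite !mulr_gt0 ?rate_const_gt0.
rewrite -lerBrDl; set rho := l1 ^+ 4 / _ in rate *.
rewrite (_ : L'^-1 - L^-1 = (L - L') / (L * L')); last by field; rewrite !gt_eqF.
rewrite ler_pdivlMr ?mulr_gt0//.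
apply: (@le_trans _ _ (rho * L ^+ 2)); last first.
  by move: rate descent_ineq; lra.
have rho0 : 0 <= rho by rewrite divr_ge0 ?exprn_ge0// ltW.
by rewrite ler_wpM2l// expr2 ler_wpM2l// ltW.
Qed.

End StepArithmetic.

Section Convergence.
Variables (R : realType) (p d n : nat) (X : 'I_n -> 'rV[R]_d) (Y : 'I_n -> R).
Local Notation param := 'M[R]_(p.*2, d.+1).
Implicit Types (th dl : param) (s : 'I_n).
Hypothesis p0 : (0 < p)%N.
Hypothesis n0 : (0 < n)%N.
Hypothesis HX : forall s, inner (augment (X s)) (augment (X s)) = 2.
Hypothesis HY : forall s, Y s = 1 \/ Y s = -1.
Local Notation h := (p%:R^-1 : R).
Local Notation L := (loss (p := p) h X Y).
Local Notation ell th := (ln (L th)^-1).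

Let pR0 : 0 < p%:R :> R. Proof. by rewrite ltr0n. Qed.
Let nR0 : 0 < n%:R :> R. Proof. by rewrite ltr0n. Qed.

Lemma loss_expR th : L th = expR (- ell th).
Proof. by rewrite lnV ?posrE ?loss_gt0// opprK lnK// posrE loss_gt0. Qed.

Lemma ell_sqr_loss th : 0 <= ell th -> ell th ^+ 2 * L th <= 2.
Proof.
move=> l0; rewrite [X in _ * X]loss_expR expRN ler_pdivrMr ?expR_gt0//.
exact: sqr_le_expR.
Qed.

(** Once [ell th] dominates [ln (2 * n)], each margin [m] has [m - 1 >= 11 / 12 * ell th] and each
    weight [sig m >= 5 / 6 * logi m]; the product of the two fractions exceeds [2 / 3]. *)
Lemma gradient_alignment th : 12 * (ln (2 * n%:R) + 1) <= ell th ->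
  2 / 3 * (L th * ell th) <= - dloss X Y th th.
Proof.
move=> big; have Lp := loss_gt0 X Y n0 th.
have n1 : 1 <= n%:R :> R by rewrite ler1n.
have ln0 : 0 <= ln (2 * n%:R) :> R by apply: ln_ge0; lra.
have l12 : 12 <= ell th by lra.
have nL : n%:R * L th <= 12^-1.
  have : ln (2 * n%:R) <= ell th - 12 by lra.
  rewrite -ler_expR lnK ?posrE ?mulr_gt0// expRD => hh.
  have e1 : L th * expR (ell th) = 1 by rewrite [X in X * _]loss_expR -expRD addNr expR0.
  have := ler_wpM2l (ltW Lp) hh; rewrite (mulrA _ (expR _)) e1 mul1r => h1.
  have h2 : expR (-12 : R) <= 6^-1.
    rewrite expRN lef_pV2 ?posrE ?expR_gt0//.
    by apply: le_trans (expR_ge1Dx _); lra.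
  by lra.
apply: le_trans (dloss_self X p0 HY th).
apply: (@le_trans _ _ (n%:R^-1 * \sum_s logi (Y s * net h th (X s)) *
    (5 / 6 * (11 / 12 * ell th)))).
  rewrite -mulr_suml (mulrA n%:R^-1) -/(L th).
  have : 0 <= L th * ell th by rewrite mulr_ge0 ?(ltW Lp)//; lra.
  by rewrite /=; lra.
apply: mean_le => s; set m := Y s * net h th (X s).
have m1 : logi m <= n%:R * L th by exact: logi_le_loss.
have m2 : - ln (2 * (n%:R * L th)) <= m by apply: margin_lower => //; lra.
have m3 : 11 / 12 * ell th <= m - 1.
  have : ln (2 * (n%:R * L th)) = ln (2 * n%:R) - ell th.
    have n2 : 0 < 2 * n%:R :> R by rewrite mulr_gt0.
    by rewrite mulrA lnM ?posrE// lnV ?posrE// opprK.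
  by lra.
have lm := logi_gt0 m.
have s1 : 5 / 6 * logi m <= sig m.
  apply: le_trans (sig_ge_logi m).
  have : logi m * logi m <= logi m * 12^-1.
    by rewrite ler_wpM2l ?(ltW lm)//; exact: le_trans m1 nL.
  by rewrite expr2; lra.
rewrite (mulrA (logi m)) (mulrC (logi m)); apply: ler_pM => //; last by lra.
by apply: mulr_ge0; [lra|exact: ltW].
Qed.

(** The factor [80^-1] makes the second-order term at most a quarter of the first-order one:
    [9 * p * a * L <= 9 * 2 / 80 < 1 / 4], by [ell_sqr_loss]. *)
Definition gd_rate th : R := 80^-1 * ell th ^+ 2 / p%:R.

Lemma descent th : 0 <= ell th ->
  L (th - gd_rate th *: gradL X Y th) <=
    L th - 3 / 4 * (gd_rate th * fro2 (gradL X Y th)).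
Proof.
move=> l0; set G := gradL X Y th; set a := gd_rate th.
have Lp := loss_gt0 X Y n0 th.
have a0 : 0 <= a by rewrite mulr_ge0 ?mulr_ge0 ?sqr_ge0// invr_ge0 ltW.
have paE : p%:R * a = 80^-1 * ell th ^+ 2 by rewrite /a /gd_rate mulrC divfK// gt_eqF.
have lL := ell_sqr_loss l0.
have lL0 : 0 <= ell th ^+ 2 * L th by rewrite mulr_ge0 ?sqr_ge0 ?ltW.
have G2 : fro2 G <= 4 * p%:R * L th ^+ 2.
  by apply: (fro2_gradL_le p0 HX HY); exact: mean_sig_le_loss.
have G0 := fro2_ge0 G.
have small : 4 * p%:R * fro2 (- a *: G) <= 4^-1.
  rewrite fro2Z sqrrN; apply: (@le_trans _ _ (4 * p%:R * (a ^+ 2 * (4 * p%:R * L th ^+ 2)))).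
    by rewrite ler_wpM2l ?mulr_ge0// ler_wpM2l ?sqr_ge0.
  rewrite (_ : _ * _ = (4 * (p%:R * a) * L th) ^+ 2); last by ring.
  rewrite paE (_ : 4 * _ * _ = 20^-1 * (ell th ^+ 2 * L th)); last by field.
  have : (20^-1 * (ell th ^+ 2 * L th)) ^+ 2 <= (20^-1 * 2) ^+ 2.
    have A0 : 0 <= 20^-1 * (ell th ^+ 2 * L th) by rewrite mulr_ge0.
    by rewrite ler_pXn2r ?nnegrE//; lra.
  by move=> h1; apply: (le_trans h1); rewrite expr2; lra.
have := loss_taylor p0 HX HY th small.
rewrite dlossZ -(mxdot_gradL X Y th G) -/(fro2 G) fro2Z sqrrN scaleNr.
rewrite ler_norml => /andP[_ up].
have h2 : 9 * p%:R * L th * (a ^+ 2 * fro2 G) <= 4^-1 * (a * fro2 G).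
  rewrite (_ : _ * (a ^+ 2 * _) = 9 * (p%:R * a) * L th * (a * fro2 G)); last by ring.
  by rewrite ler_wpM2r ?mulr_ge0// paE; lra.
by lra.
Qed.

(* The squared norm grows at most like the fourth power of [ell]; this is what
   keeps the rate constant in [inv_loss_step]. *)
Lemma gd_step_invariant (l1 M : R) th :
  12 * (ln (2 * n%:R) + 1) <= l1 -> l1 <= ell th -> 0 < M ->
  fro2 th * l1 ^+ 4 <= M * ell th ^+ 4 ->
  let th' := th - gd_rate th *: gradL X Y th in
  [/\ l1 <= ell th', fro2 th' * l1 ^+ 4 <= M * ell th' ^+ 4 &
    (L th)^-1 + l1 ^+ 4 / (rate_const R * p%:R * M) <= (L th')^-1].
Proof.
move=> big l1l M0 inv th'.
have n1 : 1 <= n%:R :> R by rewrite ler1n.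
have ln0 : 0 <= ln (2 * n%:R) :> R by apply: ln_ge0; lra.
have l0 : 0 < ell th by lra.
have l10 : 0 < l1 by lra.
set G := gradL X Y th in th' *; set a := gd_rate th in th' *.
have a0 : 0 < a by rewrite divr_gt0// mulr_gt0// exprn_gt0.
have Lp := loss_gt0 X Y n0 th; have Lp' := loss_gt0 X Y n0 th'.
have ali := gradient_alignment (le_trans big l1l).
have des : L th' <= L th - 3 / 4 * (a * fro2 G) := descent (ltW l0).
set N := Num.sqrt (fro2 th); set g := Num.sqrt (fro2 G).
have N2 : N ^+ 2 = fro2 th by rewrite sqr_sqrtr// fro2_ge0.
have g2 : g ^+ 2 = fro2 G by rewrite sqr_sqrtr// fro2_ge0.
have N0 : 0 <= N by exact: sqrtr_ge0.
have g0 : 0 <= g by exact: sqrtr_ge0.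
have cs (B C : param) : `|mxdot B C| <= Num.sqrt (fro2 B) * Num.sqrt (fro2 C).
  rewrite -(@ler_pXn2r _ 2) ?nnegrE ?mulr_ge0 ?sqrtr_ge0//.
  by rewrite real_normK ?num_real// exprMn !sqr_sqrtr ?fro2_ge0// mxdot_CS.
have ali2 : 2 / 3 * (L th * ell th) <= g * N.
  apply: (le_trans ali); rewrite -mxdot_gradL.
  by apply: (le_trans _ (cs G th)); rewrite -normrN ler_norm.
have Ll0 : 0 < L th * ell th by rewrite mulr_gt0.
have gN0 : 0 < g * N by apply: lt_le_trans ali2; rewrite mulr_gt0.
have Np : 0 < N.
  by rewrite lt_neqAle N0 andbT eq_sym; apply: contraL gN0 => /eqP ->; rewrite mulr0 ltxx.
have gp : 0 < g.
  by rewrite lt_neqAle g0 andbT eq_sym; apply: contraL gN0 => /eqP ->; rewrite mul0r ltxx.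
pose x := a * g / N.
have x0 : 0 < x by rewrite divr_gt0// mulr_gt0.
have xN : N * x = a * g by rewrite /x mulrC divfK// gt_eqF.
have des2 : L th' <= L th - 3 / 4 * (a * g ^+ 2) by rewrite g2.
have grow : ell th * (1 + 2^-1 * x) <= ell th' by exact: (log_growth Lp Lp' Np a0 l0 des2 ali2).
have l_mono : ell th <= ell th'.
  by apply: le_trans grow; rewrite ler_peMr ?(ltW l0)// lerDl mulr_ge0// ltW.
have N' : fro2 th' <= (N * (1 + x)) ^+ 2.
  rewrite (_ : th' = th + (- a) *: G); last by rewrite /th' scaleNr.
  rewrite fro2D fro2Z sqrrN -N2 -g2 mulrDr mulr1 xN.
  have h1 : mxdot th (- a *: G) <= N * (a * g).
    apply: le_trans (ler_norm _) _; apply: le_trans (cs _ _) _.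
    by rewrite fro2Z sqrrN -/N sqrtrM ?sqr_ge0// sqrtr_sqr gtr0_norm.
  rewrite (_ : (N + a * g) ^+ 2 = N ^+ 2 + 2 * (N * (a * g)) + a ^+ 2 * g ^+ 2); last by ring.
  by rewrite lerD2r lerD2l ler_wpM2l.
rewrite -N2 in inv.
split; first exact: le_trans l_mono.
- exact: (norm_growth Lp Np a0 l0 ali2 l10 M0 (lt_le_trans l0 l_mono) grow N' inv).
- apply: (inv_loss_growth Lp Lp' Np a0 l0 des2 ali2 pR0 l10 M0 _ inv).
  by rewrite /a /gd_rate divfK// gt_eqF.
Qed.

Lemma gd_convergence (step : nat -> param -> R) th0 (l1 M : R) :
  (forall k th, (0 < k)%N -> step k th = gd_rate th) ->
  12 * (ln (2 * n%:R) + 1) <= l1 -> 0 < M ->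
  let th1 := gd L step th0 1 in
  l1 <= ell th1 -> fro2 th1 <= M ->
  forall t, (1 < t)%N ->
    L (gd L step th0 t) <= 2 * rate_const R * p%:R * M / (l1 ^+ 4 * t%:R).
Proof.
move=> stepE big M0 th1 l1l Mth.
have n1 : 1 <= n%:R :> R by rewrite ler1n.
have ln0 : 0 <= ln (2 * n%:R) :> R by apply: ln_ge0; lra.
have l10 : 0 < l1 by lra.
set den := rate_const R * p%:R * M.
have den0 : 0 < den by rewrite !mulr_gt0 ?rate_const_gt0.
have l14 : 0 < l1 ^+ 4 by rewrite exprn_gt0.
pose rho := l1 ^+ 4 / den.
have rho0 : 0 < rho by rewrite divr_gt0.
have inv k : [/\ l1 <= ell (gd L step th0 k.+1),
    fro2 (gd L step th0 k.+1) * l1 ^+ 4 <= M * ell (gd L step th0 k.+1) ^+ 4 &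
    k%:R * rho <= (L (gd L step th0 k.+1))^-1].
  elim: k => [|k [i1 i2 i3]].
    split; [exact: l1l| |by rewrite mul0r invr_ge0 ltW// loss_gt0].
    apply: ler_pM => //; [exact: fro2_ge0|by rewrite exprn_ge0// ltW|].
    by rewrite ler_pXn2r ?nnegrE// ltW//; exact: lt_le_trans l1l.
  have [j1 j2 j3] := gd_step_invariant big i1 M0 i2.
  have -> : gd L step th0 k.+2 = gd L step th0 k.+1 -
      gd_rate (gd L step th0 k.+1) *: gradL X Y (gd L step th0 k.+1).
    by rewrite -(gradE p0 HX HY) -(stepE k.+1).
  split; [exact: j1|exact: j2|]; apply: le_trans j3; rewrite -natr1 mulrDl mul1r.
  by rewrite lerD2r.
case=> [//|t] t1; have t0 : (0 < t)%N by [].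
have [_ _] := inv t; set Lt := L _.
have Lt0 : 0 < Lt by exact: loss_gt0.
have tR : 0 < t%:R :> R by rewrite ltr0n.
move=> h1.
have h2 : Lt <= (t%:R * rho)^-1.
  by rewrite -(invrK Lt) lef_pV2 ?posrE ?invr_gt0// mulr_gt0.
apply: (le_trans h2).
have -> : (t%:R * rho)^-1 = den / (l1 ^+ 4 * t%:R).
  by rewrite /rho; field; rewrite !gt_eqF.
(* Iterate [t.+1] is only [t] steps past [th1]; this costs the factor 2 of the conclusion. *)
have t2 : t.+1%:R <= 2 * t%:R :> R by rewrite -natrM ler_nat mul2n -addnn -addn1 leq_add2l.
rewrite (_ : 2 * _ * _ * _ = 2 * den); last by rewrite /den; ring.
rewrite ler_pdivrMr ?mulr_gt0// mulrAC ler_pdivlMr ?mulr_gt0 ?ltr0n//.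
rewrite (_ : 2 * den * _ = den * l1 ^+ 4 * (2 * t%:R)); last by ring.
by rewrite (mulrA den) ler_wpM2l// mulr_ge0// ltW.
Qed.

End Convergence.

(** * The first step *)

(** [N] stands for the number of active units, [ps] and [po] for the shares of own-cluster and
    opposite examples. The terms [N / 4] cancel, leaving [c * m / 4] from the units that separate
    opposite examples. *)
Lemma margin_arith (R : realType) (ps po N m c eps e0 e1 E : R) :
  0 <= m -> 0 <= E -> 0 <= e0 -> 0 <= e1 -> 0 <= eps -> eps <= 4^-1 ->
  4^-1 - eps <= ps -> ps <= 1 -> po <= 2^-1 + 2 * eps ->
  0 <= c -> c * m <= N -> N <= m ->
  m * (c / 4 - 2 * eps - E - e0 - e1) <=
  ps * (N - m * E) - po * ((2^-1 + e0 + e1) * (N - c * m)).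
Proof.
move=> m0 E0 e00 e10 eps0 eps1 ps1 ps2 po2 c0 Nc Nm.
have N0 : 0 <= N by apply: le_trans Nc; rewrite mulr_ge0.
have d0 : 0 <= N - c * m by rewrite subr_ge0.
have h1 : (4^-1 - eps) * N <= ps * N by rewrite ler_wpM2r.
have h2 : ps * (m * E) <= 1 * (m * E) by rewrite ler_wpM2r// mulr_ge0.
have k0 : 0 <= (2^-1 + e0 + e1) * (N - c * m) by rewrite mulr_ge0// !addr_ge0.
have h3 := ler_wpM2r k0 po2.
have h4 : (2^-1 + 2 * eps) * ((2^-1 + e0 + e1) * (N - c * m)) <=
    (4^-1 + eps + e0 + e1) * (N - c * m).
  rewrite mulrA ler_wpM2r//.
  have : 2 * eps * (e0 + e1) <= 2^-1 * (e0 + e1).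
    by rewrite ler_wpM2r ?addr_ge0//; lra.
  by lra.
have h5 : (2 * eps + e0 + e1) * N <= (2 * eps + e0 + e1) * m.
  by rewrite ler_wpM2l// !addr_ge0// mulr_ge0.
have h6 : 0 <= (eps + e0 + e1) * (c * m) by rewrite mulr_ge0 ?mulr_ge0 ?addr_ge0.
by lra.
Qed.

Section FirstStep.
Variables (R : realType) (p d n : nat) (X : 'I_n -> 'rV[R]_d) (Y : 'I_n -> R).
Local Notation param := 'M[R]_(p.*2, d.+1).
Hypothesis p0 : (0 < p)%N.
Hypothesis n0 : (0 < n)%N.
Hypothesis HX : forall s, inner (augment (X s)) (augment (X s)) = 2.
Hypothesis HY : forall s, Y s = 1 \/ Y s = -1.
Local Notation h := (p%:R^-1 : R).
Local Notation L := (loss (p := p) h X Y).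
Local Notation kap s s' := (inner (augment (X s)) (augment (X s'))).
Local Notation phi := (huber_relu h).
Local Notation dphi := (huber_deriv h).

Let pR0 : 0 < p%:R :> R. Proof. by rewrite ltr0n. Qed.
Let nR0 : 0 < n%:R :> R. Proof. by rewrite ltr0n. Qed.
Let h0 : 0 < h. Proof. by rewrite invr_gt0. Qed.

Lemma inner_CS_bounds s s' : -2 <= kap s s' <= 2.
Proof.
have := sum_CauchySchwarz (augment (X s)) (augment (X s')).
have sq t : \sum_j augment (X t) j ^+ 2 = 2 by rewrite -(HX t); apply: eq_bigr.
rewrite !sq -/(kap s s') -ler_norml => cs.
rewrite -(@ler_pXn2r _ 2) ?nnegrE// real_normK ?num_real//.
Qed.

(** The bias adds 1 to an inner product of unit vectors. Hence examples with the same label never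
    lower each other's gain. *)
Lemma inner_augment_ge0 s s' : 0 <= kap s s'.
Proof.
have dd t : dotv (X t) (X t) = 1.
  by have := HX t; rewrite inner_augment => hh; apply: (addIr 1); rewrite hh; ring.
have := sum_CauchySchwarz (fun j => X s 0 j) (fun j => X s' 0 j).
have sq t : \sum_j X t 0 j ^+ 2 = 1 by rewrite -(dd t); apply: eq_bigr.
rewrite !sq -/(dotv (X s) (X s')) inner_augment mulr1 => cs.
have : `|dotv (X s) (X s')| <= 1.
  by rewrite -(@ler_pXn2r _ 2) ?nnegrE// real_normK ?num_real// expr1n.
by rewrite ler_norml => /andP[]; lra.
Qed.

Variables (th : param) (alpha : R).
Hypothesis alpha0 : 0 < alpha.
Local Notation z i s := (preact th (X s) i).
Local Notation margin s := (Y s * net h th (X s)).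
Local Notation th1 := (th - alpha *: gradL X Y th).

(** Displacement of a preactivation per unit of step size, without the output weight: that weight
    occurs once in the gradient and once in the output, so its sign cancels. *)
Definition kick i s : R :=
  n%:R^-1 * \sum_s' sig (margin s') * (Y s' * (dphi (z i s') * kap s s')).

Lemma preact_gradL i s : preact (gradL X Y th) (X s) i = - (outw R i * kick i s).
Proof.
have dnet_unit s' j : dnet th (X s') (delta_mx i j) =
    outw R i * (dphi (z i s') * augment (X s') j).
  rewrite /dnet (bigD1 i)//= [X in _ + X]big1 ?addr0.
    congr (_ * (_ * _)); rewrite /preact /lin (bigD1 j)//= big1 ?addr0.
      by rewrite mxE !eqxx mulr1.
    by move=> k /negbTE kj; rewrite mxE kj andbF mulr0.
  move=> k /negbTE ki; rewrite /preact /lin [X in _ * (_ * X)]big1 ?mulr0// => l _.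
  by rewrite mxE ki mulr0.
rewrite /preact /lin /kick.
transitivity (\sum_j \sum_s' augment (X s) j * (n%:R^-1 *
    - (sig (margin s') * (Y s' * (outw R i * (dphi (z i s') * augment (X s') j)))))).
  apply: eq_bigr => j _; rewrite mxE /dloss !mulr_sumr.
  by apply: eq_bigr => s' _; rewrite dnet_unit.
rewrite exchange_big mulrCA -mulrN mulr_sumr -sumrN mulr_sumr; apply: eq_bigr => s' _.
rewrite /inner !mulr_sumr -sumrN mulr_sumr; apply: eq_bigr => j _ /=; ring.
Qed.

Lemma preact_step i s : preact th1 (X s) i = z i s + alpha * (outw R i * kick i s).
Proof.
by rewrite -scaleNr preactD preactZ preact_gradL mulrNN.
Qed.

Lemma norm_kick i s : `|kick i s| <= 2.
Proof.
rewrite /kick normrM ger0_norm ?invr_ge0//.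
apply: (@le_trans _ _ (n%:R^-1 * \sum_(s' < n) 2)); last by rewrite mean_cst.
rewrite ler_wpM2l ?invr_ge0//; apply: le_trans (ler_norm_sum _ _ _) _.
apply: ler_sum => s' _; rewrite !normrM (norm_label HY) mul1r.
have /andP[d0 d1] := huber_deriv_bounds h0 (z i s').
have k2 : `|kap s s'| <= 2 by rewrite ler_norml inner_CS_bounds.
rewrite (ger0_norm d0) (gtr0_norm (sig_gt0 _)).
rewrite -[leRHS]mul1r; apply: ler_pM => //; first by rewrite ltW ?sig_gt0.
- by rewrite mulr_ge0.
- exact: sig_le1.
- by rewrite -[leRHS]mul1r; apply: ler_pM.
Qed.

(** Preactivations move by at most [2 * alpha]. If [|z| > eta], the unit stays on its linear or zero
    piece and the gain is exact; otherwise the change and the claimed gain are each at most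
    [2 * alpha], hence [4 * alpha]. *)
Lemma neuron_gain (eta : R) i s : h + 2 * alpha <= eta ->
  alpha * ((0 < z i s)%R%:R * (Y s * kick i s)) - 4 * alpha * (`|z i s| <= eta)%R%:R <=
  Y s * (outw R i * (phi (preact th1 (X s) i) - phi (z i s))).
Proof.
move=> he; rewrite preact_step.
have k2 := norm_kick i s; move: (kick i s) k2 => c k2.
have nw := norm_outw R i; have ww := outw_sqr R i; move: (outw R i) nw ww => w nw ww.
set y := z i s.
have c2 : `|alpha * (w * c)| <= 2 * alpha.
  rewrite !normrM nw mul1r (gtr0_norm alpha0) mulrC.
  by rewrite ler_wpM2r ?(ltW alpha0).
have hp := h0.
case: (leP `|y| eta) => [yb|yb].
  have n1 : `|Y s * (w * (phi (y + alpha * (w * c)) - phi y))| <= 2 * alpha.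
    rewrite !normrM (norm_label HY) nw !mul1r.
    apply: le_trans (huber_Lipschitz h0 _ _) _.
    by rewrite addrC addKr.
  have n2 : (0 < y)%R%:R * (alpha * (Y s * c)) <= 2 * alpha.
    apply: (@le_trans _ _ (alpha * `|c|)).
      apply: le_trans (ler_norm _) _; rewrite !normrM (norm_label HY) mul1r (gtr0_norm alpha0).
      by rewrite ler_piMl ?mulr_ge0 ?(ltW alpha0)//; case: (0 < y); rewrite ?normr1 ?normr0.
    by rewrite mulrC ler_wpM2r ?(ltW alpha0).
  move: n1; rewrite ler_norml => /andP[n1 _].
  by rewrite /= mulr1 mulrCA; lra.
rewrite /= mulr0 subr0.
move: c2; rewrite ler_norml => /andP[c2 c3].
have [y0|y0] := ltP 0 y.
  rewrite gtr0_norm// in yb.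
  rewrite !(huber_linear h0); last 2 first.
  - by lra.
  - by lra.
  rewrite /= mul1r [leRHS](_ : _ = alpha * (w * w * (Y s * c))); last by ring.
  by rewrite ww mul1r.
rewrite ler0_norm// in yb.
rewrite !huber_neg; last 2 first.
- by lra.
- by lra.
by rewrite /= mul0r subrr !mulr0.
Qed.

(** * Contributions of own-cluster, opposite and remaining examples *)

Variables (same opp : rel 'I_n) (e0 e1 eps b c eta : R).
Hypotheses (e0_ge0 : 0 <= e0) (e0_le : e0 <= 2^-1) (e1_ge0 : 0 <= e1) (e1_le : e1 <= 2).
Hypotheses (eps_ge0 : 0 <= eps) (eps_le : eps <= 4^-1) (b_ge0 : 0 <= b) (c_ge0 : 0 <= c).
Hypothesis eta_ge : h + 2 * alpha <= eta.
Hypothesis sameP : forall s s', same s s' -> Y s' = Y s /\ 2 - e1 <= kap s s'.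
Hypothesis oppP : forall s s', opp s s' -> Y s' = - Y s /\ kap s s' <= 1 + e1.
Hypothesis restP : forall s s', ~~ same s s' -> ~~ opp s s' -> Y s' = Y s.
Hypothesis opp_exists : forall s, exists s', opp s s'.
Hypothesis same_count : forall s, (4^-1 - eps) * n%:R <= \sum_s' (same s s')%:R.
Hypothesis opp_count : forall s, \sum_s' (opp s s')%:R <= (2^-1 + 2 * eps) * n%:R.
Local Notation m := ((p.*2)%:R : R).
Hypothesis small_output : forall s, `|net h th (X s)| <= e0.
Hypothesis few_near_zero : forall s, \sum_i (`|z i s| <= eta)%R%:R <= b * m.
Hypothesis few_split : forall s s', same s s' ->
  \sum_i (eta < z i s - z i s')%R%:R <= b * m.
Hypothesis many_gap : forall s s', opp s s' ->
  c * m <= \sum_i ((0 < z i s) && (z i s' < 0))%R%:R.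

Definition influence i s s' : R :=
  (0 < z i s)%R%:R * (sig (margin s') * (Y s * Y s' * (dphi (z i s') * kap s s'))).

Definition active s : R := \sum_i (0 < z i s)%R%:R.

Let m0 : 0 <= m. Proof. by []. Qed.

Lemma sig_margin_bounds s : 2^-1 - e0 <= sig (margin s) <= 2^-1 + e0.
Proof.
apply: sig_near_half => //; first by rewrite normrM (norm_label HY) mul1r.
Qed.

(** Ideally an active unit contributes [2^-1 * 2 = 1]. Weight and kernel lose at most [2 * e0 + e1].
    All is lost only if [z i s'] is near the kink or below [- eta], and the latter puts more than
    [eta] between [s] and [s']. *)
Lemma influence_same s s' : same s s' ->
  active s - m * (2 * e0 + e1 + 2 * b) <= \sum_i influence i s s'.
Proof.
move=> ss; have [yy kk] := sameP ss.
apply: (@le_trans _ _ (\sum_i ((0 < z i s)%R%:R - (2 * e0 + e1) - (`|z i s'| <= eta)%R%:R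
    - (eta < z i s - z i s')%R%:R))).
  rewrite !sumrB -/(active s) sumr_const card_ord -(mulr_natl (2 * e0 + e1)).
  have := few_near_zero s'; have := few_split ss; lra.
apply: ler_sum => i _; rewrite /influence -yy (labelK HY) mul1r.
have /andP[s1 s2] := sig_margin_bounds s'.
have /andP[d0 d1] := huber_deriv_bounds h0 (z i s').
have g0 := sig_gt0 (margin s'); have k0 := inner_augment_ge0 s s'.
have v0 : 0 <= sig (margin s') * (dphi (z i s') * kap s s').
  by rewrite !mulr_ge0// ltW.
have e00 := e0_ge0; have e10 := e1_ge0; have e01 := e0_le; have e11 := e1_le.
set u1 : R := (`|z i s'| <= eta)%R%:R; set u2 : R := (eta < z i s - z i s')%R%:R.
have u10 : 0 <= u1 by []; have u20 : 0 <= u2 by [].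
have [zp|zn] := ltP 0 (z i s); rewrite /= ?mul1r ?mul0r; last first.
  by clearbody u1 u2; lra.
have [zh|zh] := ltP h (z i s').
  have -> : dphi (z i s') = 1.
    by rewrite /huber_deriv ltNge (ltW (lt_trans h0 zh))/= leNgt zh.
  rewrite mul1r.
  have t1 : (2^-1 - e0) * (2 - e1) <= sig (margin s') * kap s s'.
    by apply: ler_pM => //; lra.
  have t2 : 0 <= e0 * e1 by rewrite mulr_ge0.
  by clearbody u1 u2; lra.
have [za|za] := leP `|z i s'| eta.
  have u11 : u1 = 1 by rewrite /u1 za.
  by clearbody u1 u2; lra.
have u21 : u2 = 1.
  rewrite /u2; have -> // : eta < z i s - z i s'.
  have zneg : z i s' < 0.
    rewrite ltNge; apply/negP => z'0; rewrite ger0_norm// in za.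
    by have := alpha0; have := eta_ge; lra.
  by rewrite ltr0_norm// in za; lra.
by clearbody u1 u2; lra.
Qed.

(** An active unit costs at most [(2^-1 + e0) * (1 + e1)], and nothing when it is inactive on [s'],
    where [huber_deriv] vanishes. *)
Lemma influence_opp s s' : opp s s' ->
  - ((2^-1 + e0 + e1) * (active s - c * m)) <= \sum_i influence i s s'.
Proof.
move=> ss; have [yy kk] := oppP ss.
apply: (@le_trans _ _ (\sum_i - ((2^-1 + e0 + e1) *
    ((0 < z i s)%R%:R - ((0 < z i s) && (z i s' < 0))%R%:R)))).
  rewrite sumrN -mulr_sumr sumrB -/(active s) lerN2 ler_wpM2l ?addr_ge0//.
  by rewrite lerD2l lerN2 many_gap.
have {}yy : Y s = - Y s' by rewrite yy opprK.
apply: ler_sum => i _; rewrite /influence yy mulNr (labelK HY) mulN1r mulrN mulrN lerN2.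
have /andP[s1 s2] := sig_margin_bounds s'.
have /andP[d0 d1] := huber_deriv_bounds h0 (z i s').
have g0 := sig_gt0 (margin s'); have k0 := inner_augment_ge0 s s'.
have [zp|zn] := ltP 0 (z i s); rewrite /= ?mul1r ?mul0r ?subrr ?mulr0//.
have [zh|zh] := ltP (z i s') 0.
  by rewrite /huber_deriv zh subrr mulr0 mul0r mulr0.
rewrite subr0 mulr1.
apply: (@le_trans _ _ ((2^-1 + e0) * (1 + e1))).
  apply: ler_pM => //; [exact: ltW|by rewrite mulr_ge0|].
  by apply: le_trans kk; rewrite ler_piMl.
have : e0 * e1 <= 2^-1 * e1 by rewrite ler_wpM2r.
by lra.
Qed.

Lemma influence_rest s s' : ~~ same s s' -> ~~ opp s s' -> 0 <= \sum_i influence i s s'.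
Proof.
move=> h1 h2; apply: sumr_ge0 => i _; rewrite /influence -(restP h1 h2) (labelK HY) mul1r.
have /andP[d0 d1] := huber_deriv_bounds h0 (z i s').
have g0 := sig_gt0 (margin s'); have k0 := inner_augment_ge0 s s'.
by rewrite mulr_ge0// !mulr_ge0// ltW.
Qed.

(** [E + e0 + e1] in [margin_arith] amounts to [3 * e0 + 2 * e1 + 2 * b], and the units near the
    kink in [neuron_gain] bring [4 * b] more. *)
Lemma first_step_margin s :
  alpha * m * (c / 4 - 2 * eps - 3 * e0 - 2 * e1 - 6 * b) - e0 <=
  Y s * net h th1 (X s).
Proof.
have N_le : active s <= m.
  rewrite /active (@le_trans _ _ (\sum_(i < p.*2) 1))//.
    by apply: ler_sum => i _; case: (0 < _).
  by rewrite sumr_const card_ord.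
have N_ge : c * m <= active s.
  have [s' ss'] := opp_exists s; apply: le_trans (many_gap ss') _.
  by apply: ler_sum => i _; case: (0 < _) => //=; case: (_ < 0).
set E := 2 * e0 + e1 + 2 * b.
pose ps := n%:R^-1 * \sum_s' (same s s')%:R : R.
pose po := n%:R^-1 * \sum_s' (opp s s')%:R : R.
have E0 : 0 <= E by rewrite !addr_ge0// mulr_ge0.
have ps1 : 4^-1 - eps <= ps by rewrite /ps mulrC ler_pdivlMr.
have ps2 : ps <= 1.
  rewrite -[leRHS](mean_cst 1 n0); apply: mean_le => s'.
  by case: (same s s').
have po2 : po <= 2^-1 + 2 * eps by rewrite /po mulrC ler_pdivrMr.
have gain : m * (c / 4 - 2 * eps - E - e0 - e1) <= \sum_i (0 < z i s)%R%:R * (Y s * kick i s).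
  apply: (le_trans (margin_arith m0 E0 e0_ge0 e1_ge0 eps_ge0 eps_le ps1 ps2 po2 c_ge0 N_ge N_le)).
  set Bb := (2^-1 + e0 + e1) * _.
  have -> : \sum_i (0 < z i s)%R%:R * (Y s * kick i s) =
      n%:R^-1 * \sum_s' \sum_i influence i s s'.
    rewrite exchange_big mulr_sumr; apply: eq_bigr => i _.
    rewrite /kick /influence -mulr_sumr (mulrCA (Y s) n%:R^-1) (mulrCA _ n%:R^-1).
    congr (_ * (_ * _)).
    by rewrite mulr_sumr; apply: eq_bigr => s' _; ring.
  rewrite /ps /po -!mulrA -mulrBr ler_wpM2l ?invr_ge0//.
  rewrite !mulr_suml -sumrB; apply: ler_sum => s' _.
  have [ss|ns] := boolP (same s s').
    have -> : opp s s' = false.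
      apply/negP => oo; have [y1 _] := sameP ss; have [y2 _] := oppP oo.
      rewrite y1 in y2; have Y0 : Y s = 0 by lra.
      by have /eqP := labelK HY s; rewrite Y0 mul0r eq_sym oner_eq0.
    by rewrite mul0r subr0 mul1r; exact: influence_same.
  have [oo|no] := boolP (opp s s').
    by rewrite mul0r sub0r mul1r; exact: influence_opp.
  by rewrite !mul0r subr0; exact: influence_rest.
have step : alpha * (\sum_i (0 < z i s)%R%:R * (Y s * kick i s)) - 4 * alpha * (b * m) <=
    Y s * net h th1 (X s) - Y s * net h th (X s).
  rewrite -mulrBr !netE -sumrB [leRHS]mulr_sumr.
  apply: (@le_trans _ _ (\sum_i (alpha * ((0 < z i s)%R%:R * (Y s * kick i s)) -
      4 * alpha * (`|z i s| <= eta)%R%:R))).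
    rewrite sumrB -!mulr_sumr lerD2l lerN2 ler_wpM2l ?few_near_zero//.
    by rewrite mulr_ge0// ltW.
  by apply: ler_sum => i _; rewrite -mulrBr; exact: neuron_gain.
have f0 : - e0 <= Y s * net h th (X s).
  rewrite lerNl; apply: le_trans (ler_norm _) _.
  by rewrite normrN normrM (norm_label HY) mul1r.
have ag := ler_wpM2l (ltW alpha0) gain.
move: ag step f0; rewrite /E.
move: (\sum_i _) (Y s * net h th1 (X s)) (Y s * net h th (X s)) => u v w.
by lra.
Qed.

End FirstStep.

(** * High-probability events at initialization *)

Section HighProbability.
Variables (R : realType) (sigma : R) (p d : nat).
Hypothesis sigma0 : 0 < sigma.
Local Notation J := 'I_d.+1.
Local Notation param := 'M[R]_(p.*2, d.+1).
Local Notation index := ('I_(p.*2) * J)%type.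
Local Notation mx g := (\matrix_(i, j) g (i, j) : param).
Local Notation E := (expect sigma (d := d)).
Implicit Types (S : param -> Prop).

(* [S] fails only where a certain nonnegative function, of mean at most [dl],
   is at least 1. *)
Definition whp S (dl : R) : Prop := exists W : (index -> R) -> R,
  [/\ forall g, 0 <= W g, rcoord_measurable W, forall g, W g < 1 -> S (mx g) &
    (gauss_int sigma (enum {: index}) (fun g => (W g)%:E) (fun=> 0%R) <= dl%:E)%E].

Lemma whp_prob S dl : whp S dl -> ((1 - dl)%:E <= gauss_mx_prob sigma [set th | S th])%E.
Proof.
move=> [W [W0 mW WS Wd]]; apply: (gauss_int_markov W0 mW _ Wd) => g /WS.
exact.
Qed.

Lemma whp_sub S S' dl dl' : (forall th, S th -> S' th) -> dl <= dl' ->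
  whp S dl -> whp S' dl'.
Proof.
move=> SS' dd [W [W0 mW WS Wd]]; exists W; split => //.
- by move=> g /WS; exact: SS'.
- by apply: le_trans Wd _; rewrite lee_fin.
Qed.

Lemma whp_and S1 S2 d1 d2 : whp S1 d1 -> whp S2 d2 ->
  whp (fun th => S1 th /\ S2 th) (d1 + d2).
Proof.
move=> [W1 [W10 mW1 WS1 Wd1]] [W2 [W20 mW2 WS2 Wd2]].
exists (fun g => W1 g + W2 g); split.
- by move=> g; rewrite addr_ge0.
- exact: rcoord_measurableD.
- move=> g h; split; [apply: WS1|apply: WS2]; apply: le_lt_trans h.
    by rewrite lerDl.
  by rewrite lerDr.
- rewrite (eq_gauss_int sigma _ (G := fun g => ((W1 g)%:E + (W2 g)%:E)%E)).
    rewrite gauss_intD; [by rewrite EFinD leeD|by move=> g; rewrite lee_fin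
      |exact: coord_measurable_EFin|by move=> g; rewrite lee_fin|exact: coord_measurable_EFin].
  by move=> g; rewrite EFinD.
Qed.

Lemma whp_true : whp (fun=> True) 0.
Proof.
by exists (fun=> 0); split; [by []|exact: rcoord_measurable_cst|by []|rewrite gauss_int_cst].
Qed.

Lemma whp_forall (K : finType) (S : K -> param -> Prop) (dl : R) : 0 <= dl ->
  (forall k, whp (S k) dl) -> whp (fun th => forall k, S k th) (#|K|%:R * dl).
Proof.
move=> dl0 H.
have : whp (fun th => forall k, k \in enum K -> S k th) (\sum_(k <- enum K) dl).
  elim: (enum K) => [|k r ih].
    by rewrite big_nil; apply: whp_sub whp_true.
  rewrite big_cons; apply: whp_sub (whp_and (H k) ih) => // th [h1 h2] l.
  by rewrite in_cons => /orP[/eqP ->//|/h2].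
rewrite big_const_seq count_predT -cardE iter_addr addr0 mulr_natl.
by apply: whp_sub => // th h k; apply: h; rewrite mem_enum.
Qed.

Lemma whp_implies (b : bool) S dl : 0 <= dl -> (b -> whp S dl) ->
  whp (fun th => b -> S th) dl.
Proof.
move=> dl0; case: b => [/(_ isT)|_]; first by apply: whp_sub => // th h _.
by apply: (whp_sub _ dl0 whp_true).
Qed.

Lemma enum_index : enum {: index} = [seq (i, j) | i <- enum 'I_(p.*2), j <- enum J].
Proof. by rewrite enumT unlock. Qed.

(** Chernoff's method: [A] carries the threshold, and [w] depends on the unit because output weights
    have two signs. *)
Lemma whp_product S (A : R) (w : 'I_(p.*2) -> (J -> R) -> R) (c : 'I_(p.*2) -> R) :
  0 <= A -> (forall i g, 0 <= w i g) -> (forall i, rcoord_measurable (w i)) ->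
  (forall i, (E (w i) <= (c i)%:E)%E) ->
  (forall th : param, A * \prod_i w i (fun j => th i j) < 1 -> S th) ->
  whp S (A * \prod_i c i).
Proof.
move=> A0 w0 mw wc AS; exists (fun g => A * \prod_i w i (fun j => g (i, j))); split.
- by move=> g; rewrite mulr_ge0// prodr_ge0.
- apply: rcoord_measurableM; first exact: rcoord_measurable_cst.
  by apply: rcoord_measurable_prod => i; exact: rcoord_measurable_row.
- move=> g h; apply: AS; congr (_ < _): h; congr (_ * _); apply: eq_bigr => i _.
  by congr (w i _); apply/funext => j; rewrite mxE.
rewrite (eq_gauss_int sigma _ (G := fun g => (A%:E *
    (\prod_i w i (fun j => g (i, j)))%:E)%E)); last first.
  by move=> g; rewrite EFinM.
rewrite (@gauss_intM _ _ _ _ (fun=> A%:E)); [|by move=> g; rewrite lee_fin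
  |by move=> g; rewrite lee_fin prodr_ge0|apply: coord_measurable_EFin|by []]; last first.
  by apply: rcoord_measurable_prod => i; exact: rcoord_measurable_row.
rewrite EFinM lee_wpmul2l ?lee_fin// enum_index.
have := gauss_int_prod_rows (fun=> 0) (enum_uniq 'I_(p.*2)) w0 mw wc.
by rewrite !big_enum /=; under eq_gauss_int do rewrite big_enum /=.
Qed.

Lemma prod_expR_cst (q : R) : \prod_(i < p.*2) expR q = expR ((p.*2)%:R * q).
Proof. by rewrite prodr_const card_ord -expRM_natl. Qed.

Lemma whp_count_le (A : (J -> R) -> bool) (q t : R) : bcoord_measurable A ->
  (E (fun g => (A g)%:R) <= q%:E)%E ->
  whp (fun th => \sum_i (A (fun j => th i j))%:R <= t) (expR ((p.*2)%:R * q - t / 2)).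
Proof.
move=> mA Aq.
have := @whp_product (fun th : param => \sum_i (A (fun j => th i j))%:R <= t) (expR (- (t / 2)))
  (fun i g => expR (2^-1 * (A g)%:R)) (fun=> expR q).
rewrite prod_expR_cst -expRD addrC; apply.
- exact: expR_ge0.
- by move=> i g; exact: expR_ge0.
- move=> i; apply: rcoord_measurable_expR; apply: rcoord_measurableM.
    exact: rcoord_measurable_cst.
  exact: rcoord_measurable_indic.
- by move=> i; exact: expect_exp_indic.
- move=> th; rewrite -expR_sum -mulr_sumr -expRD -[ltRHS]expR0 ltr_expR.
  by move=> h; apply: ltW; lra.
Qed.

Lemma whp_count_ge (A : (J -> R) -> bool) (c t : R) : bcoord_measurable A ->
  (c%:E <= E (fun g => (A g)%:R))%E ->
  whp (fun th => t <= \sum_i (A (fun j => th i j))%:R) (expR (t - (p.*2)%:R * (c / 2))).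
Proof.
move=> mA Ac.
have := @whp_product (fun th : param => t <= \sum_i (A (fun j => th i j))%:R) (expR t)
  (fun i g => expR (- (A g)%:R)) (fun=> expR (- (c / 2))).
rewrite prod_expR_cst -expRD mulrN; apply.
- exact: expR_ge0.
- by move=> i g; exact: expR_ge0.
- move=> i; apply: (rcoord_measurable_comp (h := fun x => expR (- x))).
    by apply: measurableT_comp; [exact: measurable_expR|exact: oppr_measurable].
  exact: rcoord_measurable_indic.
- by move=> i; exact: expect_exp_indicN.
- move=> th; rewrite -expR_sum sumrN -expRD -[ltRHS]expR0 ltr_expR.
  by move=> h; apply: ltW; lra.
Qed.

(** The [2 * k] entries contribute [Num.sqrt 2] each, so [2 ^+ k] in all, against [expR (- (2 * k))]
    from the threshold. *)
Lemma whp_fro2 : whp (fun th => fro2 th <= 8 * sigma ^+ 2 * (p * d.+1)%:R)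
  (expR (- (p * d.+1)%:R)).
Proof.
set k := (p * d.+1)%N.
have h2 : 2 <= expR (1 : R) by apply: le_trans (expR_ge1Dx _); lra.
have s4 : 0 < 4 * sigma ^+ 2 by rewrite mulr_gt0// exprn_gt0.
have main := @whp_product (fun th : param => fro2 th <= 8 * sigma ^+ 2 * k%:R)
  (expR (- (2 * k%:R)))
  (fun i g => expR (\sum_j g j ^+ 2 / (4 * sigma ^+ 2))) (fun=> Num.sqrt 2 ^+ d.+1).
apply: whp_sub (main _ _ _ _ _); first by [].
- rewrite prodr_const card_ord -exprM (_ : (d.+1 * p.*2 = 2 * k)%N); last first.
    by rewrite /k -mul2n mulnCA (mulnC d.+1).
  have -> : expR (- (2 * k%:R)) = expR (- k%:R) * expR (- k%:R) :> R.
    by rewrite -expRD; congr expR; ring.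
  have : 2 ^+ k <= expR (k%:R : R).
    by rewrite -[k%:R]mulr1 expRM_natl lerXn2r// nnegrE ?expR_ge0.
  have e2 : expR (- k%:R) * expR k%:R = 1 :> R by rewrite -expRD addNr expR0.
  move=> /(ler_wpM2l (expR_ge0 (- k%:R))); rewrite e2 => h3.
  by rewrite exprM sqr_sqrtr// -mulrA ler_piMr ?expR_ge0.
- exact: expR_ge0.
- by move=> i g; exact: expR_ge0.
- move=> i; apply: rcoord_measurable_expR; apply: rcoord_measurable_sum => j.
  apply: rcoord_measurableM; last exact: rcoord_measurable_cst.
  by apply: (rcoord_measurable_comp (h := fun x => x ^+ 2));
    [apply: measurable_funX; exact: measurable_id|exact: rcoord_measurable_coord].
- by move=> i; rewrite expect_expsqr.
- move=> th; rewrite -expR_sum -expRD -[ltRHS]expR0 ltr_expR.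
  have -> : \sum_i \sum_j th i j ^+ 2 / (4 * sigma ^+ 2) = fro2 th / (4 * sigma ^+ 2).
    rewrite /fro2 /mxdot mulr_suml; apply: eq_bigr => i _; rewrite mulr_suml.
    by apply: eq_bigr => j _; rewrite expr2.
  rewrite addrC subr_lt0 ltr_pdivrMr// => h; clear main; apply: ltW; lra.
Qed.

Lemma sum_outw : \sum_(i < p.*2) outw R i = 0.
Proof.
rewrite /outw -(big_mkord xpredT (fun i => if (i < p)%N then 1 else -1 : R)).
rewrite (@big_cat_nat _ _ _ p)//=; last by rewrite -addnn leq_addr.
rewrite (eq_big_nat _ _ (F2 := fun=> 1)); last by move=> i /andP[_ ->].
rewrite [X in _ + X](eq_big_nat _ _ (F2 := fun=> -1)); last first.
  by move=> i /andP[h _]; rewrite ltnNge h.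
by rewrite !sumr_const_nat subn0 -addnn addnK mulNrn subrr.
Qed.

Hypothesis p0 : (0 < p)%N.

(** [l] is a free Chernoff parameter. The means cancel in the exponent by [sum_outw], so only
    second-order terms add up; the leading 2 accounts for both signs. *)
Lemma whp_net_small (x : 'rV[R]_d) (l e0 : R) : inner (augment x) (augment x) = 2 ->
  0 < l -> l * sigma <= 1 ->
  whp (fun th => `|net (p%:R^-1) th x| <= e0)
    (2 * expR ((p.*2)%:R * (4 * expR 4 * (l * sigma) ^+ 2) - l * e0)).
Proof.
move=> x2 l0 ls; set h := p%:R^-1; set q := 4 * expR 4 * _.
have h0 : 0 < h by rewrite invr_gt0 ltr0n.
have [m [up low]] := expect_exp_Lipschitz sigma0 (measurable_huber h)
  (huber_le_norm h0) (ltW l0) ls x2.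
have mw k : rcoord_measurable (fun g => expR (k * huber_relu h (lin (augment x) g))).
  apply: rcoord_measurable_expR; apply: rcoord_measurableM.
    exact: rcoord_measurable_cst.
  by apply: rcoord_measurable_comp; [exact: measurable_huber|exact: rcoord_measurable_lin].
have one_sided (s : R) : s = 1 \/ s = -1 -> whp (fun th => s * net h th x <= e0)
    (expR ((p.*2)%:R * q - l * e0)).
  move=> s1.
  have main := @whp_product (fun th : param => s * net h th x <= e0) (expR (- (l * e0)))
    (fun i g => expR (s * outw R i * l * huber_relu h (lin (augment x) g)))
    (fun i => expR (s * outw R i * l * m + q)).
  apply: whp_sub (main _ _ _ _ _); first by [].
  - rewrite -expR_sum big_split /= -mulr_suml -mulr_suml -mulr_sumr sum_outw mulr0 !mul0r add0r.
    by rewrite sumr_const card_ord -(mulr_natl q) -expRD addrC.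
  - exact: expR_ge0.
  - by move=> i g; exact: expR_ge0.
  - by move=> i; exact: mw.
  - move=> i; have [->|->] : s * outw R i = 1 \/ s * outw R i = -1.
      rewrite /outw; case: ifP => _; case: s1 => ->; [left|right|right|left]; ring.
    + rewrite !mul1r; exact: up.
    + rewrite !mulN1r mulNr.
      have -> : (fun g => expR (- l * huber_relu h (lin (augment x) g))) =
          (fun g => expR (- (l * huber_relu h (lin (augment x) g)))).
        by apply/funext => g; rewrite mulNr.
      exact: low.
  - move=> th; rewrite -expR_sum -expRD -[ltRHS]expR0 ltr_expR netE.
    have -> : \sum_i s * outw R i * l * huber_relu h (lin (augment x) (fun j => th i j)) =
       l * (s * \sum_i outw R i * huber_relu h (preact th x i)).
      by rewrite !mulr_sumr; apply: eq_bigr => i _; rewrite /preact; ring.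
    rewrite addrC subr_lt0 ltr_pM2l//; exact: ltW.
rewrite mulr_natl mulr2n.
apply: whp_sub (whp_and (one_sided 1 (or_introl erefl)) (one_sided (-1) (or_intror erefl))) => //.
move=> th [h1 h2]; rewrite ler_norml; lra.
Qed.

End HighProbability.

(** * Clustered data *)

Section Geometry.
Variables (R : realType) (d : nat).
Implicit Types (x y mu nu : 'rV[R]_d).

Lemma dotv_ge0 x : 0 <= dotv x x.
Proof. by apply: sumr_ge0 => j _; rewrite -expr2 sqr_ge0. Qed.

Lemma enorm_sqr x : enorm x ^+ 2 = dotv x x.
Proof. by rewrite sqr_sqrtr// dotv_ge0. Qed.

Lemma dotv_le_norms x y : `|dotv x y| <= enorm x * enorm y.
Proof.
rewrite -(@ler_pXn2r _ 2) ?nnegrE ?mulr_ge0 ?sqrtr_ge0//.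
rewrite real_normK ?num_real// exprMn !enorm_sqr.
apply: le_trans (sum_CauchySchwarz _ _) _.
by rewrite le_eqVlt; apply/orP; left; apply/eqP; congr (_ * _); apply: eq_bigr.
Qed.

Lemma dotv_same_cluster x y mu (r : R) : dotv x x = 1 -> dotv y y = 1 ->
  enorm (x - mu) <= r -> enorm (y - mu) <= r ->
  dotv (x - y) (x - y) <= 4 * r ^+ 2 /\ 1 - 2 * r ^+ 2 <= dotv x y.
Proof.
move=> x1 y1 xr yr.
have xy : dotv (x - y) (x - y) = 2 - 2 * dotv x y.
  transitivity (dotv x x + dotv y y - 2 * dotv x y); last by rewrite x1 y1; ring.
  rewrite /dotv mulr_sumr -big_split -sumrB; apply: eq_bigr => j _.
  by rewrite !mxE /=; ring.
have h : dotv (x - y) (x - y) <= 2 * dotv (x - mu) (x - mu) + 2 * dotv (y - mu) (y - mu).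
  rewrite /dotv !mulr_sumr -big_split; apply: ler_sum => j _; rewrite !mxE /=.
  rewrite -subr_ge0 (_ : _ - _ = (x 0 j + y 0 j - 2 * mu 0 j) ^+ 2); last by ring.
  exact: sqr_ge0.
have sq (z : 'rV[R]_d) : enorm z <= r -> dotv z z <= r ^+ 2.
  move=> zr; rewrite -enorm_sqr ler_pXn2r ?nnegrE ?sqrtr_ge0//.
  by apply: le_trans zr; exact: sqrtr_ge0.
have := sq _ xr; have := sq _ yr; lra.
Qed.

Lemma dotv_opposite_cluster x y mu nu (r Delta : R) : 0 <= r ->
  enorm mu = 1 -> enorm nu = 1 -> enorm (x - mu) <= r -> enorm (y - nu) <= r ->
  dotv mu nu <= Delta -> dotv x y <= Delta + 2 * r + r ^+ 2.
Proof.
move=> r0 mu1 nu1 xr yr mn.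
have -> : dotv x y = dotv mu nu + dotv (x - mu) nu + dotv mu (y - nu) +
    dotv (x - mu) (y - nu).
  by rewrite /dotv -!big_split; apply: eq_bigr => j _; rewrite !mxE /=; ring.
have h1 := le_trans (ler_norm _) (dotv_le_norms (x - mu) nu).
have h2 := le_trans (ler_norm _) (dotv_le_norms mu (y - nu)).
have h3 := le_trans (ler_norm _) (dotv_le_norms (x - mu) (y - nu)).
have h4 : enorm (x - mu) * enorm (y - nu) <= r * r by apply: ler_pM; rewrite ?sqrtr_ge0.
rewrite mu1 nu1 mulr1 mul1r in h1 h2; rewrite expr2; lra.
Qed.

End Geometry.

Section Clusters.
Variables (R : realType) (n d : nat) (X : 'I_n -> 'rV[R]_d) (Y : 'I_n -> R).
Variables (eps r Delta : R).

(** Interface to the first step: [same] will be membership in one cluster, [opp] difference of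
    labels, and the remaining pairs lie in two clusters of one label. [e1] collects the geometric
    errors. *)
Record cluster_relations (same opp : rel 'I_n) (e1 : R) : Prop := {
  cr_unit : forall s, inner (augment (X s)) (augment (X s)) = 2;
  cr_label : forall s, Y s = 1 \/ Y s = -1;
  cr_same : forall s s', same s s' ->
    Y s' = Y s /\ 2 - e1 <= inner (augment (X s)) (augment (X s'));
  cr_split : forall s s', same s s' ->
    dotv (X s - X s') (X s - X s') <= 4 * r ^+ 2;
  cr_opp : forall s s', opp s s' ->
    Y s' = - Y s /\ inner (augment (X s)) (augment (X s')) <= 1 + e1;
  cr_rest : forall s s', ~~ same s s' -> ~~ opp s s' -> Y s' = Y s;
  cr_opp_exists : forall s, exists s', opp s s';
  cr_same_count : forall s, (4^-1 - eps) * n%:R <= \sum_s' (same s s')%:R;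
  cr_opp_count : forall s, \sum_s' (opp s s')%:R <= (2^-1 + 2 * eps) * n%:R }.

Lemma sum_indic (I : finType) (P : pred I) : \sum_i (P i)%:R = #|[pred i | P i]|%:R :> R.
Proof.
rewrite -sum1_card natr_sum [RHS]big_mkcond /=; apply: eq_bigr => i _.
by rewrite inE; case: (P i).
Qed.

Lemma cluster_data_relations (e1 : R) : (0 < n)%N -> eps < 4^-1 -> 0 <= r -> r <= 1 ->
  Delta + 3 * r <= e1 -> 2 * r <= e1 -> cluster_data X Y eps r Delta ->
  exists same opp : rel 'I_n, cluster_relations same opp e1.
Proof.
move=> n0 eps_lt r0 r1 e1a e1b [cl [mu]] /= [labE [X1 mu1] cnt near sep].
pose lab (k : 'I_4) : R := if (k < 2)%N then 1 else -1.
have {}labE s : Y s = lab (cl s) by exact: labE.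
have {}sep k l : lab k != lab l -> dotv (mu k) (mu l) <= Delta by exact: sep.
have one_neq : (1 : R) != -1 by rewrite -subr_eq0 opprK (_ : 1 + 1 = 2%:R)// pnatr_eq0.
have X1' s : dotv (X s) (X s) = 1 by rewrite -enorm_sqr X1 expr1n.
have rr : r ^+ 2 <= r by rewrite expr2 ler_piMl.
have labP k : lab k = 1 \/ lab k = -1 by rewrite /lab; case: ifP; [left|right].
exists (fun s s' => cl s == cl s'), (fun s s' => lab (cl s) != lab (cl s')); split.
- by move=> s; rewrite inner_augment X1'; ring.
- by move=> s; rewrite labE; exact: labP.
- move=> s s' /eqP ss; rewrite !labE ss; split => //.
  rewrite inner_augment.
  have near' := near s; rewrite ss in near'.
  have [_ h] := dotv_same_cluster (X1' s) (X1' s') near' (near s').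
  by lra.
- move=> s s' /eqP ss; have near' := near s; rewrite ss in near'.
  by have [] := dotv_same_cluster (X1' s) (X1' s') near' (near s').
- move=> s s' ss; split.
    by rewrite !labE; case: (labP (cl s)) (labP (cl s')) ss => -> [] ->; rewrite ?eqxx ?opprK.
  rewrite inner_augment.
  have := dotv_opposite_cluster r0 (mu1 _) (mu1 _) (near s) (near s') (sep _ _ ss).
  by lra.
- by move=> s s' _; rewrite negbK => /eqP ss; rewrite !labE ss.
- move=> s.
  (* Any cluster of the other label will do; it is nonempty because [eps < 4^-1]. *)
  pose k : 'I_4 := if (cl s < 2)%N then inord 2 else inord 0.
  have sk : lab (cl s) != lab k.
    rewrite /lab /k; case: ifP => _; rewrite inordK//= eq_sym//.
  have [k1 _] := cnt k.
  have : 0 < (4^-1 - eps) * n%:R by rewrite mulr_gt0 ?ltr0n// subr_gt0.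
  move=> /lt_le_trans /(_ k1); rewrite ltr0n => /card_gt0P[s']; rewrite inE => /eqP s'k.
  by exists s'; rewrite s'k.
- move=> s; have [k1 _] := cnt (cl s); apply: (le_trans k1).
  rewrite sum_indic ler_nat; apply: eq_leq; apply: eq_card => s'.
  by rewrite !inE eq_sym.
- move=> s.
  have -> : \sum_s' (lab (cl s) != lab (cl s'))%:R =
      \sum_(k < 4) (lab (cl s) != lab k)%:R * \sum_s' (cl s' == k)%:R :> R.
    under [RHS]eq_bigr do rewrite mulr_sumr.
    rewrite exchange_big; apply: eq_bigr => s' _ /=.
    rewrite (bigD1 (cl s'))//= eqxx mulr1 big1 ?addr0// => k /negbTE.
    by rewrite eq_sym => ->; rewrite mulr0.
  apply: (@le_trans _ _ (\sum_(k < 4) (lab (cl s) != lab k)%:R * ((4^-1 + eps) * n%:R))).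
    apply: ler_sum => k _; rewrite ler_wpM2l// sum_indic.
    by have [_] := cnt k.
  rewrite -mulr_suml mulrA ler_wpM2r//.
  (* Two of the four clusters carry the opposite label. *)
  have -> : \sum_(k < 4) (lab (cl s) != lab k)%:R = 2 :> R.
    rewrite !big_ord_recl big_ord0 /lab /=.
    have one_neq' : (-1 : R) != 1 by rewrite eq_sym.
    by case: ifP => _; rewrite ?eqxx ?one_neq ?one_neq' /=; ring.
  by lra.
Qed.

End Clusters.

(** * The good event at initialization *)

Section InitialEvent.
Variables (R : realType) (p d n : nat) (X : 'I_n -> 'rV[R]_d) (Y : 'I_n -> R).
Local Notation param := 'M[R]_(p.*2, d.+1).
Local Notation m := ((p.*2)%:R : R).
Local Notation z th i s := (preact th (X s) i).

(* [gap_unit] and [rho] are calibrated so that in [first_step_margin] the error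
   terms cost at most half of the gain [c / 4] with [c = 4 * gap_unit]. *)
Definition gap_unit : R := gap_const R / 16.
Definition rho : R := gap_unit / 192.

Lemma gap_unit_gt0 : 0 < gap_unit. Proof. by rewrite divr_gt0// gap_const_gt0. Qed.

Lemma rho_gt0 : 0 < rho. Proof. by rewrite divr_gt0// gap_unit_gt0. Qed.

Lemma gap_unit_le : gap_unit <= 16^-1.
Proof.
rewrite -[leRHS]mul1r ler_wpM2r ?invr_ge0// invf_le1; last by rewrite mulr_gt0 ?expR_gt0.
have : 1 <= expR 256 :> R by rewrite -[leLHS]expR0 ler_expR.
lra.
Qed.

Lemma rhoE : 192 * rho = gap_unit.
Proof. by rewrite /rho mulrC divfK// pnatr_eq0. Qed.

Lemma rho_le1 : rho <= 1.
Proof. have := rhoE; have := gap_unit_le; have := gap_unit_gt0; have := rho_gt0; lra. Qed.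

(** The bound on [r] gives [rho / r >= 8 / rho], after which [expR x >= 1 + x] suffices. *)
Lemma tail_le_rho (r : R) : 0 < r -> r <= rho ^+ 2 / 8 -> expR (2 - rho / r) <= rho.
Proof.
move=> r0 rr; have q0 := rho_gt0; have q1 := rho_le1.
have h1 : 8 / rho <= rho / r.
  rewrite ler_pdivlMr// mulrAC ler_pdivrMr// -expr2; lra.
have h2 : 1 <= rho^-1 by rewrite invf_ge1.
have h3 : rho^-1 <= expR (rho / r - 2) by apply: le_trans (expR_ge1Dx _); lra.
rewrite -(invrK rho) -[2 - _]opprB expRN lef_pV2 ?posrE ?expR_gt0 ?invr_gt0//.
by rewrite invrK.
Qed.

Lemma preact_sub (th : param) i s s' :
  z th i s - z th i s' = lin (fun j => augment (X s) j - augment (X s') j) (fun j => th i j).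
Proof. by rewrite /preact /lin -sumrB; apply: eq_bigr => j _; rewrite mulrBl. Qed.

Lemma inner_augment_sub s s' :
  inner (fun j => augment (X s) j - augment (X s') j)
        (fun j => augment (X s) j - augment (X s') j) =
  dotv (X s - X s') (X s - X s').
Proof.
rewrite /inner big_ord_recr /= !augment_bias subrr mulr0 addr0.
apply: eq_bigr => j _; rewrite /augment !mxE.
have -> : widen_ord (leqnSn d) j = lift ord_max j.
  by apply: val_inj; rewrite /= /bump leqNgt ltn_ord.
by rewrite liftK.
Qed.

Variables (eps r : R) (same opp : rel 'I_n) (sigma l : R).
Hypothesis p0 : (0 < p)%N.
Hypothesis n0 : (0 < n)%N.
Hypothesis sigma0 : 0 < sigma.
Hypothesis l0 : 0 < l.
Hypothesis ls : (l * sigma) ^+ 2 = p%:R^-1.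
Hypothesis lp : l <= p%:R.
Hypothesis r0 : 0 < r.
Hypothesis r_le : r <= rho ^+ 2 / 8.
Hypothesis cr : cluster_relations X Y eps r same opp (gap_unit / 16).

(** The counts allow four times the probability bound [rho], or ask for a quarter of
    [gap_const = 16 * gap_unit]; either way the Chernoff exponent stays proportional to [p]. *)
Definition good_init (th : param) : Prop :=
  [/\ forall s, `|net p%:R^-1 th (X s)| <= gap_unit / 24,
      forall s, \sum_i (`|z th i s| <= rho * sigma)%R%:R <= 4 * rho * m,
      forall s s', same s s' ->
        \sum_i (rho * sigma < z th i s - z th i s')%R%:R <= 4 * rho * m,
      forall s s', opp s s' ->
        4 * gap_unit * m <= \sum_i ((0 < z th i s) && (z th i s' < 0))%R%:R &
      fro2 th <= 8 * sigma ^+ 2 * (p * d.+1)%:R].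

(** Modelled on the output at initialization, where [8 * expR 4] is [2p * 4 * expR 4 / p]. The other
    events have exponents at least [rho * p], and [l <= p]. *)
Definition fail_bound : R := 2 * expR (8 * expR 4 - rho * l).

Let pR0 : 0 < p%:R :> R. Proof. by rewrite ltr0n. Qed.
Let mE : m = 2 * p%:R. Proof. by rewrite -mul2n natrM. Qed.

Lemma fail_bound_ge (x : R) : x <= - (rho * l) -> expR x <= fail_bound.
Proof.
move=> x1; apply: (@le_trans _ _ (expR (8 * expR 4 - rho * l))).
  by rewrite ler_expR; apply: (le_trans x1); rewrite lerDr mulr_ge0 ?expR_ge0.
by rewrite /fail_bound ler_peMl ?expR_ge0 ?ler1n.
Qed.

Let ls1 : l * sigma <= 1.
Proof.
rewrite -(@ler_pXn2r _ 2) ?nnegrE// ?(mulr_ge0 (ltW l0) (ltW sigma0))//.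
by rewrite expr1n ls invf_le1// ler1n.
Qed.

Let fb0 : 0 <= fail_bound. Proof. by rewrite mulr_ge0// expR_ge0. Qed.

Lemma whp_good_init : whp sigma good_init (10 * n%:R ^+ 2 * fail_bound).
Proof.
have u0 := gap_unit_gt0; have q0 := rho_gt0; have uq := rhoE; have u1 := gap_unit_le.
have lq : 0 < rho * l by rewrite mulr_gt0.
have lq2 : rho * l <= rho * p%:R by rewrite ler_wpM2l// ltW.
have HX := cr_unit cr.
have wF : whp sigma (fun th : param => forall s, `|net p%:R^-1 th (X s)| <= gap_unit / 24)
    (#|'I_n|%:R * fail_bound).
  apply: whp_forall => // s.
  apply: whp_sub
    (@whp_net_small _ _ _ _ sigma0 p0 (X s) l (gap_unit / 24) (HX s) l0 ls1) => //.
  rewrite ler_wpM2l// ler_expR ls mE lerB//.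
    rewrite le_eqVlt; apply/orP; left; apply/eqP; field; by rewrite gt_eqF.
  by rewrite mulrC ler_wpM2l ?(ltW l0)//; lra.
have wS : whp sigma (fun th : param => forall s,
    \sum_i (`|z th i s| <= rho * sigma)%R%:R <= 4 * rho * m) (#|'I_n|%:R * fail_bound).
  apply: whp_forall => // s.
  have mA : bcoord_measurable (fun g => `|lin (augment (X s)) g| <= rho * sigma).
    apply: bcoord_measurable_le; last exact: rcoord_measurable_cst.
    by apply: rcoord_measurable_comp; [exact: normr_measurable|exact: rcoord_measurable_lin].
  have rs0 : 0 <= rho * sigma by rewrite mulr_ge0 ?ltW.
  have qA := expect_ball sigma0 rs0 (augment_bias (X s)).
  rewrite mulfK ?gt_eqF// in qA.
  apply: whp_sub (whp_count_le p (4 * rho * m) mA qA) => //.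
  apply: fail_bound_ge; rewrite mE; lra.
have wT : whp sigma (fun th : param => forall k : 'I_n * 'I_n, same k.1 k.2 ->
    \sum_i (rho * sigma < z th i k.1 - z th i k.2)%R%:R <= 4 * rho * m)
    (#|{: 'I_n * 'I_n}|%:R * fail_bound).
  apply: whp_forall => // -[s s'] /=; apply: whp_implies => // ss.
  set w := fun j => augment (X s) j - augment (X s') j.
  have mA : bcoord_measurable (fun g => rho * sigma < lin w g).
    by apply: bcoord_measurable_lt; [exact: rcoord_measurable_cst|exact: rcoord_measurable_lin].
  have w4 : inner w w <= 4 * r ^+ 2 by rewrite inner_augment_sub (cr_split cr).
  have qA := @expect_tail _ _ _ sigma0 w r rho r0 w4.
  have qA' : (expect sigma (fun g => (rho * sigma < lin w g)%R%:R) <= rho%:E)%E.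
    by apply: (le_trans qA); rewrite lee_fin tail_le_rho.
  apply: whp_sub (whp_count_le p (4 * rho * m) mA qA').
    move=> th h; apply: le_trans h; rewrite le_eqVlt; apply/orP; left; apply/eqP.
    by apply: eq_bigr => i _; rewrite preact_sub.
  apply: fail_bound_ge; rewrite mE; lra.
have wD : whp sigma (fun th : param => forall k : 'I_n * 'I_n, opp k.1 k.2 ->
    4 * gap_unit * m <= \sum_i ((0 < z th i k.1) && (z th i k.2 < 0))%R%:R)
    (#|{: 'I_n * 'I_n}|%:R * fail_bound).
  apply: whp_forall => // -[s s'] /=; apply: whp_implies => // ss.
  have mA : bcoord_measurable (fun g =>
      (0 < lin (augment (X s)) g) && (lin (augment (X s')) g < 0)).
    by apply: bcoord_measurable_and; apply: bcoord_measurable_lt;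
      try exact: rcoord_measurable_cst; exact: rcoord_measurable_lin.
  have [_ k1] := cr_opp cr ss.
  have k2 : inner (augment (X s)) (augment (X s')) <= 1 + 10^-1 by lra.
  have /andP[k3 _] := inner_CS_bounds HX s s'.
  have qA := expect_gap sigma0 (HX s) (HX s') k2 k3.
  apply: whp_sub (whp_count_ge p (4 * gap_unit * m) mA qA) => //.
  apply: fail_bound_ge; have -> : gap_const R = 16 * gap_unit by rewrite /gap_unit; field.
  rewrite mE.
  have : rho * p%:R <= gap_unit * p%:R by rewrite ler_wpM2r ?(ltW pR0)//; lra.
  lra.
have wN : whp sigma (fun th : param => fro2 th <= 8 * sigma ^+ 2 * (p * d.+1)%:R) fail_bound.
  apply: whp_sub (whp_fro2 p d sigma0) => //; apply: fail_bound_ge; rewrite lerN2.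
  apply: (le_trans lq2); apply: (@le_trans _ _ (1 * p%:R)).
    by rewrite ler_wpM2r ?(ltW pR0)// rho_le1.
  by rewrite mul1r ler_nat leq_pmulr.
apply: whp_sub (whp_and wF (whp_and wS (whp_and wT (whp_and wD wN)))).
  move=> th [h1 [h2 [h3 [h4 h5]]]]; split => //.
  - by move=> s s'; exact: (h3 (s, s')).
  - by move=> s s'; exact: (h4 (s, s')).
rewrite card_prod card_ord natrM -expr2.
have nn : n%:R <= n%:R ^+ 2 :> R by rewrite expr2 ler_peMl// ler1n.
have n1 : 1 <= n%:R ^+ 2 :> R by rewrite -natrX ler1n expn_gt0 n0.
have h1 := ler_wpM2r fb0 nn; have h2 := ler_wpM2r fb0 n1.
rewrite mul1r in h2; have fb := fb0.
lra.
Qed.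

End InitialEvent.

(** * The parameters as powers of the width *)

Section Powers.
Variables (R : realType) (P : R).
Hypothesis P1 : 1 <= P.

Let P0 : 0 < P. Proof. exact: lt_le_trans P1. Qed.

Lemma powR_mul x y : P `^ x * P `^ y = P `^ (x + y).
Proof. by rewrite powRD// (gt_eqF P0) implybT. Qed.

Lemma powR_base : P = P `^ 1. Proof. by rewrite powRr1// ltW. Qed.

Lemma powR_le x y : x <= y -> P `^ x <= P `^ y.
Proof. exact: ler_powR. Qed.

(** Turns a multiplicative constant into an exponent: [Lg >= 3 / 2] gives [ln Lg >= 3^-1], so the
    power [3 * K] of [Lg] already exceeds [K]. *)
Lemma powR_ge (Lg K a C : R) : 3 / 2 <= Lg -> 0 <= K -> 0 < a -> 1 + 3 * K <= C * a ->
  Lg `^ C <= P -> K * Lg <= P `^ a.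
Proof.
move=> Lg32 K0 a0 Ca LP.
have Lg0 : 0 < Lg by lra.
apply: (@le_trans _ _ ((Lg `^ C) `^ a)); last first.
  by apply: ge0_ler_powR; rewrite ?nnegrE ?powR_ge0// ltW.
rewrite -powRrM; apply: (@le_trans _ _ (Lg `^ (1 + 3 * K))); last first.
  by apply: ler_powR => //; lra.
rewrite powRD; last by rewrite (gt_eqF Lg0) implybT.
rewrite powRr1 ?(ltW Lg0)// mulrC ler_wpM2l ?(ltW Lg0)//.
rewrite /powR (gt_eqF Lg0).
have h1 : expR 3^-1 <= Lg.
  apply: le_trans Lg32; have := ler_wpM2r (expR_ge0 (3^-1 : R)) (expR_ge1Dx (- 3^-1 : R)).
  by rewrite -expRD addNr expR0; lra.
have h2 : 3^-1 <= ln Lg by rewrite -ler_expR lnK ?posrE.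
have h3 : K * 3^-1 <= K * ln Lg by rewrite ler_wpM2l.
by apply: le_trans (expR_ge1Dx _); lra.
Qed.

End Powers.

Section GoodStart.
Variables (R : realType) (p d n : nat) (X : 'I_n -> 'rV[R]_d) (Y : 'I_n -> R).
Local Notation param := 'M[R]_(p.*2, d.+1).
Variables (eps r : R) (same opp : rel 'I_n) (sigma alpha : R).
Hypothesis p0 : (0 < p)%N.
Hypothesis n0 : (0 < n)%N.
Hypothesis alpha0 : 0 < alpha.
Hypothesis cr : cluster_relations X Y eps r same opp (gap_unit R / 16).
Hypothesis eps0 : 0 <= eps.
Hypothesis eps_le : eps <= gap_unit R / 16.
Hypothesis eta_ge : p%:R^-1 + 2 * alpha <= rho R * sigma.
Hypothesis gain_ge1 : 1 <= alpha * p%:R.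
Local Notation L := (loss (p := p) p%:R^-1 X Y).
Variable th : param.
Hypothesis good : good_init X same opp sigma th.
Local Notation th1 := (th - alpha *: gradL X Y th).

Lemma good_margin s : gap_unit R / 2 * (alpha * p%:R) <= Y s * net p%:R^-1 th1 (X s).
Proof.
have u0 := gap_unit_gt0 R; have u1 := gap_unit_le R; have uq := rhoE R; have q0 := rho_gt0 R.
have el := eps_le; have gg := gain_ge1; have [gF gS gT gD _] := good.
apply: le_trans (first_step_margin (e0 := gap_unit R / 24) (e1 := gap_unit R / 16)
  (b := 4 * rho R) (c := 4 * gap_unit R) p0 n0 (cr_unit cr) (cr_label cr) alpha0 _ _ _ _ eps0 _ _ _ eta_ge
  (cr_same cr) (cr_opp cr) (cr_rest cr) (cr_opp_exists cr) (cr_same_count cr)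
  (cr_opp_count cr) gF gS gT gD s); try lra.
(* Each of the four errors is at most [gap_unit / 8]. The factor 2 in [m = 2p] then pays for the
   initial output, because [alpha * p >= 1]. *)
have e1 : 4 * gap_unit R / 4 - 2 * eps - 3 * (gap_unit R / 24) - 2 * (gap_unit R / 16)
    - 6 * (4 * rho R) >= gap_unit R / 2 by lra.
have ap : 0 <= alpha * p%:R by lra.
rewrite -mul2n natrM.
have := ler_wpM2l ap e1.
have : gap_unit R * 1 <= gap_unit R * (alpha * p%:R) by rewrite ler_wpM2l// ltW.
by lra.
Qed.

Lemma good_loss : L th1 <= expR (- (gap_unit R / 2 * (alpha * p%:R))).
Proof.
rewrite lossE -[leRHS](mean_cst _ n0); apply: mean_le => s.
apply: le_trans (logi_le_exp _) _; rewrite ler_expR lerN2; exact: good_margin.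
Qed.

Lemma good_norm : fro2 th1 <=
  16 * sigma ^+ 2 * (p * d.+1)%:R + 8 * alpha ^+ 2 * p%:R.
Proof.
have [_ _ _ _ gN] := good.
have G1 := fro2_gradL_le p0 (cr_unit cr) (cr_label cr) (mean_sig_le1 X Y n0 th).
set G := gradL X Y th in G1 *.
have h1 : fro2 (th - alpha *: G) <= 2 * fro2 th + 2 * (alpha ^+ 2 * fro2 G).
  have := fro2_ge0 (th + alpha *: G).
  rewrite -[th - _]/(th + - _) -scaleNr !fro2D !fro2Z sqrrN.
  have -> : mxdot th (- alpha *: G) = - mxdot th (alpha *: G).
    rewrite /mxdot -sumrN; apply: eq_bigr => i _; rewrite -sumrN.
    by apply: eq_bigr => j _; rewrite !mxE; ring.
  by lra.
have h2 : alpha ^+ 2 * fro2 G <= alpha ^+ 2 * (4 * p%:R * 1 ^+ 2) by rewrite ler_wpM2l ?sqr_ge0.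
by apply: (le_trans h1); move: h2; rewrite expr1n; lra.
Qed.

End GoodStart.

(* Both [p^(beta/2)] and [p^(1/2 - beta)] will be at least this constant times
   [ln (n d / delta)]; the first summand serves the union bound, the second the
   hypothesis of [gd_convergence]. *)
Definition power_const (R : realType) : R := (24 + 8 * expR 4) / rho R + 48 / gap_unit R.

Theorem theorem2 (R : realType) (beta : R) :
  0 < beta < 2^-1 ->
  exists C2 C3 C4 C5 C6 : R,
    [/\ 0 < C2, 0 < C3, 0 < C4, 0 < C5 & 0 < C6] /\
    forall (delta : R) (n d p : nat) (X : 'I_n -> 'rV[R]_d) (Y : 'I_n -> R)
           (eps r Delta : R),
      0 < delta -> delta < 2^-1 -> (4 <= n)%N ->
      0 < eps -> 0 < r -> 0 < Delta ->
      cluster_data X Y eps r Delta ->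
      Delta < C2 -> r < C2 -> eps < C2 ->
      (ln ((n * d)%:R / delta)) `^ C3 <= p%:R ->
      let alpha0 := p%:R `^ (- (2^-1 + beta)) in
      let sigma := p%:R `^ (- (2^-1 + beta / 2)) in
      let h := p%:R^-1 in
      let L := loss (p := p) h X Y in
      (* (a) *)
      ((1 - delta)%:E <=
         gauss_mx_prob sigma
           [set th0 | (L (gd L (fun _ _ => alpha0) th0 1)
                        <= expR (- (C4 * p%:R `^ (2^-1 - beta))))%R])%E /\
      (* (b) *)
      ((1 - delta)%:E <=
         gauss_mx_prob sigma
           [set th0 | forall t : nat, (1 < t)%N -> (
              L (gd L (fun k th => if k == 0%N then alpha0
                                   else C5 * ln ((L th)^-1) ^+ 2 / p%:R) th0 t)
                <= C6 * d%:R / (p%:R `^ (1 - 3 * beta) * t%:R))%R])%E.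
Proof.
move=> /andP[b0 b1].
have u0 := gap_unit_gt0 R; have u1 := gap_unit_le R; have uq := rhoE R; have q0 := rho_gt0 R.
have q1 := rho_le1 R.
set K := power_const R.
have K1 : 24 + 8 * expR 4 <= K * rho R.
  rewrite /K /power_const (mulrDl _ _ (rho R)) divfK ?gt_eqF// lerDl.
  exact: (mulr_ge0 (divr_ge0 (ler0n _ _) (ltW u0)) (ltW q0)).
have e40 := expR_gt0 (4 : R).
have K2 : 48 <= K * gap_unit R.
  rewrite /K /power_const (mulrDl _ _ (gap_unit R)) (divfK (x := gap_unit R)) ?gt_eqF// lerDr.
  have e4n : 0 <= 24 + 8 * expR 4 :> R.
    exact: (addr_ge0 (ler0n _ _) (mulr_ge0 (ler0n _ _) (ltW e40))).
  exact: (mulr_ge0 (divr_ge0 e4n (ltW q0)) (ltW u0)).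
have K0 : 0 < K.
  by rewrite -(pmulr_lgt0 _ u0); apply: lt_le_trans K2.
have g0 : 0 < 2^-1 - beta by rewrite subr_gt0.
(* Adding the two inverses makes [C3] times either exponent at least [1 + 3 * K], as [powR_ge]
   requires. *)
pose C3 := (1 + 3 * K) * ((beta / 2)^-1 + (2^-1 - beta)^-1).
pose C4 := gap_unit R / 2.
have b20 : 0 < beta / 2 by rewrite divr_gt0.
have k30 : 0 < 1 + 3 * K by rewrite addr_gt0// mulr_gt0.
have C40 : 0 < C4 by rewrite divr_gt0.
(* The first witness is the radius of [tail_le_rho], [80^-1] is that of [gd_rate], and
   [80 * rate_const] is [2 * rate_const] from [gd_convergence] times the 40 in the norm bound
   [M]. *)
exists (rho R ^+ 2 / 8), C3, C4, 80^-1, (80 * rate_const R / C4 ^+ 4); split.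
  split.
  - exact: (divr_gt0 (exprn_gt0 2 q0) (ltr0Sn _ _)).
  - by apply: (mulr_gt0 k30); rewrite addr_gt0 ?invr_gt0.
  - exact: C40.
  - by rewrite invr_gt0 ltr0Sn.
  - apply: divr_gt0 (exprn_gt0 4 C40).
    exact: (mulr_gt0 (ltr0Sn _ _) (rate_const_gt0 R)).
move=> delta n d p X Y eps r Delta dl0 dl1 n4 eps0 r0 Delta0 cd DC rC eC LP.
move=> alpha sigma h L.
have n0 : (0 < n)%N by apply: leq_trans n4.
have q2 : rho R ^+ 2 <= rho R by rewrite expr2 ler_piMl// ltW.
have q28 : rho R ^+ 2 / 8 <= gap_unit R / 64 by lra.
(* In dimension 0 no input could have norm 1. *)
have d0 : (0 < d)%N.
  case: d X cd {LP L} => // X [cl [mu]] /= [_ [/(_ (Ordinal n0)) + _] _ _ _].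
  by rewrite /enorm /dotv big_ord0 sqrtr0 => /eqP; rewrite eq_sym oner_eq0.
have [same [opp cr]] : exists same opp : rel 'I_n,
    cluster_relations X Y eps r same opp (gap_unit R / 16).
  by apply: (cluster_data_relations n0 _ _ _ _ _ cd); lra.
set Lg := ln _ in LP.
have nR : 4 <= n%:R :> R by rewrite (ler_nat R 4 n).
have dR : 1 <= d%:R :> R by rewrite (ler_nat R 1 d).
pose M0 : R := (n * d)%:R / delta.
have nd : n%:R <= (n * d)%:R :> R by rewrite ler_nat leq_pmulr.
have M0n : 2 * n%:R <= M0.
  rewrite /M0 ler_pdivlMr//; apply: le_trans nd.
  by rewrite mulrAC ler_piMl// ?ler0n//; lra.
have M00 : 0 < M0 by lra.
have Lg32 : 3 / 2 <= Lg.
  rewrite -ler_expR lnK ?posrE//; apply: (@le_trans _ _ (2 ^+ 3)); last first.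
    by rewrite -/M0 (_ : 2 ^+ 3 = 8 :> R); [lra|ring].
  by rewrite expRM_natl lerXn2r ?nnegrE ?expR_ge0// expR_half_le2.
have P0 : 0 < p%:R :> R by apply: lt_le_trans LP; rewrite powR_gt0//; lra.
have p0 : (0 < p)%N by rewrite -(ltr0n R).
have P1 : 1 <= p%:R :> R by rewrite ler1n.
have bge : K * Lg <= p%:R `^ (beta / 2).
  apply: (powR_ge P1 Lg32 (ltW K0) b20 _ LP).
  have -> : C3 * (beta / 2) = (1 + 3 * K) + (1 + 3 * K) * ((2^-1 - beta)^-1 * (beta / 2)).
    rewrite /C3 -(mulrA (1 + 3 * K)) (mulrDl _ _ (beta / 2)) mulrDr.
    by rewrite (mulVf (x := beta / 2)) ?mulr1// gt_eqF.
  by rewrite lerDl; apply: mulr_ge0 (ltW k30) (mulr_ge0 _ (ltW b20)); rewrite invr_ge0 ltW.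
have gge : K * Lg <= p%:R `^ (2^-1 - beta).
  apply: (powR_ge P1 Lg32 (ltW K0) g0 _ LP).
  have -> : C3 * (2^-1 - beta) = (1 + 3 * K) * ((beta / 2)^-1 * (2^-1 - beta)) + (1 + 3 * K).
    rewrite /C3 -(mulrA (1 + 3 * K)) (mulrDl _ _ (2^-1 - beta)) mulrDr.
    by rewrite (mulVf (x := 2^-1 - beta)) ?mulr1// gt_eqF.
  by rewrite lerDr; apply: mulr_ge0 (ltW k30) (mulr_ge0 _ (ltW g0)); rewrite invr_ge0 ltW.
(* [Q] becomes the Chernoff parameter [l], and [G] is the gain [alpha * p]. *)
set Q := p%:R `^ (beta / 2) in bge; set G := p%:R `^ (2^-1 - beta) in gge *.
have Q0 : 0 < Q by rewrite powR_gt0.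
have alpha_gt0 : 0 < alpha by rewrite powR_gt0.
have sigma_gt0 : 0 < sigma by rewrite powR_gt0.
have PaG : alpha * p%:R = G.
  by rewrite /alpha /G [X in _ * X](powR_base P1) powR_mul//; congr (_ `^ _); field.
have Qs : (Q * sigma) ^+ 2 = p%:R^-1.
  by rewrite /Q /sigma powR_mul// expr2 powR_mul// -(powR_inv1 (ler0n R p)); congr (_ `^ _); field.
have QP : Q <= p%:R by rewrite [leRHS](powR_base P1); apply: powR_le => //; lra.
have aQ : alpha * Q = sigma by rewrite /alpha /Q /sigma powR_mul//; congr (_ `^ _); field.
have hQ : p%:R^-1 * Q <= sigma.
  rewrite /Q /sigma -(powR_inv1 (ler0n R p)) powR_mul//; apply: powR_le => //; lra.
have Lg0 : 0 < Lg by lra.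
have KLg : K <= K * Lg by rewrite ler_peMr ?(ltW K0)//; lra.
have Qq : 24 <= rho R * Q.
  have := ler_wpM2l (ltW q0) (le_trans KLg bge); rewrite (mulrC _ K) => h1.
  by apply: le_trans h1; apply: le_trans K1; rewrite lerDl mulr_ge0// ltW.
(* Multiplied by [Q], the left side is at most [3 * sigma], while [rho * Q >= 24]. *)
have eta_ge : p%:R^-1 + 2 * alpha <= rho R * sigma.
  rewrite -(ler_pM2r Q0).
  have h1 : 24 * sigma <= rho R * Q * sigma by rewrite ler_wpM2r// ltW.
  have -> : (p%:R^-1 + 2 * alpha) * Q = p%:R^-1 * Q + 2 * sigma by rewrite -aQ; ring.
  by move: hQ h1 sigma_gt0; rewrite (mulrAC _ Q sigma); lra.
have uG : 24 * (Lg + 1) <= gap_unit R * G.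
  have h1 : gap_unit R * (K * Lg) <= gap_unit R * G by rewrite ler_wpM2l// ltW.
  have h2 : 48 * Lg <= K * gap_unit R * Lg by rewrite ler_wpM2r// ltW.
  by apply: le_trans h1; rewrite mulrA (mulrC (gap_unit R)); apply: le_trans h2; lra.
have G1 : 1 <= G.
  have : 16^-1 * G >= gap_unit R * G by rewrite ler_wpM2r// ltW// powR_gt0.
  by lra.
have whp_good : whp sigma (good_init (p := p) X same opp sigma) delta.
  apply: whp_sub (whp_good_init p0 n0 sigma_gt0 Q0 Qs QP r0 (ltW rC) cr) => //.
  (* [expR (- 20) <= 20^-1] absorbs the constants [10 * 2] of the union bound, and
     [expR (- (2 * Lg)) = M0 ^- 2] absorbs [n ^+ 2], leaving at most [delta ^+ 2]. *)
  have h1 : 8 * expR 4 - rho R * Q <= - (20 + 2 * Lg).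
    have h2 := ler_wpM2l (ltW q0) bge; have h3 := ler_wpM2r (ltW Lg0) K1.
    have h4 : 8 * expR 4 * 1 <= 8 * expR 4 * Lg by rewrite ler_wpM2l ?mulr_ge0 ?(ltW e40)//; lra.
    by move: h2 h3 h4; rewrite mulrA (mulrC (rho R)); lra.
  have h5 : expR (- (20 + 2 * Lg)) <= 20^-1 * (M0 ^+ 2)^-1.
    rewrite opprD expRD; apply: ler_pM; rewrite ?expR_ge0//.
      by rewrite expRN lef_pV2 ?posrE ?expR_gt0//; apply: le_trans (expR_ge1Dx _); lra.
    rewrite expRN mulr_natl mulr2n expRD lnK ?posrE// -expr2//.
  have h6 : n%:R ^+ 2 * (M0 ^+ 2)^-1 <= delta.
    rewrite ler_pdivrMr ?exprn_gt0//.
    have h7 : n%:R <= delta * M0 by rewrite /M0 mulrC divfK ?gt_eqF.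
    have h8 : n%:R ^+ 2 <= (delta * M0) ^+ 2.
      by rewrite ler_pXn2r ?nnegrE//; exact: mulr_ge0 (ltW dl0) (ltW M00).
    apply: (le_trans h8); rewrite exprMn ler_wpM2r ?sqr_ge0// expr2 ler_piMl ?(ltW dl0)//; lra.
  rewrite /fail_bound.
  apply: (@le_trans _ _ (10 * n%:R ^+ 2 * (2 * (20^-1 * (M0 ^+ 2)^-1)))).
    rewrite ler_wpM2l ?mulr_ge0 ?sqr_ge0// ler_wpM2l//.
    by apply: le_trans h5; rewrite ler_expR.
  by apply: le_trans h6; rewrite le_eqVlt; apply/orP; left; apply/eqP; field; rewrite gt_eqF.
have HX := cr_unit cr; have HY := cr_label cr.
have eps_le : eps <= gap_unit R / 16 by lra.
have gain1 : 1 <= alpha * p%:R by rewrite PaG.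
split.
  apply: (@whp_prob _ sigma p d (fun th0 => L (gd L (fun _ _ => alpha) th0 1)
    <= expR (- (C4 * G)))).
  apply: whp_sub whp_good => // th good.
  rewrite /gd /L (gradE p0 HX HY) -PaG.
  exact: (good_loss p0 n0 alpha_gt0 cr (ltW eps0) eps_le eta_ge gain1 good).
set step := fun (k : nat) (th : 'M[R]_(p.*2, d.+1)) => if k == 0%N then alpha
  else 80^-1 * ln (L th)^-1 ^+ 2 / p%:R.
apply: (@whp_prob _ sigma p d (fun th0 => forall t, (1 < t)%N ->
  L (gd L step th0 t) <= 80 * rate_const R / C4 ^+ 4 * d%:R / (p%:R `^ (1 - 3 * beta) * t%:R))).
apply: whp_sub whp_good => // th good t t1.
(* From [16 * (d + 1) + 8 <= 40 * d]: [sigma ^+ 2 * p] equals the power of [p], and [alpha ^+ 2 * p]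
   is at most that. *)
pose M := 40 * d%:R * p%:R `^ (- beta).
have M_gt0 : 0 < M by rewrite mulr_gt0 ?powR_gt0// mulr_gt0// ltr0n.
have G0 : 0 < G by rewrite powR_gt0.
have gd1 : gd L step th 1 = th - alpha *: gradL X Y th.
  by rewrite /gd /step /L (gradE p0 HX HY).
have loss1 := good_loss p0 n0 alpha_gt0 cr (ltW eps0) eps_le eta_ge gain1 good.
have norm1 := good_norm alpha p0 n0 cr good.
rewrite -gd1 PaG -/C4 in loss1 norm1.
have l1 : C4 * G <= ln (L (gd L step th 1))^-1.
  rewrite -ler_expR lnK ?posrE ?invr_gt0 ?loss_gt0//.
  by rewrite -[C4 * G]opprK expRN lef_pV2 ?posrE ?expR_gt0 ?loss_gt0.
have big : 12 * (ln (2 * n%:R) + 1) <= C4 * G.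
  have : ln (2 * n%:R) <= Lg by rewrite ler_ln ?posrE//; lra.
  by rewrite /C4; lra.
have norm_le : fro2 (gd L step th 1) <= M.
  apply: (le_trans norm1).
  have e1 : sigma ^+ 2 * p%:R = p%:R `^ (- beta).
    by rewrite /sigma expr2 powR_mul// [X in _ * X](powR_base P1) powR_mul//; congr (_ `^ _); field.
  have e2 : alpha ^+ 2 * p%:R <= p%:R `^ (- beta).
    by rewrite /alpha expr2 powR_mul// [X in _ * X](powR_base P1) powR_mul//; apply: powR_le => //; lra.
  have -> : 16 * sigma ^+ 2 * (p * d.+1)%:R = 16 * p%:R `^ (- beta) * (d%:R + 1).
    by rewrite natrM -(natr1 d) -e1; ring.
  rewrite /M.
  have B0 : 0 < p%:R `^ (- beta) :> R by rewrite powR_gt0.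
  have : p%:R `^ (- beta) * 1 <= p%:R `^ (- beta) * d%:R :> R by rewrite ler_wpM2l// ltW.
  by lra.
have stepE k th' : (0 < k)%N -> step k th' = gd_rate X Y th'.
  by rewrite /step; case: k.
apply: le_trans (gd_convergence p0 n0 HX HY stepE big M_gt0 l1 norm_le t1) _.
rewrite le_eqVlt; apply/orP; left; apply/eqP.
have t0 : t%:R != 0 :> R by rewrite pnatr_eq0 -lt0n ltnW.
have W0 : p%:R `^ (1 - 3 * beta) != 0 :> R by rewrite gt_eqF// powR_gt0.
(* The identity [1 - beta + (1 - 3 * beta) = 4 * (2^-1 - beta)] fixes the exponent in the rate. *)
have e4 : p%:R * p%:R `^ (- beta) * p%:R `^ (1 - 3 * beta) = G ^+ 4.
  rewrite (_ : G ^+ 4 = G * G * (G * G)); last by ring.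
  by rewrite [X in X * _ * _](powR_base P1) /G !powR_mul//; congr (_ `^ _); field.
rewrite /M exprMn -e4; field.
by rewrite t0 W0 !gt_eqF// ?powR_gt0.
Qed.
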